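(* Let $p\in\mathbb{S}^2$. For every $f\in H^1(\mathbb{S}^2)$, $$\frac14\int_{\mathbb{S}^2}\frac{f^2}{\rho_\phi(d(x,p))^2}\,d\sigma\le S(f)+\frac{1}{2\pi}\int_{\mathbb{S}^2}\frac{f^2}{\pi-d(x,p)}\,d\sigma,$$ $$\frac14\int_{\mathbb{S}^2}\frac{f^2}{\rho_\phi(\pi-d(x,p))^2}\,d\sigma\le S(f)+\frac{1}{2\pi}\int_{\mathbb{S}^2}\frac{f^2}{d(x,p)}\,d\sigma.$$ Moreover, $$\sup_{f\in H^1(\mathbb{S}^2)\setminus\{0\}}\frac{\frac14\int_{\mathbb{S}^2}\frac{f^2}{\rho_\phi(d(x,p))^2}\,d\sigma}{S(f)+\frac{1}{2\pi}\int_{\mathbb{S}^2}\frac{f^2}{\pi-d(x,p)}\,d\sigma}=\sup_{f\in H^1(\mathbb{S}^2)\setminus\{0\}}\frac{\frac14\int_{\mathbb{S}^2}\frac{f^2}{\rho_\phi(\pi-d(x,p))^2}\,d\sigma}{S(f)+\frac{1}{2\pi}\int_{\mathbb{S}^2}\frac{f^2}{d(x,p)}\,d\sigma}=1,$$ and neither of these two suprema is attained by any $f\in H^1(\mathbb{S}^2)\setminus\{0\}$.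
   Context: $\mathbb{S}^2\subset\mathbb{R}^3$ is the unit sphere with its surface measure $\sigma$, $\nabla$ is the (weak) gradient on $\mathbb{S}^2$, and $d(x,p)\in[0,\pi]$ is the geodesic distance from $x$ to the fixed point $p$. Use spherical coordinates $(\theta,\varphi)$, $\theta\in[0,\pi]$, $\varphi\in[0,2\pi)$, with $p$ as the north pole, so that $\theta=d(x,p)$, $d\sigma=\sin\theta\,d\theta\,d\varphi$ and $\nabla=\hat\theta\,\partial_\theta+\hat\varphi\,\frac{1}{\sin\theta}\partial_\varphi$; here $\hat\theta$ is the unit tangent vector field in the direction of increasing $\theta$ (defined off $\pm p$), so $\hat\theta\cdot\nabla f=\partial f/\partial\theta$. $H^1(\mathbb{S}^2)$ is the real Sobolev space obtained as the completion of $C^\infty(\mathbb{S}^2)$ in the norm $\left(\|f\|_{L^2}^2+\|\nabla f\|_{L^2}^2\right)^{1/2}$; equivalently, the functions in $L^2(\mathbb{S}^2)$ whose weak gradient is in $L^2$. For $t\in(0,\pi]$ put $\phi(t)=\log(\pi e/t)$ and $\rho_\phi(t)=t\,\phi(t)$. Define $$S(f)=\int_{\mathbb{S}^2}|\hat\theta\cdot\nabla f|^2\,d\sigma+\frac{1}{2\pi^2}\int_{\mathbb{S}^2}f^2\,d\sigma.$$ *)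

(* Defs.v *)
From HB Require Import structures.
From mathcomp Require Import all_boot all_order all_algebra.
From mathcomp Require Import all_classical all_reals all_analysis.
From mathcomp Require Import measurable_realfun.

Set Implicit Arguments.
Unset Strict Implicit.
Unset Printing Implicit Defensive.

Import Order.TTheory GRing.Theory Num.Theory numFieldNormedType.Exports.

Local Open Scope classical_set_scope.
Local Open Scope ring_scope.

(* R^3 is the product type R * R * R rather than 'rV[R]_3: the product carries
   both the Borel sigma-algebra and the normed-module structure needed for
   derivatives. *)
Notation "'R3 R" := (R * R * R)%type (at level 8, R at level 2) : type_scope.

Section Sphere.
Context {R : realType}.
Local Open Scope ring_scope.

Definition dot (x y : 'R3 R) : R := x.1.1 * y.1.1 + x.1.2 * y.1.2 + x.2 * y.2.

Definition S2 : set ('R3 R) := [set x | dot x x = 1].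

(* The surface measure is the Borel measure on R^3, concentrated on S2, given
   by the standard parametrization (north pole e_3): the image of
   sin(theta) dtheta dphi on [0, pi] x [0, 2 pi[. *)
Definition sph (z : R * R) : 'R3 R :=
  (sin z.1 * cos z.2, sin z.1 * sin z.2, cos z.1).

Definition sph_density (z : R * R) : R :=
  sin z.1 * \1_(`[0, pi] `*` `[0, 2 * pi[) z.

Definition sigma (A : set ('R3 R)) : \bar R :=
  (\int[lebesgue_measure \x lebesgue_measure]_(z in sph @^-1` A)
    (sph_density z)%:E)%E.

Lemma measurable_sph : measurable_fun setT sph.
Proof.
have ms : measurable_fun setT (@sin R).
  apply: continuous_measurable_fun; exact: continuous_sin.
have mc : measurable_fun setT (@cos R).
  apply: continuous_measurable_fun; exact: continuous_cos.
have s1 : measurable_fun setT (fun z : R * R => sin z.1) by exact: measurableT_comp.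
apply: measurable_fun_pair; first apply: measurable_fun_pair.
- by apply: measurable_funM => //; exact: measurableT_comp.
- by apply: measurable_funM => //; exact: measurableT_comp.
- exact: measurableT_comp.
Qed.

Lemma sph_density_ge0 z : 0 <= sph_density z.
Proof.
rewrite /sph_density indicE; case: (boolP (z \in _)) => [|_]; last by rewrite mulr0.
rewrite inE => -[/= /[!in_itv]/= h _].
by rewrite mulr1 sin_ge0_pi.
Qed.

Lemma measurable_sph_density : measurable_fun setT sph_density.
Proof.
apply: measurable_funM.
  apply: (@measurableT_comp _ _ _ _ _ _ (@sin R) _ fst) => //.
  apply: continuous_measurable_fun; exact: continuous_sin.
by apply: measurable_indic; apply: measurableX.
Qed.

Let sigma0 : sigma set0 = 0%E.
Proof. by rewrite /sigma preimage_set0 integral_set0. Qed.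

Let sigma_ge0 A : (0 <= sigma A)%E.
Proof. by apply: integral_ge0 => z _; rewrite lee_fin sph_density_ge0. Qed.

Let sigma_semi_sigma_additive : semi_sigma_additive sigma.
Proof.
move=> F mF tF mUF; rewrite /sigma preimage_bigcup.
apply: (@semi_sigma_additive_nng_induced _ _ _
  (lebesgue_measure \x lebesgue_measure)%E (fun z => (sph_density z)%:E)).
- by apply/measurable_EFinP; exact: measurable_sph_density.
- by move=> z; rewrite lee_fin sph_density_ge0.
- by move=> n; rewrite -[X in measurable X]setTI; exact: measurable_sph.
- apply/trivIsetP => /= i j _ _ ij; rewrite -preimage_setI.
  by move/trivIsetP : tF => /(_ _ _ _ _ ij) ->//; rewrite preimage_set0.
- by rewrite -preimage_bigcup -[X in measurable X]setTI; exact: measurable_sph.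
Qed.

HB.instance Definition _ := isMeasure.Build _ _ _ sigma
  sigma0 sigma_ge0 sigma_semi_sigma_additive.

Fixpoint Cdiff (n : nat) (F : 'R3 R -> R) : Prop :=
  if n is m.+1 then
    (forall x, differentiable F x) /\ (forall v, Cdiff m (fun x => 'D_v F x))
  else continuous F.

Definition smooth (F : 'R3 R -> R) : Prop := forall n, Cdiff n F.

(* Gradient on the sphere: tangential part of the Euclidean gradient of an
   extension to R^3. *)
Definition egrad (F : 'R3 R -> R) (x : 'R3 R) : 'R3 R :=
  ('D_(1, 0, 0) F x, 'D_(0, 1, 0) F x, 'D_(0, 0, 1) F x).

Definition sgrad (F : 'R3 R -> R) (x : 'R3 R) : 'R3 R :=
  egrad F x - dot (egrad F x) x *: x.

(* An element of H^1(S^2), the completion of C^oo(S^2) in the H^1 norm: an L^2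
   function f and an L^2 field G such that (f, G) is the L^2 limit of pairs
   (u, grad u) with u smooth. Smooth functions on S^2 are the restrictions of
   smooth functions on R^3. G is the weak gradient of f, which determines it
   almost everywhere. Values outside S2 are irrelevant. *)
Record H1 := MkH1 {
  h1fun :> 'R3 R -> R ;
  grad : 'R3 R -> 'R3 R ;
  _ : measurable_fun S2 h1fun ;
  _ : measurable_fun S2 grad ;
  _ : (\int[sigma]_(x in S2) (h1fun x ^+ 2)%:E < +oo)%E ;
  _ : (\int[sigma]_(x in S2) (dot (grad x) (grad x))%:E < +oo)%E ;
  _ : exists u : nat -> 'R3 R -> R,
      [/\ forall n, smooth (u n),
          (\int[sigma]_(x in S2) ((u n x - h1fun x) ^+ 2)%:E)%E
            @[n --> \oo] --> 0%E
        & (\int[sigma]_(x in S2)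
            (dot (sgrad (u n) x - grad x) (sgrad (u n) x - grad x))%:E)%E
            @[n --> \oo] --> 0%E ] }.

(* f <> 0 in L^2; since the gradient is closable, this is f <> 0 in H^1. *)
Definition nonzero : set H1 :=
  [set f : H1 | ~ {ae sigma, forall x, S2 x -> f x = 0}].

(* Geodesic distance on S2. *)
Definition dist (x p : 'R3 R) : R := acos (dot x p).

(* Unit tangent vector at x in the direction of increasing distance to p. *)
Definition thetahat (p x : 'R3 R) : 'R3 R :=
  (sin (dist x p))^-1 *: (cos (dist x p) *: x - p).

Definition phi (t : R) : R := ln (pi * expR 1 / t).

Definition rho_phi (t : R) : R := t * phi t.

Definition energy (p : 'R3 R) (f : H1) : \bar R :=
  (\int[sigma]_(x in S2) (dot (thetahat p x) (grad f x) ^+ 2)%:E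
   + (1 / (2 * pi ^+ 2))%:E * \int[sigma]_(x in S2) (f x ^+ 2)%:E)%E.

(* The integrands below are nonnegative, so the integrals are taken in
   [0, +oo]; at the (null) points where a denominator vanishes the integrand is
   0 by the convention 1 / 0 = 0. *)
Definition hardy_lhs (t : 'R3 R -> R) (f : H1) : \bar R :=
  ((1 / 4)%:E * \int[sigma]_(x in S2) (f x ^+ 2 / rho_phi (t x) ^+ 2)%:E)%E.

Definition hardy_rhs (p : 'R3 R) (t : 'R3 R -> R) (f : H1) : \bar R :=
  (energy p f + (1 / (2 * pi))%:E * \int[sigma]_(x in S2) (f x ^+ 2 / t x)%:E)%E.

End Sphere.

Arguments H1 R : clear implicits.

(* Main.v *)
Require Import Defs.
From HB Require Import structures.
From mathcomp Require Import all_boot all_order all_algebra.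
From mathcomp Require Import all_classical all_reals all_analysis.
From mathcomp Require Import measurable_realfun ring lra.

(** Both inequalities are one-dimensional along the meridians of p. If U is a function
    on a meridian and m a multiplier with m' + m^2 / sin <= (W2 - W1) sin that is
    nonpositive at the left end and nonnegative at the right end, integrating the
    derivative of m U^2 and completing the square gives
    int W1 U^2 sin <= int U'^2 sin + int W2 U^2 sin ([hardy_1D]). The multiplier
    - sin / (2 rho_phi), suggested by the virtual ground state sqrt phi, handles
    W1 = 1 / (4 rho_phi^2) with
    W2 = (2 pi - t)^2 / (2 pi^3 (pi - t) phi t) ([hardy_riccati]); this comes down to
    an upper bound for 1/t - cot t ([sinB_tcos_le_rat]). Since ln x < x - 1 for
    x <> 1, this W2 is strictly smaller than the potential
    1/(2 pi^2) + 1/(2 pi (pi - t)) of the statement ([loss_lt]).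

    The surface measure is defined in coordinates about the north pole, so meridians
    of an arbitrary p require its rotation invariance ([sigma_rotE]). Tilting the pole
    changes the mean of a C1 function by the integral of a divergence, which vanishes
    ([sphere_mean_cst]); C1 approximations of indicators of octants then transfer
    the invariance to Borel sets.

    This gives the inequality for smooth functions. To reach H1, the multiplier
    (1 - cos) sin first shows that the H1 norm controls the weight 1/(pi - t), so
    that the potential terms converge along an approximating sequence
    ([pole_cvg0]); the singular term on the left is recovered by truncation of its
    weight ([hardy_closed_L2], [log_hardy_H1]).

    The strict inequality between the two potentials leaves a remainder that is
    positive unless f = 0 almost everywhere ([hardy_gap], [gap_norm_gt0]), whence the
    quotient is always less than 1. It approaches 1 along the smooth functions
    u = sqrt (ln (1 + 1/(|x - p|^2 + e^2))), a regularization of sqrt phi: the square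
    of u is about 2 phi at distances between e and 1, and both sides of the
    inequality are equal to pi ln (phi e) up to a bounded error
    ([peak_bounds], [hardy_sharp]).

    The second inequality is the first one for the antipode - p, whose distance
    function is pi - dist x p and whose polar direction is opposite. *)

Set Implicit Arguments.
Unset Strict Implicit.
Unset Printing Implicit Defensive.

Import Order.TTheory GRing.Theory Num.Theory numFieldNormedType.Exports.

Local Open Scope classical_set_scope.
Local Open Scope ring_scope.

(** * Derivatives, Taylor bounds and numerical bounds for pi *)

Section DeriveRules.
Context {R : realType}.
Implicit Types (f g : R -> R) (x a b : R).

Lemma der_cst x c : is_derive x 1 (fun=> c : R) (0 : R).
Proof. exact: is_derive_cst. Qed.

Lemma der_id x : is_derive x 1 (fun y : R => y) (1 : R).
Proof. exact: is_derive_id. Qed.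

Lemma derD f g x a b : is_derive x 1 f a -> is_derive x 1 g b ->
  is_derive x 1 (fun y => f y + g y) (a + b).
Proof. exact: is_deriveD. Qed.

Lemma derN f x a : is_derive x 1 f a -> is_derive x 1 (fun y => - f y) (- a).
Proof. exact: is_deriveN. Qed.

Lemma derM f g x a b : is_derive x 1 f a -> is_derive x 1 g b ->
  is_derive x 1 (fun y => f y * g y) (f x * b + g x * a).
Proof. exact: is_deriveM. Qed.

Lemma der_comp h f x a b : is_derive (f x) 1 h b -> is_derive x 1 f a ->
  is_derive x 1 (fun y => h (f y)) (b * a).
Proof. exact: is_derive1_comp. Qed.

Lemma derX f x a n : is_derive x 1 f a ->
  is_derive x 1 (fun y => f y ^+ n.+1) (n.+1%:R * f x ^+ n * a).
Proof.
move=> df; elim: n => [|n ih]; first by eapply is_derive_eq; [exact: df|ring].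
rewrite (_ : (fun y => _) = (fun y => f y * f y ^+ n.+1)); last first.
  by apply/funext => y; rewrite exprS.
by apply: (is_derive_eq (derM df ih)); rewrite !exprS; ring.
Qed.

Lemma derV f x a : f x != 0 -> is_derive x 1 f a ->
  is_derive x 1 (fun y => (f y)^-1) (- f x ^- 2 * a).
Proof. exact: is_deriveV. Qed.

Lemma der_ln f x a : 0 < f x -> is_derive x 1 f a ->
  is_derive x 1 (fun y => ln (f y)) ((f x)^-1 * a).
Proof. by move=> f0; apply: der_comp; exact: is_derive1_ln. Qed.

Lemma der_exp f x a : is_derive x 1 f a ->
  is_derive x 1 (fun y => expR (f y)) (expR (f x) * a).
Proof. by apply: der_comp; exact: is_derive_expR. Qed.

Lemma der_sin f x a : is_derive x 1 f a ->
  is_derive x 1 (fun y => sin (f y)) (cos (f x) * a).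
Proof. by apply: der_comp; exact: is_derive_sin. Qed.

Lemma der_cos f x a : is_derive x 1 f a ->
  is_derive x 1 (fun y => cos (f y)) (- sin (f x) * a).
Proof. by apply: der_comp; exact: is_derive_cos. Qed.

Lemma is_derive_continuous f x a : is_derive x 1 f a -> {for x, continuous f}.
Proof.
by move=> [df _]; apply: differentiable_continuous; apply/derivable1_diffP.
Qed.

End DeriveRules.

Ltac der := first
  [ eassumption | eapply der_cst | eapply der_id
  | eapply derX; der | eapply derD; der | eapply derN; der | eapply derM; der
  | eapply derV; [|der] | eapply der_ln; [|der] | eapply der_exp; der
  | eapply der_sin; der | eapply der_cos; der | idtac ].

Section Trig.
Context {R : realType}.
Implicit Types (f g : R -> R) (x s t : R).

Lemma ge0_of_derive_ge0 f df (b : R) :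
  (forall x, is_derive x 1 f (df x)) -> f 0 = 0 ->
  (forall x, 0 < x < b -> 0 <= df x) -> forall x, 0 <= x <= b -> 0 <= f x.
Proof.
move=> dfE f0 df0 x /andP[x0 xb].
have cf : continuous f by move=> y; exact: is_derive_continuous (dfE y).
rewrite -f0; apply: (@ger0_derive1_ndecr R f 0 b); rewrite ?lexx//.
- by move=> y; rewrite in_itv/= => yb; rewrite derive1E (@derive_val _ _ _ _ _ _ _ (dfE y)) df0.
- exact: continuous_subspaceT.
Qed.

Lemma cos_ge_deg2 t : 0 <= t -> 1 - t ^+ 2 / 2 <= cos t.
Proof.
move=> t0; rewrite -subr_ge0.
apply: (@ge0_of_derive_ge0 (fun t => cos t - (1 - t ^+ 2 / 2)) (fun t => t - sin t) t).
- by move=> x; eapply is_derive_eq; [der|rewrite /=; field].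
- by rewrite cos0 expr0n/=; lra.
- move=> x /andP[x0 _].
  apply: (@ge0_of_derive_ge0 (fun t => t - sin t) (fun t => 1 - cos t) x).
  + by rewrite sin0 subr0.
  + by move=> y _; rewrite subr_ge0 cos_le1.
  + by rewrite (ltW x0) lexx.
- by rewrite t0 lexx.
Qed.

Lemma sin_ge_deg3 t : 0 <= t -> t - t ^+ 3 / 6 <= sin t.
Proof.
move=> t0; rewrite -subr_ge0.
apply: (@ge0_of_derive_ge0 (fun t => sin t - (t - t ^+ 3 / 6)) (fun t => cos t - (1 - t ^+ 2 / 2)) t).
- by move=> x; eapply is_derive_eq; [der|rewrite /=; field].
- by rewrite sin0 expr0n/=; lra.
- by move=> x /andP[x0 _]; rewrite subr_ge0 cos_ge_deg2// ltW.
- by rewrite t0 lexx.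
Qed.

Lemma cos_le_deg4 t : 0 <= t -> cos t <= 1 - t ^+ 2 / 2 + t ^+ 4 / 24.
Proof.
move=> t0; rewrite -subr_ge0.
apply: (@ge0_of_derive_ge0 (fun t => 1 - t ^+ 2 / 2 + t ^+ 4 / 24 - cos t)
   (fun t => sin t - (t - t ^+ 3 / 6)) t).
- by move=> x; eapply is_derive_eq; [der|rewrite /=; field].
- by rewrite cos0 !expr0n/=; lra.
- by move=> x /andP[x0 _]; rewrite subr_ge0 sin_ge_deg3// ltW.
- by rewrite t0 lexx.
Qed.

Lemma sin_le_deg5 t : 0 <= t -> sin t <= t - t ^+ 3 / 6 + t ^+ 5 / 120.
Proof.
move=> t0; rewrite -subr_ge0.
apply: (@ge0_of_derive_ge0 (fun t => t - t ^+ 3 / 6 + t ^+ 5 / 120 - sin t)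
   (fun t => 1 - t ^+ 2 / 2 + t ^+ 4 / 24 - cos t) t).
- by move=> x; eapply is_derive_eq; [der|rewrite /=; field].
- by rewrite sin0 !expr0n/=; lra.
- by move=> x /andP[x0 _]; rewrite subr_ge0 cos_le_deg4// ltW.
- by rewrite t0 lexx.
Qed.

Lemma cos_ge_deg6 t : 0 <= t ->
  1 - t ^+ 2 / 2 + t ^+ 4 / 24 - t ^+ 6 / 720 <= cos t.
Proof.
move=> t0; rewrite -subr_ge0.
apply: (@ge0_of_derive_ge0 (fun t => cos t - (1 - t ^+ 2 / 2 + t ^+ 4 / 24 - t ^+ 6 / 720))
   (fun t => t - t ^+ 3 / 6 + t ^+ 5 / 120 - sin t) t).
- by move=> x; eapply is_derive_eq; [der|rewrite /=; field].
- by rewrite cos0 !expr0n/=; lra.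
- by move=> x /andP[x0 _]; rewrite subr_ge0 sin_le_deg5// ltW.
- by rewrite t0 lexx.
Qed.

Lemma sin_ge_deg7 t : 0 <= t ->
  t - t ^+ 3 / 6 + t ^+ 5 / 120 - t ^+ 7 / 5040 <= sin t.
Proof.
move=> t0; rewrite -subr_ge0.
apply: (@ge0_of_derive_ge0 (fun t => sin t - (t - t ^+ 3 / 6 + t ^+ 5 / 120 - t ^+ 7 / 5040))
   (fun t => cos t - (1 - t ^+ 2 / 2 + t ^+ 4 / 24 - t ^+ 6 / 720)) t).
- by move=> x; eapply is_derive_eq; [der|rewrite /=; field].
- by rewrite sin0 !expr0n/=; lra.
- by move=> x /andP[x0 _]; rewrite subr_ge0 cos_ge_deg6// ltW.
- by rewrite t0 lexx.
Qed.

(** The value cos (pi / 2) = 0 is confronted with the Taylor polynomials of cos of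
    degree 6 (lower bound) and 4 (upper bound). *)
Lemma pi_bounds : 313 / 100 < (pi : R) /\ (pi : R) < 319 / 100.
Proof.
have := @pihalf_02 R; move=> /andP[p0 p2]; split.
- rewrite ltNge; apply/negP => pile.
  have : 0 < cos (pi / 2 : R).
    apply: lt_le_trans (cos_ge_deg6 (ltW p0)).
    set y := pi / 2; have y0 : 0 < y by [].
    have y1 : y <= 313 / 200 by rewrite /y; lra.
    have z1 : y * y <= 49 / 20 by nra.
    have z0 : 0 <= y * y by nra.
    rewrite (_ : y ^+ 2 = y * y); last by ring.
    rewrite (_ : y ^+ 4 = (y * y) ^+ 2); last by ring.
    rewrite (_ : y ^+ 6 = (y * y) ^+ 3); last by ring.
    move: (y * y) z0 z1 => z z0 z1.
    have h1 : 0 <= (49 / 20 - z) * z by rewrite mulr_ge0//; lra.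
    have h2 : 0 <= (49 / 20 - z) * z * z by rewrite !mulr_ge0//; lra.
    rewrite !exprS expr0; nra.
  by rewrite cos_pihalf ltxx.
- rewrite ltNge; apply/negP => pige.
  have q0 : 0 <= 319 / 200 :> R by lra.
  have : 0 <= cos (319 / 200 : R) by apply: cos_ge0_pihalf; lra.
  apply/negP; rewrite -ltNge.
  by apply: le_lt_trans (cos_le_deg4 q0) _; lra.
Qed.

Lemma sinB_tcos_ge0 t : 0 <= t <= pi -> 0 <= sin t - t * cos t.
Proof.
apply: (@ge0_of_derive_ge0 (fun t => sin t - t * cos t) (fun t => t * sin t)).
- by move=> x; eapply is_derive_eq; [der|rewrite /=; ring].
- by rewrite sin0 mul0r subr0.
- by move=> x /andP[x0 xp]; rewrite mulr_ge0 ?(ltW x0)// sin_ge0_pi// !ltW.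
Qed.

(** The derivative of sin t - t cos t is t sin t, so the Taylor upper bound for
    sin is integrated once more. *)
Lemma sinB_tcos_le t : 0 <= t ->
  sin t - t * cos t <= t ^+ 3 / 3 - t ^+ 5 / 30 + t ^+ 7 / 840.
Proof.
move=> t0; rewrite -subr_ge0.
apply: (@ge0_of_derive_ge0
   (fun t => t ^+ 3 / 3 - t ^+ 5 / 30 + t ^+ 7 / 840 - (sin t - t * cos t))
   (fun t => t * (t - t ^+ 3 / 6 + t ^+ 5 / 120 - sin t)) t).
- by move=> x; eapply is_derive_eq; [der|rewrite /=; field].
- by rewrite sin0 !expr0n/=; lra.
- by move=> x /andP[x0 _]; rewrite mulr_ge0 ?(ltW x0)// subr_ge0 sin_le_deg5// ltW.
- by rewrite t0 lexx.
Qed.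

(** The bound cot s <= 1/s - s/3, freed of denominators: the derivative of the
    difference is s/3 times sin s - s cos s. *)
Lemma scos_le s : 0 <= s <= pi -> s * cos s <= (1 - s ^+ 2 / 3) * sin s.
Proof.
move=> s0; rewrite -subr_ge0.
apply: (@ge0_of_derive_ge0
   (fun s => (1 - s ^+ 2 / 3) * sin s - s * cos s)
   (fun s => s / 3 * (sin s - s * cos s)) pi) => //.
- by move=> x; eapply is_derive_eq; [der|rewrite /=; field].
- by rewrite sin0 expr0n/= mulr0 mul0r subr0.
- move=> x /andP[x0 xp]; rewrite mulr_ge0 ?divr_ge0 ?(ltW x0)//.
  by rewrite sinB_tcos_ge0// !ltW.
Qed.

End Trig.

(** * An upper bound for 1/t - cot t *)

Section CotBound.
Context {R : realType}.
Implicit Types (s t : R).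

(** All coefficients of the difference in the Bernstein basis of degree 8 on
    [0, 9/5] are nonnegative; 319/100 stands for an upper bound of pi. *)
Lemma poly_bound t : 0 <= t <= 9 / 5 ->
  (1 / 3 - t ^+ 2 / 30 + t ^+ 4 / 840) * ((319 / 100) ^+ 3 * (319 / 100 - t)) <=
  (2 * (319 / 100) - t) ^+ 2 * (1 - t ^+ 2 / 6 + t ^+ 4 / 120 - t ^+ 6 / 5040).
Proof.
move=> /andP[t0 t1].
have B k l : 0 <= t ^+ k * (9 / 5 - t) ^+ l.
  by rewrite mulr_ge0 ?exprn_ge0 ?subr_ge0.
have := (B 0 8, B 1 7, B 2 6, B 3 5, B 4 4, B 5 3, B 6 2, B 7 1, B 8 0)%N.
move=> [[[[[[[[]]]]]]]]; lra.
Qed.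

(** Away from pi, Taylor polynomials reduce the claim to [poly_bound]. Both sides
    depend on pi through A = pi (pi - t), because (2 pi - t)^2 = 4 A + t^2 and
    pi^3 (pi - t) = pi^2 A, and the inequality for a larger value of pi implies the
    one for a smaller value. *)
Lemma sinB_tcos_le_small t : 0 < t <= 9 / 5 ->
  (sin t - t * cos t) * (pi ^+ 3 * (pi - t)) <= t ^+ 2 * (2 * pi - t) ^+ 2 * sin t.
Proof.
move=> /andP[t0 t1]; have [p1 p2] := @pi_bounds R.
have := poly_bound; move=> /(_ t); rewrite (ltW t0) t1 => /(_ isT).
have := sinB_tcos_le (ltW t0); have := sin_ge_deg7 (ltW t0).
set q : R := pi; rewrite -/q in p1 p2; set Q : R := 319 / 100.
have qQ : q < Q by [].
set S := 1 - t ^+ 2 / 6 + t ^+ 4 / 120 - t ^+ 6 / 5040.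
set k := 1 / 3 - t ^+ 2 / 30 + t ^+ 4 / 840.
rewrite (_ : t - _ + _ - _ = t * S); last by rewrite /S; field.
rewrite (_ : t ^+ 3 / 3 - _ + _ = t ^+ 3 * k); last by rewrite /k; field.
have x1 : t * t <= 13 / 4 by nra.
have x0 : 0 <= t * t by nra.
have S0 : 0 <= S.
  rewrite /S (_ : t ^+ 2 = t * t); last by ring.
  rewrite (_ : t ^+ 4 = (t * t) ^+ 2); last by ring.
  rewrite (_ : t ^+ 6 = (t * t) ^+ 3); last by ring.
  have x2 : 0 <= 13 / 4 - t * t by rewrite subr_ge0.
  have := mulr_ge0 (mulr_ge0 x2 x0) x0.
  move: (t * t) x0 x1 => z z0 z1 h; nra.
have k0 : 0 <= k.
  rewrite /k (_ : t ^+ 2 = t * t); last by ring.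
  rewrite (_ : t ^+ 4 = (t * t) ^+ 2); last by ring.
  move: (t * t) x0 x1 => z z0 z1; nra.
move: (sin t) (cos t) => s c sS ck; move: k k0 ck S S0 sS => k k0 ck S S0 sS kS.
pose a := q * (q - t); pose A := Q * (Q - t).
have a0 : 0 < a by rewrite mulr_gt0//; lra.
have aA : a <= A by rewrite /a /A ler_pM//; lra.
have A0 : 0 < A by rewrite (lt_le_trans a0).
rewrite (_ : (2 * Q - t) ^+ 2 = 4 * A + t ^+ 2) in kS; last by rewrite /A; ring.
rewrite (_ : Q ^+ 3 * _ = Q ^+ 2 * A) in kS; last by rewrite /A; ring.
have h1 : k * (Q ^+ 2 * a) <= (4 * a + t ^+ 2) * S.
  rewrite -(ler_pM2r A0).
  apply: (@le_trans _ _ (a * ((4 * A + t ^+ 2) * S))).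
    have -> : k * (Q ^+ 2 * a) * A = a * (k * (Q ^+ 2 * A)) by ring.
    by rewrite ler_wpM2l// ltW.
  rewrite -subr_ge0 (_ : _ - _ = (A - a) * (t ^+ 2 * S)); last by ring.
  by rewrite mulr_ge0 ?subr_ge0// mulr_ge0// sqr_ge0.
have h2 : k * (q ^+ 2 * a) <= (4 * a + t ^+ 2) * S.
  apply: le_trans h1; rewrite ler_wpM2l// ler_pM2r// ler_sqr ?nnegrE ?ltW//.
  - lra.
  - by rewrite /Q; lra.
rewrite (_ : (2 * q - t) ^+ 2 = 4 * a + t ^+ 2); last by rewrite /a; ring.
rewrite (_ : q ^+ 3 * _ = q ^+ 2 * a); last by rewrite /a; ring.
have qa0 : 0 <= q ^+ 2 * a by rewrite mulr_ge0 ?sqr_ge0// ltW.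
apply: (@le_trans _ _ (t ^+ 3 * k * (q ^+ 2 * a))); first by rewrite ler_wpM2r.
apply: (@le_trans _ _ (t ^+ 3 * ((4 * a + t ^+ 2) * S))).
  by rewrite -mulrA ler_wpM2l// exprn_ge0// ltW.
rewrite (_ : t ^+ 3 * _ = t ^+ 2 * (4 * a + t ^+ 2) * (t * S)); last by ring.
by rewrite ler_wpM2l// mulr_ge0 ?sqr_ge0// addr_ge0 ?sqr_ge0// mulr_ge0 ?ltW.
Qed.

(** Near pi the cotangent blows up; with s = pi - t it is controlled by
    cot s <= 1/s - s/3. *)
Lemma sinB_tcos_le_large t : 9 / 5 <= t < pi ->
  (sin t - t * cos t) * (pi ^+ 3 * (pi - t)) <= t ^+ 2 * (2 * pi - t) ^+ 2 * sin t.
Proof.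
move=> /andP[t1 tp]; have [p1 p2] := @pi_bounds R.
pose s := pi - t; have st : t = pi - s by rewrite /s; ring.
have s0 : 0 < s by rewrite subr_gt0.
have := @scos_le R s; rewrite (ltW s0) {1}/s => /(_ _)P0; have := P0 ltac:(by rewrite /s; lra); clear P0.
have -> : sin t = sin s by rewrite st sinB sinpi cospi; ring.
have -> : cos t = - cos s by rewrite st cosB sinpi cospi; ring.
have sp : 0 < sin s by apply: sin_gt0_pi; rewrite s0/= /s; lra.
rewrite (_ : pi - t = s) // (_ : 2 * pi - t = pi + s); last by rewrite /s; ring.
move: (sin s) sp (cos s) => S S0 c cS.
set q : R := pi; rewrite -/q in p1 p2 st.
have t0 : 0 < t by lra.
have q0 : 0 < q by lra.
apply: (@le_trans _ _ (q ^+ 3 * (S * (s + t * (1 - s ^+ 2 / 3))))).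
  rewrite (_ : _ * (q ^+ 3 * s) = q ^+ 3 * (S * s + t * (s * c))); last by ring.
  rewrite ler_pM2l ?exprn_gt0// (_ : S * (s + _) = S * s + t * ((1 - s ^+ 2 / 3) * S)); last by ring.
  by rewrite lerD2l ler_pM2l.
rewrite (_ : q ^+ 3 * _ = q ^+ 3 * (s + t * (1 - s ^+ 2 / 3)) * S); last by ring.
rewrite ler_pM2r//.
have key : 0 <= q ^+ 2 * (q * t / 3 - 2) + s ^+ 2.
  have [qt|qt] := leP 6 (q * t).
    by rewrite addr_ge0 ?sqr_ge0// mulr_ge0 ?sqr_ge0//; lra.
  have t2 : t <= 48 / 25 by nra.
  have s2 : 6 / 5 <= s by rewrite /s; lra.
  have s3 : 7 / 5 <= s ^+ 2 by rewrite expr2; nra.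
  have q2 : q ^+ 2 <= 51 / 5 by rewrite expr2; nra.
  have qt1 : 0 <= q * t / 3 - 2 + 1 / 8 by nra.
  have := mulr_ge0 (sqr_ge0 q) qt1.
  rewrite mulrDr; lra.
rewrite -subr_ge0 (_ : _ - _ = s ^+ 2 * (q ^+ 2 * (q * t / 3 - 2) + s ^+ 2)).
  by rewrite mulr_ge0// sqr_ge0.
by rewrite st; field.
Qed.

(** This is 1/t - cot t <= t (2 pi - t)^2 / (pi^3 (pi - t)), the inequality on which
    the Riccati inequality for the logarithmic weight rests; both sides are
    equivalent to 1/(pi - t) at t = pi. *)
Lemma sinB_tcos_le_rat t : 0 < t < pi ->
  (sin t - t * cos t) * (pi ^+ 3 * (pi - t)) <= t ^+ 2 * (2 * pi - t) ^+ 2 * sin t.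
Proof.
move=> /andP[t0 tp]; have [t1|/ltW t1] := leP t (9 / 5).
  by apply: sinB_tcos_le_small; rewrite t0.
by apply: sinB_tcos_le_large; rewrite t1.
Qed.

End CotBound.

(** * Two Riccati inequalities *)

Ltac nz := repeat split; repeat (apply/andP; split); by rewrite ?gt_eqF.

Section Weights.
Context {R : realType}.
Implicit Types t : R.

Lemma phiE t : 0 < t -> phi t = 1 - ln (t / pi).
Proof.
move=> t0; have p0 := @pi_gt0 R; have e0 := @expR_gt0 R 1.
rewrite /phi !ln_div ?posrE ?mulr_gt0// lnM ?posrE// expRK; ring.
Qed.

Lemma phi_ge t : 0 < t -> 2 - t / pi <= phi t.
Proof.
move=> t0; rewrite phiE//; have p0 := @pi_gt0 R.
have := @le_ln1Dx R (t / pi - 1); rewrite (_ : 1 + _ = t / pi); last by ring.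
by move=> /(_ _)P0; have := P0 ltac:(by rewrite ltrBrDl addrN divr_gt0); lra.
Qed.

Lemma phi_gt t : 0 < t -> t < pi -> 2 - t / pi < phi t.
Proof.
move=> t0 tp; rewrite phiE//; have p0 := @pi_gt0 R.
have x0 : 0 < t / pi by rewrite divr_gt0.
have : 1 + ln (t / pi) < expR (ln (t / pi)).
  apply: expR_gt1Dx; rewrite lt_eqF// ln_lt0// x0/=.
  by rewrite ltr_pdivrMr// mul1r.
by rewrite lnK ?posrE//; lra.
Qed.

Lemma phi_ge1 t : 0 < t <= pi -> 1 <= phi t.
Proof.
move=> /andP[t0 tp]; apply: le_trans (phi_ge t0).
by rewrite lerBrDr -lerBrDl (_ : 2 - 1 = 1 :> R) ?ler_pdivrMr ?pi_gt0 ?mul1r//; ring.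
Qed.

Lemma rho_phi_ge t : 0 < t <= pi -> t <= rho_phi t.
Proof.
by move=> tp; have /andP[t0 _] := tp; rewrite /rho_phi ler_peMr ?(ltW t0) ?phi_ge1.
Qed.

(** The potential that makes [hardy_m] satisfy its Riccati inequality; it lies below
    the potential [loss_bound] of the right-hand side. *)
Definition loss t : R := (2 * pi - t) ^+ 2 / (2 * pi ^+ 3 * (pi - t) * phi t).

Definition loss_bound t : R := 1 / (2 * pi ^+ 2) + 1 / (2 * pi) / (pi - t).

Lemma loss_ge0 t : 0 < t < pi -> 0 <= loss t.
Proof.
move=> /andP[t0 tp]; rewrite /loss divr_ge0 ?sqr_ge0// mulr_ge0//.
  by rewrite mulr_ge0 ?subr_ge0 ?(ltW tp)// mulr_ge0// exprn_ge0// pi_ge0.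
by rewrite (le_trans ler01)// phi_ge1// t0 ltW.
Qed.

(** The potential [loss_bound] equals (2 pi - t) / (2 pi^2 (pi - t)), so the claim is
    phi t > 2 - t / pi, that is, the strict inequality ln x < x - 1 at x = t / pi.
    This strictness is the reason why no function attains the supremum. *)
Lemma loss_lt t : 0 < t < pi -> loss t < loss_bound t.
Proof.
move=> /andP[t0 tp]; have p0 := @pi_gt0 R.
have s0 : 0 < pi - t by rewrite subr_gt0.
have f1 : 0 < phi t by rewrite (lt_le_trans ltr01)// phi_ge1// t0 ltW.
have r0 : 0 < 2 * pi - t by lra.
have := phi_gt t0 tp => h.
have -> : loss_bound t = (2 * pi - t) / (2 * pi ^+ 2 * (pi - t)).
  rewrite /loss_bound; clear -p0 s0; move: (pi : R) p0 s0 => q p0 s0.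
  by field; nz.
rewrite /loss ltr_pdivrMr; last by rewrite !mulr_gt0 ?exprn_gt0.
rewrite (_ : _ / _ * _ = (2 * pi - t) * (pi * phi t)); last first.
  by clear -p0 s0 f1; move: (pi : R) (phi t) p0 s0 f1 => q f p0 s0 f1; field; nz.
rewrite expr2 ltr_pM2l//.
have -> : 2 * pi - t = pi * (2 - t / pi) by rewrite mulrBr [pi * (t / pi)]mulrCA divff ?gt_eqF// mulr1 mulrC.
by rewrite ltr_pM2l.
Qed.

(** This is sin times the logarithmic derivative of sqrt phi, the virtual ground
    state of the logarithmic Hardy inequality. *)
Definition hardy_m t : R := - (sin t / (2 * rho_phi t)).

Definition hardy_dm t : R :=
  - ((cos t * rho_phi t - sin t * (phi t - 1)) / (2 * rho_phi t ^+ 2)).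

Lemma is_derive_phi t : 0 < t -> is_derive t 1 (@phi R) (- t^-1).
Proof.
move=> t0; have c0 : 0 < pi * expR 1 :> R by rewrite mulr_gt0 ?pi_gt0 ?expR_gt0.
have t1 : t != 0 by rewrite gt_eqF.
have q0 : 0 < pi * expR 1 / t by rewrite divr_gt0.
refine (@is_derive_eq _ _ _ (@phi R) _ _ _ _ (der_ln (f := fun y => pi * expR 1 / y) q0
  (derM (der_cst t _) (derV (f := fun y => y) t1 (der_id t)))) _).
by move: c0 => /=; move: (pi * expR 1) => c c0; field; nz.
Qed.

Lemma is_derive_rho_phi t : 0 < t -> is_derive t 1 (@rho_phi R) (phi t - 1).
Proof.
move=> t0; apply: (is_derive_eq (derM (der_id t) (is_derive_phi t0))).
by field; nz.
Qed.

Lemma is_derive_hardy_m t : 0 < t <= pi -> is_derive t 1 hardy_m (hardy_dm t).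
Proof.
move=> tp; have /andP[t0 _] := tp.
have r0 : 0 < rho_phi t := lt_le_trans t0 (rho_phi_ge tp).
have r1 : 2 * rho_phi t != 0 by rewrite mulf_neq0 ?gt_eqF.
refine (@is_derive_eq _ _ _ hardy_m _ _ _ _ (derN (derM (is_derive_sin t)
  (derV (f := fun y => 2 * rho_phi y) r1 (derM (der_cst t _) (is_derive_rho_phi t0))))) _).
by rewrite /hardy_dm; field; nz.
Qed.

Lemma continuous_hardy_dm t : 0 < t <= pi -> {for t, continuous hardy_dm}.
Proof.
move=> tp; have /andP[t0 _] := tp.
have r0 : 0 < rho_phi t := lt_le_trans t0 (rho_phi_ge tp).
have d1 := is_derive_phi t0; have d2 := is_derive_rho_phi t0.
have r1 : 2 * rho_phi t ^+ 2 != 0 by rewrite mulf_neq0 ?gt_eqF ?exprn_gt0.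
refine (@is_derive_continuous _ hardy_dm _ _ (derN (derM
  (derD (derM (is_derive_cos t) d2)
     (derN (derM (is_derive_sin t) (derD d1 (derN (der_cst t _))))))
  (derV (f := fun y => 2 * rho_phi y ^+ 2) r1 (derM (der_cst t _) (derX 1 d2)))))).
Qed.

(** After clearing denominators the terms in 1/rho_phi^2 cancel and what remains is
    [sinB_tcos_le_rat]. *)
Lemma hardy_riccati t : 0 < t < pi ->
  hardy_dm t + hardy_m t ^+ 2 / sin t <=
  (loss t - 1 / 4 / rho_phi t ^+ 2) * sin t.
Proof.
move=> tp; have /andP[t0 tp'] := tp; have p0 := @pi_gt0 R.
have s0 : 0 < pi - t by rewrite subr_gt0.
have f1 : 0 < phi t by rewrite (lt_le_trans ltr01)// phi_ge1// t0 ltW.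
have S0 := sin_gt0_pi tp.
have := sinB_tcos_le_rat tp => h.
rewrite -subr_ge0.
have -> : (loss t - 1 / 4 / rho_phi t ^+ 2) * sin t - (hardy_dm t + hardy_m t ^+ 2 / sin t) =
   (t ^+ 2 * (2 * pi - t) ^+ 2 * sin t - (sin t - t * cos t) * (pi ^+ 3 * (pi - t)))
   / (2 * pi ^+ 3 * (pi - t) * phi t * t ^+ 2).
  rewrite /loss /hardy_dm /hardy_m /rho_phi; clear -p0 t0 s0 f1 S0.
  move: (pi : R) (phi t) (sin t) p0 s0 f1 S0 => q f s p0 s0 f1 S0.
  by field; nz.
by rewrite divr_ge0 ?subr_ge0// ltW// !mulr_gt0 ?exprn_gt0.
Qed.

(** A multiplier vanishing at both ends of [0, pi], with derivative -2 at pi: it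
    yields a Hardy inequality for the weight 1/(pi - t), whose singularity is that of
    the right-hand side at the opposite pole. *)
Definition pole_m t : R := (1 - cos t) * sin t.

Definition pole_dm t : R := sin t * sin t + (1 - cos t) * cos t.

Lemma is_derive_pole_m t : is_derive t 1 pole_m (pole_dm t).
Proof.
rewrite /pole_m; eapply is_derive_eq; first by der.
by rewrite /pole_dm; ring.
Qed.

Lemma continuous_pole_dm t : {for t, continuous pole_dm}.
Proof. by rewrite /pole_dm; eapply is_derive_continuous; der. Qed.

Lemma sin_le_dist_pi t : t <= pi -> sin t <= pi - t.
Proof.
move=> tp; have s0 : 0 <= pi - t by rewrite subr_ge0.
have -> : sin t = sin (pi - t) by rewrite sinB sinpi cospi; ring.
rewrite -subr_ge0; apply: (@ge0_of_derive_ge0 R (fun t => t - sin t) (fun t => 1 - cos t) (pi - t)).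
- by rewrite sin0 subr0.
- by move=> y _; rewrite subr_ge0 cos_le1.
- by rewrite s0 lexx.
Qed.

Lemma pole_riccati t : 0 < t < pi ->
  pole_dm t + pole_m t ^+ 2 / sin t <= (7 - (pi - t)^-1) * sin t.
Proof.
move=> tp; have /andP[t0 tp'] := tp; have p0 := @pi_gt0 R.
have s0 : 0 < pi - t by rewrite subr_gt0.
have S0 := sin_gt0_pi tp; have S1 := sin_le1 t.
have C1 := cos_le1 t; have C2 := cos_geN1 t.
have CS : cos t * cos t = 1 - sin t * sin t by rewrite -!expr2 cos2sin2.
have q1 : (pi - t)^-1 * sin t <= 1.
  by rewrite mulrC ler_pdivrMr// mul1r sin_le_dist_pi// ltW.
have q2 : 0 <= cos t -> (pi - t)^-1 * sin t <= sin t.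
  move=> c0; rewrite ler_piMl// ?(ltW S0)// invf_le1//.
  have [tle|tgt] := leP t (pi / 2); first by have := @pi_ge2 R; lra.
  exfalso; move: c0; apply/negP; rewrite -ltNge.
  have -> : cos t = - cos (pi - t) by rewrite cosB cospi sinpi; ring.
  by rewrite oppr_lt0; apply: cos_gt0_pihalf; lra.
rewrite /pole_dm /pole_m.
have -> : ((1 - cos t) * sin t) ^+ 2 / sin t = (1 - cos t) * (1 - cos t) * sin t.
  by field; nz.
rewrite mulrBl.
have h1 : (1 - cos t) * (1 - cos t) * sin t <= 4 * sin t.
  by rewrite ler_pM2r//; nra.
have h2 : sin t * sin t <= sin t by nra.
have [c0|c0] := leP 0 (cos t).
  have := q2 c0; have : (1 - cos t) * cos t <= sin t * sin t by nra.
  lra.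
have : (1 - cos t) * cos t <= sin t * sin t - 1 by nra.
lra.
Qed.

End Weights.

(** * Hardy inequalities on an interval *)

Section Hardy1D.
Context {R : realType}.
Local Notation mu := (@lebesgue_measure R).

Lemma FTC_Ioo (F f : R -> R) (a b : R) : a < b ->
  (forall x, a <= x <= b -> is_derive x 1 F (f x)) ->
  (forall x, a <= x <= b -> {for x, continuous f}) ->
  (\int[mu]_(x in `]a, b[) (f x)%:E = (F b - F a)%:E)%E.
Proof.
move=> ab dF cf.
have cF x : a <= x <= b -> {for x, continuous F}.
  by move=> xab; exact: is_derive_continuous (dF x xab).
have cfw : {within `[a, b], continuous f}.
  apply: continuous_in_subspaceT => x /set_mem /=; rewrite in_itv/= => xab.
  exact: cf.
have mf : measurable_fun `]a, b[ f.
  apply: (@measurable_funS _ _ _ _ `[a, b]%classic) => //; first exact: subset_itv_oo_cc.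
  exact: subspace_continuous_measurable_fun.
rewrite -(@integral_itv_bndoo R a b (EFin \o f) true false); last first.
  by apply/measurable_EFinP.
rewrite EFinB; apply: continuous_FTC2 => //.
- split.
  + by move=> x; rewrite in_itv/= => /andP[/ltW xa /ltW xb]; have [] := dF x; rewrite ?xa.
  + by apply: cvg_at_right_filter; apply: cF; rewrite lexx ltW.
  + by apply: cvg_at_left_filter; apply: cF; rewrite lexx ltW.
- move=> x; rewrite in_itv/= => /andP[/ltW xa /ltW xb].
  by rewrite derive1E; have [|_ ->] := dF x; rewrite ?xa.
Qed.

Lemma lower_bounded (f : R -> R) (a b : R) : a <= b ->
  (forall x, a <= x <= b -> {for x, continuous f}) ->
  exists2 K : R, 0 <= K & forall x, a <= x <= b -> - K <= f x.
Proof.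
move=> ab cf.
have cfw : {within `[a, b], continuous f}.
  apply: continuous_in_subspaceT => x /set_mem /=; rewrite in_itv/= => xab.
  exact: cf.
have [c _ cmin] := EVT_min ab cfw.
exists `|f c| => // x xab; apply: le_trans (cmin x _); last by rewrite in_itv.
by rewrite lerNl -normrN ler_norm.
Qed.

(** Completing the square in U' gives
    U'^2 sin + (m' + m^2 / sin) U^2 >= (m U^2)', and the integral of the right-hand
    side is nonnegative by the signs of m at the ends. The Riccati inequality bounds
    m' + m^2 / sin by (W2 - W1) sin. *)
Lemma hardy_1D (m dm W1 W2 U dU : R -> R) (a b : R) :
  0 <= a -> a < b -> b <= pi ->
  (forall x, a <= x <= b -> is_derive x 1 m (dm x)) ->
  (forall x, a <= x <= b -> {for x, continuous dm}) ->
  (forall x : R, is_derive x 1 U (dU x)) -> continuous dU ->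
  measurable_fun setT W1 -> measurable_fun setT W2 ->
  (forall x, a < x < b -> 0 <= W1 x) -> (forall x, a < x < b -> 0 <= W2 x) ->
  (forall x, a < x < b -> dm x + m x ^+ 2 / sin x <= (W2 x - W1 x) * sin x) ->
  m a <= 0 -> 0 <= m b ->
  (\int[mu]_(x in `]a, b[) (W1 x * U x ^+ 2 * sin x)%:E <=
   \int[mu]_(x in `]a, b[) (dU x ^+ 2 * sin x)%:E +
   \int[mu]_(x in `]a, b[) (W2 x * U x ^+ 2 * sin x)%:E)%E.
Proof.
move=> a0 ab bpi dm_ cdm dU_ cdU mW1 mW2 W10 W20 ric ma mb.
have cU : continuous U by move=> x; exact: is_derive_continuous (dU_ x).
have cm x : a <= x <= b -> {for x, continuous m}.
  by move=> xab; exact: is_derive_continuous (dm_ x xab).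
pose G x := m x * (U x * U x).
pose g x := m x * (U x * dU x + U x * dU x) + (U x * U x) * dm x.
have dG x : a <= x <= b -> is_derive x 1 G (g x).
  by move=> xab; exact: (derM (dm_ x xab) (derM (dU_ x) (dU_ x))).
have cg x : a <= x <= b -> {for x, continuous g}.
  move=> xab; apply: cvgD; apply: cvgM.
  - exact: cm.
  - by apply: cvgD; apply: cvgM; [exact: cU|exact: cdU|exact: cU|exact: cdU].
  - by apply: cvgM; exact: cU.
  - exact: cdm.
(* The derivative g of m U^2 has no sign; adding a constant K makes it nonnegative,
   so that all integrals can be compared in [0, +oo]. *)
have [K K0 gK] := lower_bounded (ltW ab) cg.
have FK : (\int[mu]_(x in `]a, b[) (g x + K)%:E = (G b + K * b - (G a + K * a))%:E)%E.
  apply: (@FTC_Ioo (fun x => G x + K * x) (fun x => g x + K)) => //.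
  - move=> x xab; apply: (is_derive_eq (derD (dG x xab) (derM (der_cst x K) (der_id x)))).
    by ring.
  - by move=> x xab; apply: cvgD; [exact: cg|exact: cvg_cst].
have mgK : measurable_fun `]a, b[ (fun x => (g x + K)%:E).
  apply/measurable_EFinP.
  apply: (@measurable_funS _ _ _ _ `[a, b]%classic) => //; first exact: subset_itv_oo_cc.
  apply: subspace_continuous_measurable_fun => //.
  apply: continuous_in_subspaceT => x /set_mem /=; rewrite in_itv/= => xab.
  by apply: cvgD; [exact: cg|exact: cvg_cst].
have sin0' x : a < x < b -> 0 <= sin x.
  by move=> /andP[ax xb]; apply: sin_ge0_pi; rewrite (le_trans a0 (ltW ax)) (le_trans (ltW xb)).
have msin : measurable_fun setT (@sin R).
  by apply: continuous_measurable_fun; exact: continuous_sin.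
have mU : measurable_fun setT U by exact: continuous_measurable_fun.
have mdU : measurable_fun setT dU by exact: continuous_measurable_fun.
have mT (V W : R -> R) : measurable_fun setT V -> measurable_fun setT W ->
    measurable_fun `]a, b[ (fun x => (W x * V x ^+ 2 * sin x)%:E).
  move=> mV mW; apply: measurable_funTS; apply/measurable_EFinP.
  apply: measurable_funM => //; apply: measurable_funM => //.
  exact: measurable_funX.
have mD : measurable_fun `]a, b[ (fun x => (dU x ^+ 2 * sin x)%:E).
  apply: measurable_funTS; apply/measurable_EFinP.
  by apply: measurable_funM => //; exact: measurable_funX.
have h0 (V W : R -> R) : (forall x, a < x < b -> 0 <= W x) ->
    forall x, `]a, b[%classic x -> (0 <= (W x * V x ^+ 2 * sin x)%:E)%E.
  move=> W0 x /=; rewrite in_itv/= => xab; rewrite lee_fin.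
  by rewrite mulr_ge0 ?sin0'// mulr_ge0 ?W0 ?sqr_ge0.
have hD x : `]a, b[%classic x -> (0 <= (dU x ^+ 2 * sin x)%:E)%E.
  by rewrite /= in_itv/= => xab; rewrite lee_fin mulr_ge0 ?sin0' ?sqr_ge0.
have hg x : `]a, b[%classic x -> (0 <= (g x + K)%:E)%E.
  rewrite /= in_itv/= => /andP[/ltW ax /ltW xb]; rewrite lee_fin -lerBlDr sub0r.
  by rewrite gK// ax.
have muab : mu `]a, b[%classic = (b - a)%:E.
  by rewrite lebesgue_measure_itv/= lte_fin ab EFinB.
have IK : (\int[mu]_(x in `]a, b[) K%:E = (K * (b - a))%:E)%E.
  by rewrite integral_cst//= [X in (_ * X)%E]muab EFinM.
have key : (\int[mu]_(x in `]a, b[) (W1 x * U x ^+ 2 * sin x)%:E + (K * (b - a))%:E <=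
   \int[mu]_(x in `]a, b[) (dU x ^+ 2 * sin x)%:E +
   \int[mu]_(x in `]a, b[) (W2 x * U x ^+ 2 * sin x)%:E + (K * (b - a))%:E)%E.
  apply: (@le_trans _ _ (\int[mu]_(x in `]a, b[) (W1 x * U x ^+ 2 * sin x)%:E +
     \int[mu]_(x in `]a, b[) (g x + K)%:E)%E).
    rewrite leeD2l// FK lee_fin.
    have : 0 <= G b by rewrite /G mulr_ge0// -expr2 sqr_ge0.
    have : G a <= 0 by rewrite /G mulr_le0_ge0// -expr2 sqr_ge0.
    by rewrite mulrBr; lra.
  have mW2U := mT U W2 mU mW2; have mW1U := mT U W1 mU mW1.
  have hW1U := h0 U W1 W10; have hW2U := h0 U W2 W20.
  have hK x : `]a, b[%classic x -> (0 <= K%:E)%E by rewrite lee_fin.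
  have mK : measurable_fun `]a, b[ (fun=> K%:E) by exact: measurable_cst.
  have mS : measurable_fun `]a, b[
      (fun x => (dU x ^+ 2 * sin x)%:E + (W2 x * U x ^+ 2 * sin x)%:E)%E.
    exact: emeasurable_funD.
  have hS x : `]a, b[%classic x ->
      (0 <= (dU x ^+ 2 * sin x)%:E + (W2 x * U x ^+ 2 * sin x)%:E)%E.
    by move=> xab; rewrite adde_ge0 ?hD ?hW2U.
  rewrite -IK -ge0_integralD// -ge0_integralD// -ge0_integralD//.
  apply: ge0_le_integral => //.
  - by move=> x xab; rewrite adde_ge0 ?hg ?hW1U.
  - exact: emeasurable_funD.
  - exact: emeasurable_funD.
  move=> x /=; rewrite in_itv/= => xab; rewrite -!EFinD lee_fin.
  have [s0|s0] := ltP 0 (sin x); last first.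
    exfalso; move: s0; apply/negP; rewrite -ltNge; apply: sin_gt0_pi.
    by case/andP: xab => ax xb; rewrite (le_lt_trans a0 ax) (lt_le_trans xb bpi).
  have := ric x xab => r1.
  rewrite addrA lerD2r /g -subr_ge0.
  have : 0 <= (dU x - m x * U x / sin x) ^+ 2 * sin x by rewrite mulr_ge0 ?sqr_ge0// ltW.
  have -> : (dU x - m x * U x / sin x) ^+ 2 * sin x =
    dU x ^+ 2 * sin x - 2 * m x * U x * dU x + (m x ^+ 2 / sin x) * U x ^+ 2.
    by field; rewrite gt_eqF.
  have := ler_wpM2r (sqr_ge0 (U x)) r1.
  move: (m x ^+ 2 / sin x) => Z.
  lra.
by move: key; rewrite leeD2rE.
Qed.

End Hardy1D.

(** * Densities and weighted L2 norms *)

Section Density.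
Context d1 d2 (T1 : measurableType d1) (T2 : measurableType d2) {R : realType}.
Variables (mu : {measure set T1 -> \bar R}) (m : {measure set T2 -> \bar R}).
Variables (f : T1 -> T2) (h : T1 -> R).
Hypotheses (mf : measurable_fun setT f) (mh : measurable_fun setT h).
Hypothesis h0 : forall x, 0 <= h x.
Hypothesis mE : forall A, measurable A -> m A = (\int[mu]_(z in f @^-1` A) (h z)%:E)%E.
Import HBNNSimple.
Local Open Scope ereal_scope.

Let integral_density_indic A : measurable A ->
  \int[m]_x (\1_A x)%:E = \int[mu]_z ((\1_A (f z))%:E * (h z)%:E).
Proof.
move=> mA; rewrite integral_indic// setIT mE// integral_mkcond.
apply: eq_integral => z _; rewrite patchE indicE.
have -> : (z \in f @^-1` A) = (f z \in A) by apply/idP/idP; rewrite !inE.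
by case: (f z \in A); rewrite ?mul1e ?mul0e.
Qed.

Let integral_density_nnsfun (s : {nnsfun T2 >-> R}) :
  \int[m]_x (s x)%:E = \int[mu]_z ((s (f z))%:E * (h z)%:E).
Proof.
have sE x : (s x)%:E = \sum_(y \in range s) (y%:E * (\1_(s @^-1` [set y]) x)%:E).
  by rewrite fimfunE -fsumEFin//.
under eq_integral do rewrite sE.
have ms y : measurable (s @^-1` [set y]) by exact: measurable_sfunP.
have mi y : measurable_fun setT (fun x => (\1_(s @^-1` [set y]) x : R)%:E).
  by apply/measurable_EFinP; exact: measurable_indic.
have mif y : measurable_fun setT (fun z => (\1_(s @^-1` [set y]) (f z) : R)%:E * (h z)%:E).
  by apply: emeasurable_funM; [exact: (measurableT_comp (mi y))|exact/measurable_EFinP].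
have i0 y x : 0 <= y%:E * (\1_(s @^-1` [set y]) x)%:E.
  exact: nnfun_muleindic_ge0.
have y0 y : y \in range s -> (0 <= y)%R by rewrite inE => -[x _ <-].
rewrite ge0_integral_fsum//=; last first.
  by move=> y; apply: emeasurable_funM => //; exact: measurable_cst.
transitivity (\int[mu]_z \sum_(y \in range s)
   (y%:E * ((\1_(s @^-1` [set y]) (f z))%:E * (h z)%:E))); last first.
  apply: eq_integral => z _; rewrite sE ge0_mule_fsuml//.
  by apply: eq_fsbigr => y _; rewrite muleA.
have j0 y z : 0 <= (\1_(s @^-1` [set y]) (f z))%:E * (h z)%:E :> \bar R.
  by rewrite mule_ge0// lee_fin.
rewrite ge0_integral_fsum//=; last 2 first.
- by move=> y; apply: emeasurable_funM => //; exact: measurable_cst.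
- by move=> y z _; rewrite muleA mule_ge0// ?lee_fin.
apply: eq_fsbigr => y yr.
have yy := y0 _ yr.
have l0 x : setT x -> 0 <= (\1_(s @^-1` [set y]) x)%:E :> \bar R by rewrite lee_fin.
have l1 z : setT z -> 0 <= (\1_(s @^-1` [set y]) (f z))%:E * (h z)%:E :> \bar R.
  by move=> _; exact: j0.
rewrite (ge0_integralZl_EFin m measurableT l0 (mi y) yy).
by rewrite (ge0_integralZl_EFin mu measurableT l1 (mif y) yy) integral_density_indic.
Qed.

(** Change of variables for the image m under f of the measure with density h with
    respect to mu: by linearity for simple functions, then by monotone convergence. *)
Lemma ge0_integral_density (g : T2 -> \bar R) : measurable_fun setT g ->
  (forall x, 0 <= g x) ->
  \int[m]_x g x = \int[mu]_z (g (f z) * (h z)%:E).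
Proof.
move=> mg g0; pose s := nnsfun_approx measurableT mg.
have sg x : (s n x)%:E @[n --> \oo] --> g x by exact: cvg_nnsfun_approx.
have nds x a b : (a <= b)%N -> (s a x <= s b x)%R.
  by move=> ab; exact/lefP/nd_nnsfun_approx.
have gE : \int[m]_x g x = lim (\int[m]_x (s n x)%:E @[n --> \oo]).
  transitivity (\int[m]_x limn (fun n => (s n x)%:E)).
    by apply: eq_integral => x _; apply/esym/cvg_lim.
  apply: monotone_convergence => //.
  - by move=> n; exact/measurable_EFinP.
  - by move=> n x _; rewrite lee_fin.
  - by move=> x _ a b ab; rewrite lee_fin nds.
rewrite gE.
transitivity (\int[mu]_z limn (fun n => (s n (f z))%:E * (h z)%:E)); last first.
  by apply: eq_integral => z _; apply/cvg_lim => //; apply: cvgeZr.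
rewrite monotone_convergence//.
- by under eq_fun do rewrite integral_density_nnsfun.
- move=> n; apply: emeasurable_funM; last exact/measurable_EFinP.
  by apply/measurable_EFinP; apply: (measurableT_comp _ mf).
- by move=> n z _; rewrite mule_ge0// lee_fin.
- by move=> z _ a b ab; rewrite lee_wpmul2r ?lee_fin ?nds.
Qed.

End Density.

Section ScaledSum.
Context {R : realType}.
Local Open Scope ereal_scope.

Lemma le_scaled_sum (s c : R) (F1 F2 X Y A1 A2 : \bar R) :
  (0 <= s)%R -> (0 <= c)%R -> 0 <= F1 -> 0 <= F2 -> 0 <= X -> 0 <= Y ->
  A1 <= s%:E * F1 + c%:E * X -> A2 <= s%:E * F2 + c%:E * Y ->
  s%:E * (A1 + A2) <=
  (s * s)%:E * (F1 + F2) + ((s * c)%:E * X + (s * c)%:E * Y).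
Proof.
move=> s0 c0 F10 F20 X0 Y0 h1 h2.
have k1 : 0 <= s%:E * F1 + c%:E * X by rewrite adde_ge0// mule_ge0.
have k2 : 0 <= s%:E * F2 + c%:E * Y by rewrite adde_ge0// mule_ge0.
apply: (@le_trans _ _ (s%:E * ((s%:E * F1 + c%:E * X) + (s%:E * F2 + c%:E * Y)))).
  by apply: lee_wpmul2l => //; exact: leeD.
rewrite !ge0_muleDr ?mule_ge0// -?EFinM ?muleA -?EFinM.
by rewrite addeACA.
Qed.

End ScaledSum.

Section Closed.
Context d (T : measurableType d) {R : realType} (mu : {measure set T -> \bar R}).
Variables (D : set T) (mD : measurable D).
Local Open Scope ereal_scope.

Definition wnorm2 (W f : T -> R) : \bar R := \int[mu]_(x in D) (W x * f x ^+ 2)%:E.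

(** Young's inequality f^2 <= s u^2 + s / (s - 1) (u - f)^2. Taking s close to 1
    compares the values of a quadratic form at f and at u even when its value at f is
    not known to be finite. *)
Lemma wnorm2_split (W f u : T -> R) (s : R) : (1 < s)%R ->
  measurable_fun D W -> measurable_fun D f -> measurable_fun D u ->
  (forall x, D x -> (0 <= W x)%R) ->
  wnorm2 W f <= s%:E * wnorm2 W u + (s / (s - 1))%:E * wnorm2 W (fun x => (u x - f x)%R).
Proof.
move=> s1 mW mf mu_ W0.
have s0 : (0 < s)%R by rewrite (lt_trans ltr01).
have s10 : (0 < s - 1)%R by rewrite subr_gt0.
have sq (g : T -> R) : measurable_fun D g -> measurable_fun D (fun x => (W x * g x ^+ 2)%:E).
  move=> mg; apply/measurable_EFinP; apply: measurable_funM => //.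
  exact: measurable_funX.
have sq0 (g : T -> R) x : D x -> 0 <= (W x * g x ^+ 2)%:E.
  by move=> Dx; rewrite lee_fin mulr_ge0 ?W0 ?sqr_ge0.
have muf : measurable_fun D (fun x => (u x - f x)%R) by exact: measurable_funB.
have squ := sq _ mu_; have squf := sq _ muf.
have c0 : (0 <= s / (s - 1))%R by rewrite divr_ge0// ltW.
have h1 x : D x -> 0 <= s%:E * (W x * u x ^+ 2)%:E.
  by move=> Dx; rewrite mule_ge0 ?sq0// lee_fin ltW.
have h2 x : D x -> 0 <= (s / (s - 1))%:E * (W x * (u x - f x) ^+ 2)%:E.
  by move=> Dx; apply: mule_ge0; [rewrite lee_fin|exact: (sq0 (fun x => u x - f x)%R)].
have k1 : measurable_fun D (fun x => s%:E * (W x * u x ^+ 2)%:E).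
  by apply: emeasurable_funM => //; exact: measurable_cst.
have k2 : measurable_fun D (fun x => (s / (s - 1))%:E * (W x * (u x - f x) ^+ 2)%:E).
  by apply: emeasurable_funM => //; exact: measurable_cst.
rewrite /wnorm2 -ge0_integralZl_EFin//; [|exact: sq0|exact: ltW].
rewrite -ge0_integralZl_EFin//; last exact: sq0.
rewrite -ge0_integralD//.
apply: ge0_le_integral => //.
- exact: sq0.
- exact: sq.
- exact: emeasurable_funD.
move=> x Dx; rewrite -!EFinM -EFinD lee_fin.
rewrite [(s * (_ * _))%R]mulrCA [(s / (s - 1) * (_ * _))%R]mulrCA -mulrDr ler_wpM2l ?W0//.
move: (u x) (f x) => U F; rewrite -subr_ge0.
rewrite (_ : _ - _ = ((s - 1) * U - (F - U)) ^+ 2 / (s - 1))%R.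
  by rewrite divr_ge0 ?sqr_ge0// ltW.
by field; rewrite gt_eqF.
Qed.

(** With [wnorm2_split] both sides change by a factor s and by error terms that
    vanish as n grows; then s decreases to 1. *)
Lemma hardy_closed (W1 W2 f F : T -> R) (u v : (T -> R)^nat) :
  measurable_fun D W1 -> measurable_fun D W2 ->
  measurable_fun D f -> measurable_fun D F ->
  (forall n, measurable_fun D (u n)) -> (forall n, measurable_fun D (v n)) ->
  (forall x, D x -> (0 <= W1 x)%R) -> (forall x, D x -> (0 <= W2 x)%R) ->
  (forall n, wnorm2 W1 (u n) <= wnorm2 (cst 1%R) (v n) + wnorm2 W2 (u n)) ->
  wnorm2 W1 (fun x => u n x - f x)%R @[n --> \oo] --> 0 ->
  wnorm2 W2 (fun x => u n x - f x)%R @[n --> \oo] --> 0 ->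
  wnorm2 (cst 1%R) (fun x => v n x - F x)%R @[n --> \oo] --> 0 ->
  wnorm2 W1 f <= wnorm2 (cst 1%R) F + wnorm2 W2 f.
Proof.
move=> mW1 mW2 mf mF mu_ mv W10 W20 H c1 c2 c3.
have n0 W g : (forall x, D x -> (0 <= W x)%R) -> 0 <= wnorm2 W g.
  by move=> W0; apply: integral_ge0 => x Dx; rewrite lee_fin mulr_ge0 ?W0 ?sqr_ge0.
have p1 x : D x -> (0 <= cst 1%R x :> R)%R by [].
have [->|fin] := eqVneq (wnorm2 (cst 1%R) F + wnorm2 W2 f) +oo; first exact: leey.
set B := wnorm2 (cst 1%R) F + wnorm2 W2 f.
have B0 : 0 <= B by rewrite adde_ge0 ?n0.
have Bfin : B \is a fin_num by rewrite ge0_fin_numE// ltey.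
have step s : (1 < s)%R -> wnorm2 W1 f <= (s * s)%:E * B.
  move=> s1; have s0 : (0 < s)%R by rewrite (lt_trans ltr01).
  pose c := (s / (s - 1))%R.
  have c0 : (0 <= c)%R by rewrite divr_ge0 ?subr_ge0 ?ltW.
  pose e n := (s * c)%:E * wnorm2 (cst 1%R) (fun x => v n x - F x)%R
    + (s * c)%:E * wnorm2 W2 (fun x => u n x - f x)%R
    + c%:E * wnorm2 W1 (fun x => u n x - f x)%R.
  have e0 : e n @[n --> \oo] --> 0.
    have cZ (k : R) (w : nat -> \bar R) : w n @[n --> \oo] --> 0 ->
        k%:E * w n @[n --> \oo] --> 0.
      by move=> w0; rewrite -(mule0 k%:E); exact: cvgeZl.
    rewrite -[X in _ --> X]adde0; apply: cvgeD => //; last exact: cZ.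
    by rewrite -[X in _ --> X]adde0; apply: cvgeD => //; exact: cZ.
  have Be : (s * s)%:E * B + e n @[n --> \oo] --> (s * s)%:E * B + 0.
    apply: cvgeD => //; last exact: cvg_cst.
    by rewrite fin_num_adde_defl.
  rewrite -[leRHS]adde0 -(cvg_lim _ Be)//; apply: lime_ge.
    by apply/cvg_ex; eexists; exact: Be.
  apply: nearW => n.
  apply: (le_trans (wnorm2_split s1 mW1 mf (mu_ n) W10)).
  rewrite /e addeA; apply: leeD => //.
  apply: (@le_trans _ _ (s%:E * (wnorm2 (cst 1%R) (v n) + wnorm2 W2 (u n)))).
    by apply: lee_wpmul2l; [rewrite lee_fin ltW|exact: H].
  have mvF := measurable_funB (mv n) mF; have muf := measurable_funB (mu_ n) mf.
  have m1 : measurable_fun D (cst 1%R : T -> R) by exact: measurable_cst.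
  have h1 := wnorm2_split s1 m1 (mv n) mF p1.
  have h2 := wnorm2_split s1 mW2 (mu_ n) mf W20.
  have sym W (a b : T -> R) : wnorm2 W (fun x => a x - b x)%R = wnorm2 W (fun x => b x - a x)%R.
    by apply: eq_integral => x _; rewrite -sqrrN opprB.
  rewrite sym in h1; rewrite [X in _ <= _ + _ * X]sym in h2.
  by apply: le_scaled_sum h1 h2; rewrite ?n0// ltW.
apply/lee_addgt0Pr => e e0.
have b0 := fine_ge0 B0.
(* For s <= 2 one has s^2 - 1 <= 3 (s - 1), whence the choice of s. *)
pose s := (1 + Num.min 1 (e / (3 * (fine B + 1))))%R.
have d0 : (0 < e / (3 * (fine B + 1)))%R by rewrite divr_gt0// mulr_gt0// ltr_wpDl.
have s1 : (1 < s)%R by rewrite /s ltrDl lt_min ltr01.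
apply: le_trans (step s s1) _.
rewrite -(fineK Bfin) -EFinM -EFinD lee_fin.
set b := fine B in b0 d0 s s1 *.
have q1 : (s - 1 <= 1)%R by rewrite /s addrAC subrr add0r ge_min lexx.
have q2 : ((s - 1) * (3 * (b + 1)) <= e)%R.
  rewrite /s addrAC subrr add0r -ler_pdivlMr ?mulr_gt0 ?ltr_wpDl//.
  by rewrite ge_min lexx orbT.
have q0 : (0 < s - 1)%R by rewrite subr_gt0.
have q3 : (0 <= (s - 1) * b)%R by rewrite mulr_ge0// ltW.
have : (0 <= (1 - (s - 1)) * ((s - 1) * b))%R by rewrite mulr_ge0// subr_ge0.
nra.
Qed.

End Closed.

(** * Functions of class C1 on three-space *)

Section ThreeSpace.
Context {R : realType}.

(** An open set is the union of the countably many product balls of rational centre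
    and radius 1/(n+1) that it contains. *)
Lemma open_measurable_R3 (U : set ('R3 R)) : open U -> measurable U.
Proof.
move=> oU.
pose B (i : rat * rat * rat * nat) : set ('R3 R) :=
  (ball (ratr i.1.1.1 : R) i.2.+1%:R^-1 `*` ball (ratr i.1.1.2 : R) i.2.+1%:R^-1)
    `*` ball (ratr i.1.2 : R) i.2.+1%:R^-1.
pose F i := if `[< B i `<=` U >] then B i else set0.
have -> : U = \bigcup_i F i.
  apply/seteqP; split => [[[x1 x2] x3] Ux|x [i _]]; last first.
    by rewrite /F; case: asboolP => // BU /BU.
  have /nbhs_ballP[e /= e0 eU] : nbhs (x1, x2, x3) U by exact: open_nbhs_nbhs.
  have [n /= ne] : exists n : nat, n.+1%:R^-1 < e / 2.
    have e20 : 0 < e / 2 by rewrite divr_gt0.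
    have [n _ nE] := near_infty_natSinv_lt (PosNum e20).
    by exists n; apply: nE => /=.
  have n0 : 0 < n.+1%:R^-1 :> R by rewrite invr_gt0.
  have app (x : R) : exists q : rat, `|ratr q - x| < n.+1%:R^-1.
    move: n.+1%:R^-1 n0 => r r0.
    have [|q] := @rat_in_itvoo R (x - r) (x + r); first by lra.
    by rewrite in_itv/= => /andP[q1 q2]; exists q; rewrite ltr_norml; lra.
  have [q1 h1] := app x1; have [q2 h2] := app x2; have [q3 h3] := app x3.
  exists (q1, q2, q3, n) => //; rewrite /F; case: asboolP => [_|[]].
    by split => //=; split => //=.
  have close (x y : R) (q : rat) : `|ratr q - x| < n.+1%:R^-1 -> `|ratr q - y| < n.+1%:R^-1 ->
      `|x - y| < e.
    move: n.+1%:R^-1 ne => r re.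
    by rewrite !ltr_norml => /andP[? ?] /andP[? ?]; lra.
  move=> [[y1 y2] y3] [[/= k1 k2] k3]; apply: eU.
  by split => /=; [split => /=|]; [exact: (close _ _ q1)|exact: (close _ _ q2)|exact: (close _ _ q3)].
apply: countable_bigcupT_measurable => // i; rewrite /F; case: asboolP => // _.
by apply: measurableX; [apply: measurableX|]; exact: measurable_ball.
Qed.

Lemma continuous_measurable_R3 (u : 'R3 R -> R) : continuous u -> measurable_fun setT u.
Proof.
move=> /continuousP cu; apply: (measurability _ (RGenOpens.measurableE R)).
move=> _ [_ [a [b ->] <-]]; rewrite setTI; apply: open_measurable_R3.
exact/cu/interval_open.
Qed.

Definition C1 (u : 'R3 R -> R) : Prop :=
  (forall x, differentiable u x) /\ (forall v, continuous (fun x => 'D_v u x)).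

Lemma smooth_C1 u : smooth u -> C1 u.
Proof. by move=> /(_ 2%N)[du cu]; split => // v x; have [+ _] := cu v; move/(_ x)/differentiable_continuous. Qed.

Lemma C1_continuous u : C1 u -> continuous u.
Proof. by move=> [du _] x; exact: differentiable_continuous. Qed.

Lemma C1B u v : C1 u -> C1 v -> C1 (fun x => u x - v x).
Proof.
move=> [du cu] [dv cv]; split=> [x|w]; first exact: differentiableB.
rewrite (_ : (fun x => _) = fun x => 'D_w u x - 'D_w v x); last first.
  by apply/funext => x; rewrite deriveB//; exact: diff_derivable.
by move=> x; apply: cvgB; [exact: cu|exact: cv].
Qed.

(** A compact product containing the unit sphere. *)
Definition in_cube (x : 'R3 R) := [/\ `|x.1.1| <= 1, `|x.1.2| <= 1 & `|x.2| <= 1].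

Lemma continuous_bounded_cube (u : 'R3 R -> R) : continuous u ->
  exists2 M : R, 0 <= M & forall x, in_cube x -> `|u x| <= M.
Proof.
move=> cu; pose I : set R := `[-1, 1]%classic.
have cI : compact I by exact: segment_compact.
have cc : compact ((I `*` I) `*` I) by apply: compact_setX => //; exact: compact_setX.
have cau : continuous (fun x => `|u x|).
  by move=> x; apply: cvg_norm; exact: cu.
have [||c _ cM] := @compact_EVT_max _ R (fun x => `|u x|) _ _ cc.
- by exists (0, 0, 0); split => /=; [split|]; rewrite /I /= in_itv /=; lra.
- exact: continuous_subspaceT.
exists `|u c| => // -[[x1 x2] x3] [/= h1 h2 h3]; apply: cM; rewrite inE.
by split => /=; [split|]; rewrite /I /= in_itv /= -ler_norml.
Qed.

Lemma dot_egrad (u : 'R3 R -> R) x (v : 'R3 R) : differentiable u x ->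
  dot (egrad u x) v = 'd u x v.
Proof.
move=> du; case: v => [[v1 v2] v3]; rewrite /dot /egrad /= !deriveE//.
rewrite -[RHS]/('d u x (v1, v2, v3)).
have -> : (v1, v2, v3) = v1 *: ((1, 0, 0) : 'R3 R) + v2 *: ((0, 1, 0) : 'R3 R) + v3 *: ((0, 0, 1) : 'R3 R).
  have sc (a : R) (y : 'R3 R) : a *: y = (a * y.1.1, a * y.1.2, a * y.2) by [].
  have ad (y z : 'R3 R) : y + z = (y.1.1 + z.1.1, y.1.2 + z.1.2, y.2 + z.2) by [].
  by rewrite !sc !ad /=; congr (_, _, _); ring.
by rewrite !linearD !linearZ/= /GRing.scale/=; ring.
Qed.

Lemma is_derive_curve (u : 'R3 R -> R) (g1 g2 g3 : R -> R) (t d1 d2 d3 : R) :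
  differentiable u (g1 t, g2 t, g3 t) ->
  is_derive t 1 g1 d1 -> is_derive t 1 g2 d2 -> is_derive t 1 g3 d3 ->
  is_derive t 1 (fun s => u (g1 s, g2 s, g3 s))
    (dot (egrad u (g1 t, g2 t, g3 t)) (d1, d2, d3)).
Proof.
move=> du D1 D2 D3; rewrite dot_egrad//.
have e1 : differentiable g1 t by apply/derivable1_diffP; case: D1.
have e2 : differentiable g2 t by apply/derivable1_diffP; case: D2.
have e3 : differentiable g3 t by apply/derivable1_diffP; case: D3.
have e12 : differentiable (fun s => (g1 s, g2 s)) t by exact: differentiable_pair.
have e : differentiable (fun s => (g1 s, g2 s, g3 s)) t by exact: differentiable_pair.
have dug : differentiable (fun s => u (g1 s, g2 s, g3 s)) t.
  exact: (differentiable_comp (f := fun s => (g1 s, g2 s, g3 s))).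
apply: DeriveDef; first exact/derivable1_diffP.
rewrite deriveE//.
rewrite (@diff_comp _ _ _ _ (fun s => (g1 s, g2 s, g3 s)) u t e du) /=.
congr ('d u _ _); rewrite diff_pair//= diff_pair//= -!deriveE//.
by case: D1 => _ ->; case: D2 => _ ->; case: D3 => _ ->.
Qed.

End ThreeSpace.

(** * Spherical coordinates about an arbitrary pole *)

Section Geometry.
Context {R : realType}.
Implicit Types (al be th ph : R).

(** The image of the point with polar angle th and azimuth ph - be under the rotation
    that carries the north pole to sph (al, be). Subtracting be makes [rot] coincide
    with [sph] when al = 0. *)
Definition rot al be th ph : 'R3 R :=
  (sin th * cos (ph - be) * (cos al * cos be) - sin th * sin (ph - be) * sin be
     + cos th * (sin al * cos be),
   sin th * cos (ph - be) * (cos al * sin be) + sin th * sin (ph - be) * cos be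
     + cos th * (sin al * sin be),
   cos th * cos al - sin th * cos (ph - be) * sin al).

Definition rot_dth al be th ph : 'R3 R :=
  (cos th * cos (ph - be) * (cos al * cos be) - cos th * sin (ph - be) * sin be
     - sin th * (sin al * cos be),
   cos th * cos (ph - be) * (cos al * sin be) + cos th * sin (ph - be) * cos be
     - sin th * (sin al * sin be),
   - (sin th * cos al) - cos th * cos (ph - be) * sin al).

Definition rot_dph al be th ph : 'R3 R :=
  (- (sin th * sin (ph - be) * (cos al * cos be)) - sin th * cos (ph - be) * sin be,
   - (sin th * sin (ph - be) * (cos al * sin be)) + sin th * cos (ph - be) * cos be,
   sin th * sin (ph - be) * sin al).

Definition rot_dal al be th ph : 'R3 R :=
  (- (sin th * cos (ph - be) * (sin al * cos be)) + cos th * (cos al * cos be),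
   - (sin th * cos (ph - be) * (sin al * sin be)) + cos th * (cos al * sin be),
   - (cos th * sin al) - sin th * cos (ph - be) * cos al).

Lemma rot0 be th ph : rot 0 be th ph = sph (th, ph).
Proof.
have -> : sph (th, ph) = sph (th, (ph - be) + be) by rewrite subrK.
by rewrite /rot /sph /= sin0 cos0 (cosD (ph - be) be) (sinD (ph - be) be); congr (_, _, _); ring.
Qed.

Lemma cos_mul_cos (x : R) : cos x * cos x = 1 - sin x * sin x.
Proof. by rewrite -!expr2 cos2sin2. Qed.

Lemma dot_rot_pole al be th ph : dot (rot al be th ph) (sph (al, be)) = cos th.
Proof.
rewrite /dot /rot /sph /=; have a2 := cos_mul_cos al; have b2 := cos_mul_cos be.
move: (cos (ph - be)) (sin (ph - be)) (cos th) (sin th) => C S ct st.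
move: (cos al) (sin al) (cos be) (sin be) a2 b2 => ca sa cb sb a2 b2.
transitivity (st * C * (ca * sa) * (cb * cb + sb * sb) - st * C * (sa * ca) +
  ct * (sa * sa * (cb * cb + sb * sb) + ca * ca)); first by ring.
by rewrite a2 b2; ring.
Qed.

Lemma dot_rot al be th ph : dot (rot al be th ph) (rot al be th ph) = 1.
Proof.
rewrite /dot /rot /=; have a2 := cos_mul_cos al; have b2 := cos_mul_cos be.
have t2 := cos_mul_cos th; have p2 := cos_mul_cos (ph - be).
move: (cos (ph - be)) (sin (ph - be)) (cos th) (sin th) p2 t2 => C S ct st p2 t2.
move: (cos al) (sin al) (cos be) (sin be) a2 b2 => ca sa cb sb a2 b2.
transitivity ((st * st * (C * C) * (ca * ca) + st * st * (S * S) + ct * ct * (sa * sa)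
  + 2 * (st * C * ca * ct * sa)) * (cb * cb + sb * sb) +
  ct * ct * (ca * ca) + st * st * (C * C) * (sa * sa) - 2 * (st * C * ca * ct * sa)
  + st * st * (S * S) * 0); first by ring.
by rewrite a2 b2 p2 t2; ring.
Qed.

Lemma in_cube_sphere (x : 'R3 R) : dot x x = 1 -> in_cube x.
Proof.
case: x => [[a b] c]; rewrite /dot /in_cube /= => h.
have sq (y : R) : y * y <= 1 -> `|y| <= 1.
  by move=> y1; rewrite -ler_sqr ?nnegrE// real_normK ?num_real// expr1n expr2.
by split; apply: sq; nra.
Qed.

(** Tilting the pole is an infinitesimal rotation, hence a tangent vector field of the
    sphere; this is its expression in spherical coordinates. *)
Lemma rot_dal_comb al be th ph (w : 'R3 R) :
  dot w (rot_dal al be th ph) * sin th =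
  cos (ph - be) * sin th * dot w (rot_dth al be th ph)
  - cos th * sin (ph - be) * dot w (rot_dph al be th ph).
Proof.
case: w => [[w1 w2] w3]; rewrite /dot /rot_dal /rot_dth /rot_dph /=.
have t2 := cos_mul_cos th; have p2 := cos_mul_cos (ph - be).
move: (cos (ph - be)) (sin (ph - be)) (cos th) (sin th) p2 t2 => C S ct st p2 t2.
move: (cos al) (sin al) (cos be) (sin be) => ca sa cb sb.
apply/eqP; rewrite -subr_eq0; apply/eqP.
transitivity ((w1 * ca * cb + w2 * ca * sb - w3 * sa) * ct * st * (1 - C * C - S * S)).
  by ring.
by rewrite p2; ring.
Qed.

Variable u : 'R3 R -> R.
Hypothesis du : forall x, differentiable u x.

Lemma is_derive_rot_al be th ph al :
  is_derive al 1 (fun a => u (rot a be th ph)) (dot (egrad u (rot al be th ph)) (rot_dal al be th ph)).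
Proof.
by apply: is_derive_curve => //; (eapply is_derive_eq; [der|rewrite /=; ring]).
Qed.

Lemma is_derive_rot_th al be ph th :
  is_derive th 1 (fun t => u (rot al be t ph)) (dot (egrad u (rot al be th ph)) (rot_dth al be th ph)).
Proof.
by apply: is_derive_curve => //; (eapply is_derive_eq; [der|rewrite /=; ring]).
Qed.

Lemma is_derive_rot_ph al be th ph :
  is_derive ph 1 (fun f => u (rot al be th f)) (dot (egrad u (rot al be th ph)) (rot_dph al be th ph)).
Proof.
by apply: is_derive_curve => //; (eapply is_derive_eq; [der|rewrite /=; ring]).
Qed.

End Geometry.

Section Measurability.
Context {R : realType}.

Lemma measurable_rot (al be : R) : measurable_fun setT (fun z : R * R => rot al be z.1 z.2).
Proof.
have ms : measurable_fun setT (@sin R).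
  by apply: continuous_measurable_fun; exact: continuous_sin.
have mc : measurable_fun setT (@cos R).
  by apply: continuous_measurable_fun; exact: continuous_cos.
have m1 : measurable_fun setT (fun z : R * R => sin z.1) by exact: measurableT_comp.
have m2 : measurable_fun setT (fun z : R * R => cos z.1) by exact: measurableT_comp.
have mb : measurable_fun setT (fun z : R * R => z.2 - be) by exact: measurable_funB.
have m3 : measurable_fun setT (fun z : R * R => sin (z.2 - be)) by exact: (measurableT_comp ms).
have m4 : measurable_fun setT (fun z : R * R => cos (z.2 - be)) by exact: (measurableT_comp mc).
rewrite /rot; apply: measurable_fun_pair; first apply: measurable_fun_pair.
all: by repeat first [exact: measurable_cst | exact: m1 | exact: m2 | exact: m3
  | exact: m4 | apply: measurable_funM | apply: measurable_funB | apply: measurable_funD].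
Qed.

End Measurability.

Section FubiniSets.
Context d1 d2 (T1 : measurableType d1) (T2 : measurableType d2) {R : realType}.
Variables (m1 : {sigma_finite_measure set T1 -> \bar R})
  (m2 : {sigma_finite_measure set T2 -> \bar R}).
Variables (A : set T1) (C : set T2).
Hypotheses (mA : measurable A) (mC : measurable C).
Local Open Scope ereal_scope.

Lemma patch_setX (f : T1 * T2 -> \bar R) x y :
  (f \_ (A `*` C)) (x, y) = ((fun y => ((fun x => f (x, y)) \_ A) x) \_ C) y.
Proof.
rewrite !patchE; have -> : ((x, y) \in A `*` C) = (x \in A) && (y \in C).
  by apply/idP/andP; rewrite !inE => -[].
by case: (x \in A); case: (y \in C).
Qed.

Lemma fubini_setX (f : T1 * T2 -> \bar R) :
  (m1 \x m2).-integrable (A `*` C) f ->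
  \int[m1 \x m2]_(z in A `*` C) f z =
  \int[m2]_(y in C) \int[m1]_(x in A) f (x, y).
Proof.
move=> intf; rewrite integral_mkcond -integral21_prod_meas1.
  rewrite [RHS]integral_mkcond; apply: eq_integral => y _.
  rewrite /fubini_G patchE; case: ifPn => yC.
    rewrite [RHS]integral_mkcond; apply: eq_integral => x _.
    by rewrite patch_setX patchE yC.
  by rewrite integral0_eq// => x _; rewrite patch_setX patchE (negbTE yC).
by have [+ _] := @integrable_mkcond _ _ R (m1 \x m2) _ f (measurableX mA mC); apply.
Qed.

Lemma fubini_setX_swap (f : T1 * T2 -> \bar R) :
  (m1 \x m2).-integrable (A `*` C) f ->
  \int[m1 \x m2]_(z in A `*` C) f z =
  \int[m1]_(x in A) \int[m2]_(y in C) f (x, y).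
Proof.
move=> intf; rewrite integral_mkcond -integral12_prod_meas1.
  rewrite [RHS]integral_mkcond; apply: eq_integral => x _.
  rewrite /fubini_F patchE; case: ifPn => xA.
    rewrite [RHS]integral_mkcond; apply: eq_integral => y _.
    by rewrite patch_setX !patchE xA.
  rewrite integral0_eq// => y _; rewrite patch_setX patchE.
  by case: ifP => // _; rewrite patchE (negbTE xA).
by have [+ _] := @integrable_mkcond _ _ R (m1 \x m2) _ f (measurableX mA mC); apply.
Qed.

End FubiniSets.

(** * Rotation invariance of spherical means *)

Section RotationInvariance.
Context {R : realType}.
Local Notation mu := (@lebesgue_measure R).
Local Notation mu2 := (mu \x mu)%E.
Local Notation Th := (`]0, pi[%classic : set R).
Local Notation Ph := (`]0, (2 * pi)[%classic : set R).

Let mB : measurable (Th `*` Ph).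
Proof. by apply: measurableX. Qed.

Lemma box_measure_finite : (mu2 (Th `*` Ph) < +oo)%E.
Proof.
have p0 := @pi_gt0 R; have p20 : 0 < 2 * pi :> R by rewrite mulr_gt0.
have e1 : mu Th = pi%:E by rewrite lebesgue_measure_itv/= lte_fin p0 -EFinB subr0.
have e2 : mu Ph = (2 * pi)%:E by rewrite lebesgue_measure_itv/= lte_fin p20 -EFinB subr0.
rewrite [X in (X < _)%E](_ : _ = (pi%:E * (2 * pi)%:E)%E) ?ltry//.
by rewrite -e1 -e2; exact: product_measure1E.
Qed.

Lemma integrable_box (f : R * R -> R) (M : R) : measurable_fun setT f ->
  (forall z, (Th `*` Ph) z -> `|f z| <= M) -> mu2.-integrable (Th `*` Ph) (EFin \o f).
Proof.
move=> mf fM; apply: measurable_bounded_integrable => //.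
- exact: box_measure_finite.
- exact: measurable_funTS.
- exists M; split; first exact: num_real.
  by move=> x Mx z Bz; exact: le_trans (fM z Bz) (ltW Mx).
Qed.

Lemma norm_lincomb3 (a b c v1 v2 v3 M : R) : `|a| <= M -> `|b| <= M -> `|c| <= M ->
  `|a * v1 + b * v2 + c * v3| <= M * (`|v1| + `|v2| + `|v3|).
Proof.
move=> a1 b1 c1; rewrite !mulrDr.
apply: le_trans (ler_normD _ _) _; apply: lerD; last by rewrite normrM ler_wpM2r.
by apply: le_trans (ler_normD _ _) _; apply: lerD; rewrite normrM ler_wpM2r.
Qed.

Variable u : 'R3 R -> R.
Hypothesis cu : C1 u.
Variable be : R.

Let du : forall x, differentiable u x := proj1 cu.

Let X al (z : R * R) : 'R3 R := rot al be z.1 z.2.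

Let in_cube_X al z : in_cube (X al z).
Proof. by apply: in_cube_sphere; exact: dot_rot. Qed.

(** A single constant bounds u and its differential at all points of the sphere; it
    provides the dominating function for differentiation under the integral sign. *)
Lemma bounded_C1 : exists2 M : R, 0 <= M &
  forall x, in_cube x -> `|u x| <= M /\ forall v, `|dot (egrad u x) v| <= M * (`|v.1.1| + `|v.1.2| + `|v.2|).
Proof.
have [M0 M00 h0] := continuous_bounded_cube (C1_continuous cu).
have [M1 M10 h1] := continuous_bounded_cube (cu.2 (1, 0, 0)).
have [M2 M20 h2] := continuous_bounded_cube (cu.2 (0, 1, 0)).
have [M3 M30 h3] := continuous_bounded_cube (cu.2 (0, 0, 1)).
have [M [Mge0 l0 l1 l2 l3]] : exists M : R,
    [/\ 0 <= M, M0 <= M, M1 <= M, M2 <= M & M3 <= M].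
  by exists (M0 + M1 + M2 + M3); clear -M00 M10 M20 M30; split; lra.
exists M => // x cx.
split; first exact: le_trans (h0 x cx) l0.
move=> [[v1 v2] v3]; rewrite /dot /egrad/=.
have k1 : `|'D_(1, 0, 0) u x| <= M by exact: le_trans (h1 x cx) l1.
have k2 : `|'D_(0, 1, 0) u x| <= M by exact: le_trans (h2 x cx) l2.
have k3 : `|'D_(0, 0, 1) u x| <= M by exact: le_trans (h3 x cx) l3.
exact: (norm_lincomb3 v1 v2 v3 k1 k2 k3).
Qed.

Lemma measurable_egrad_dot (al : R) (v : R * R -> 'R3 R) :
  measurable_fun setT (fun z => (v z).1.1) -> measurable_fun setT (fun z => (v z).1.2) ->
  measurable_fun setT (fun z => (v z).2) ->
  measurable_fun setT (fun z => dot (egrad u (X al z)) (v z)).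
Proof.
move=> m1 m2 m3; have mX : measurable_fun setT (X al) by exact: measurable_rot.
have mD w : measurable_fun setT (fun z => 'D_w u (X al z)).
  have mDu : measurable_fun setT (fun x => 'D_w u x).
    by apply: continuous_measurable_R3; exact: cu.2.
  exact: (measurableT_comp mDu mX).
by rewrite /dot /egrad/=; apply: measurable_funD; first apply: measurable_funD;
  apply: measurable_funM.
Qed.

Definition sphere_mean al : R :=
  \int[mu2]_(z in Th `*` Ph) (u (X al z) * sin z.1).

Let ms : measurable_fun setT (@sin R).
Proof. by apply: continuous_measurable_fun; exact: continuous_sin. Qed.
Let mc : measurable_fun setT (@cos R).
Proof. by apply: continuous_measurable_fun; exact: continuous_cos. Qed.
Let m1 : measurable_fun setT (fun z : R * R => sin z.1).
Proof. exact: measurableT_comp. Qed.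
Let m2 : measurable_fun setT (fun z : R * R => cos z.1).
Proof. exact: measurableT_comp. Qed.
Let mb : measurable_fun setT (fun z : R * R => z.2 - be).
Proof. exact: measurable_funB. Qed.
Let m3 : measurable_fun setT (fun z : R * R => sin (z.2 - be)).
Proof. exact: (measurableT_comp ms). Qed.
Let m4 : measurable_fun setT (fun z : R * R => cos (z.2 - be)).
Proof. exact: (measurableT_comp mc). Qed.
Let mu_X al : measurable_fun setT (fun z : R * R => u (X al z)).
Proof.
apply: measurableT_comp; last exact: measurable_rot.
by apply: continuous_measurable_R3; exact: C1_continuous.
Qed.

Ltac mtac := repeat first [exact: measurable_cst | exact: m1 | exact: m2 | exact: m3
  | exact: m4 | exact: mu_X | apply: measurable_funM | apply: measurable_funN | apply: measurable_funB
  | apply: measurable_funD].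

Let mdth al : measurable_fun setT
  (fun z : R * R => dot (egrad u (X al z)) (rot_dth al be z.1 z.2)).
Proof. by apply: measurable_egrad_dot; rewrite /rot_dth /=; mtac. Qed.

Let mdph al : measurable_fun setT
  (fun z : R * R => dot (egrad u (X al z)) (rot_dph al be z.1 z.2)).
Proof. by apply: measurable_egrad_dot; rewrite /rot_dph /=; mtac. Qed.

Let div_th al (z : R * R) := cos (z.2 - be) * (cos z.1 * u (X al z) +
   sin z.1 * dot (egrad u (X al z)) (rot_dth al be z.1 z.2)).
Let div_ph al (z : R * R) := cos z.1 * (cos (z.2 - be) * u (X al z) +
   sin (z.2 - be) * dot (egrad u (X al z)) (rot_dph al be z.1 z.2)).

Let n1 (a b : R) : `|a| <= 1 -> `|b| <= 1 -> `|a * b| <= 1.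
Proof. by move=> a1 b1; rewrite normrM mulr_ile1. Qed.

Ltac btac := repeat first [exact: cos_max | exact: sin_max | apply: n1 | rewrite normrN].

Let norm_rot_d al z : [/\ `|(rot_dth al be z.1 z.2).1.1| + `|(rot_dth al be z.1 z.2).1.2| + `|(rot_dth al be z.1 z.2).2| <= 8,
  `|(rot_dph al be z.1 z.2).1.1| + `|(rot_dph al be z.1 z.2).1.2| + `|(rot_dph al be z.1 z.2).2| <= 8 &
  `|(rot_dal al be z.1 z.2).1.1| + `|(rot_dal al be z.1 z.2).1.2| + `|(rot_dal al be z.1 z.2).2| <= 8].
Proof.
have n2 (a b : R) : `|a| <= 1 -> `|b| <= 1 -> `|a + b| <= 2.
  by move=> a1 b1; rewrite (le_trans (ler_normD _ _))//; lra.
have n3 (a b c : R) : `|a| <= 1 -> `|b| <= 1 -> `|c| <= 1 -> `|a + b + c| <= 3.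
  move=> a1 b1 c1; rewrite (le_trans (ler_normD _ _))//.
  by have := n2 _ _ a1 b1; lra.
have s3 (a b c : R) : `|a| <= 3 -> `|b| <= 3 -> `|c| <= 2 -> `|a| + `|b| + `|c| <= 8 by lra.
have s2 (a b c : R) : `|a| <= 2 -> `|b| <= 2 -> `|c| <= 2 -> `|a| + `|b| + `|c| <= 8 by lra.
have s1 (a b c : R) : `|a| <= 2 -> `|b| <= 2 -> `|c| <= 1 -> `|a| + `|b| + `|c| <= 8 by lra.
split; rewrite /rot_dth /rot_dph /rot_dal /=.
- by apply: s3; [apply: n3|apply: n3|apply: n2]; btac.
- by apply: s1; [apply: n2|apply: n2|]; btac.
- by apply: s2; apply: n2; btac.
Qed.

Let bound_div : exists2 M : R, 0 <= M & forall al z,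
  [/\ `|u (X al z)| <= M, `|div_th al z| <= M, `|div_ph al z| <= M &
   `|dot (egrad u (X al z)) (rot_dal al be z.1 z.2)| <= M].
Proof.
have [M M0 hM] := bounded_C1; exists (9 * M) => [|al z]; first by rewrite mulr_ge0.
have [hu hv] := hM _ (in_cube_X al z); have [e1 e2 e3] := norm_rot_d al z.
have k v : `|v.1.1| + `|v.1.2| + `|v.2| <= 8 -> `|dot (egrad u (X al z)) v| <= 8 * M.
  by move=> h; apply: le_trans (hv v) _; rewrite mulrC ler_wpM2r.
have w (a b c x y : R) : `|a| <= 1 -> `|b| <= 1 -> `|c| <= 1 -> `|x| <= M -> `|y| <= 8 * M ->
    `|a * (b * x + c * y)| <= 9 * M.
  move=> a1 b1 c1 x1 y1; rewrite normrM.
  have h : `|b * x + c * y| <= 9 * M.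
    rewrite (le_trans (ler_normD _ _))// !normrM.
    have : `|b| * `|x| <= 1 * M by rewrite ler_pM.
    have : `|c| * `|y| <= 1 * (8 * M) by rewrite ler_pM.
    lra.
  by rewrite -[leRHS]mul1r ler_pM.
split.
- by rewrite (le_trans hu)//; lra.
- by apply: w => //; [exact: cos_max|exact: cos_max|exact: sin_max|exact: k].
- by apply: w => //; [exact: cos_max|exact: cos_max|exact: sin_max|exact: k].
- by rewrite (le_trans (k _ e3))//; lra.
Qed.

Let mdiv_th al : measurable_fun setT (div_th al).
Proof. by rewrite /div_th; apply: measurable_funM => //; apply: measurable_funD; apply: measurable_funM. Qed.

Let mdiv_ph al : measurable_fun setT (div_ph al).
Proof. by rewrite /div_ph; apply: measurable_funM => //; apply: measurable_funD; apply: measurable_funM. Qed.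

Lemma fubini_box (f : R * R -> R) (M : R) : measurable_fun setT f ->
  (forall z, `|f z| <= M) ->
  (\int[mu2]_(z in Th `*` Ph) (f z)%:E = \int[mu]_(y in Ph) \int[mu]_(x in Th) (f (x, y))%:E)%E.
Proof.
by move=> mf fM; apply: fubini_setX => //; apply: (integrable_box mf) => z _; exact: fM.
Qed.

Lemma fubini_box_swap (f : R * R -> R) (M : R) : measurable_fun setT f ->
  (forall z, `|f z| <= M) ->
  (\int[mu2]_(z in Th `*` Ph) (f z)%:E = \int[mu]_(x in Th) \int[mu]_(y in Ph) (f (x, y))%:E)%E.
Proof.
by move=> mf fM; apply: fubini_setX_swap => //; apply: (integrable_box mf) => z _; exact: fM.
Qed.

Definition continuousR (f : R -> R) := continuous f.

Let cstc (a : R) : continuousR (fun _ : R => a). Proof. by move=> ?; exact: cvg_cst. Qed.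
Let ccos (f : R -> R) : continuousR f -> continuousR (fun x => cos (f x)).
Proof. by move=> cf x; apply: (@continuous_comp _ _ _ f (@cos R)); [exact: cf|exact: continuous_cos]. Qed.
Let csin (f : R -> R) : continuousR f -> continuousR (fun x => sin (f x)).
Proof. by move=> cf x; apply: (@continuous_comp _ _ _ f (@sin R)); [exact: cf|exact: continuous_sin]. Qed.
Let cid : continuousR (fun x : R => x). Proof. by move=> ?; exact: cvg_id. Qed.
Let cadd (f g : R -> R) : continuousR f -> continuousR g -> continuousR (fun x => f x + g x).
Proof. by move=> cf cg x; apply: cvgD; [exact: cf|exact: cg]. Qed.
Let copp (f : R -> R) : continuousR f -> continuousR (fun x => - f x).
Proof. by move=> cf x; apply: cvgN; exact: cf. Qed.
Let cmul (f g : R -> R) : continuousR f -> continuousR g -> continuousR (fun x => f x * g x).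
Proof. by move=> cf cg x; apply: cvgM; [exact: cf|exact: cg]. Qed.

Ltac ctac := lazymatch goal with
  | |- continuousR (fun x => @?f x + @?g x) => apply: (@cadd f g) => /=; ctac
  | |- continuousR (fun x => @?f x * @?g x) => apply: (@cmul f g) => /=; ctac
  | |- continuousR (fun x => - @?f x) => apply: (@copp f) => /=; ctac
  | |- continuousR (fun x => cos (@?f x)) => apply: (@ccos f) => /=; ctac
  | |- continuousR (fun x => sin (@?f x)) => apply: (@csin f) => /=; ctac
  | |- continuousR cos => exact: continuous_cos
  | |- continuousR sin => exact: continuous_sin
  | |- continuousR (fun x => x) => exact: cid
  | |- continuousR (fun x => ?a) => exact: cstc
  | |- _ => idtac end.

Lemma continuous_egrad_dot (g1 g2 g3 v1 v2 v3 : R -> R) :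
  continuousR g1 -> continuousR g2 -> continuousR g3 -> continuousR v1 -> continuousR v2 -> continuousR v3 ->
  continuousR (fun t => dot (egrad u (g1 t, g2 t, g3 t)) (v1 t, v2 t, v3 t)).
Proof.
move=> c1 c2 c3 d1 d2 d3 t; rewrite /dot /egrad/=.
have cD w : 'D_w u (g1 x, g2 x, g3 x) @[x --> t] --> 'D_w u (g1 t, g2 t, g3 t).
  apply: (@continuous_comp _ _ _ (fun x => (g1 x, g2 x, g3 x)) (fun x => 'D_w u x)); last exact: cu.2.
  exact: (cvg_pair (cvg_pair (c1 t) (c2 t)) (c3 t)).
by apply: cvgD; [apply: cvgD|]; apply: cvgM; [exact: cD|exact: d1|exact: cD|exact: d2|exact: cD|exact: d3].
Qed.

Lemma continuous_rot_dth al ph :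
  continuousR (fun t => dot (egrad u (rot al be t ph)) (rot_dth al be t ph)).
Proof. by rewrite /rot /rot_dth; apply: continuous_egrad_dot; ctac. Qed.

Lemma continuous_rot_dph al th :
  continuousR (fun t => dot (egrad u (rot al be th t)) (rot_dph al be th t)).
Proof. by rewrite /rot /rot_dph; apply: continuous_egrad_dot; ctac. Qed.

Let cu_th al ph : continuousR (fun t => u (rot al be t ph)).
Proof. by move=> t; exact: is_derive_continuous (is_derive_rot_th du al be ph t). Qed.

Let cu_ph al th : continuousR (fun t => u (rot al be th t)).
Proof. by move=> t; exact: is_derive_continuous (is_derive_rot_ph du al be th t). Qed.

Let div_th0 al : (\int[mu2]_(z in Th `*` Ph) (div_th al z)%:E = 0)%E.
Proof.
have [M _ hM] := bound_div.
rewrite (fubini_box (M := M)) //; last by move=> z; case: (hM al z).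
apply: integral0_eq => y _; rewrite /div_th /X /=.
have dF (x : R) : 0 <= x <= pi -> is_derive x 1
    (fun x => cos (y - be) * (sin x * u (rot al be x y)))
    (cos (y - be) * (cos x * u (rot al be x y) +
      sin x * dot (egrad u (rot al be x y)) (rot_dth al be x y))).
  move=> _; apply: (is_derive_eq (derM (der_cst x (cos (y - be)))
    (derM (is_derive_sin x) (is_derive_rot_th du al be y x)))).
  by rewrite /=; ring.
rewrite (FTC_Ioo (pi_gt0 R) dF).
  by rewrite sinpi sin0 !mul0r !mulr0 subrr.
move=> x _; move: x; apply: cmul; first exact: cstc.
apply: cadd; apply: cmul; [ctac|exact: cu_th|ctac|exact: continuous_rot_dth].
Qed.

Let div_ph0 al : (\int[mu2]_(z in Th `*` Ph) (div_ph al z)%:E = 0)%E.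
Proof.
have [M _ hM] := bound_div.
rewrite (fubini_box_swap (M := M)) //; last by move=> z; case: (hM al z).
apply: integral0_eq => x _; rewrite /div_ph /X /=.
have dF (y : R) : 0 <= y <= 2 * pi -> is_derive y 1
    (fun y => cos x * (sin (y - be) * u (rot al be x y)))
    (cos x * (cos (y - be) * u (rot al be x y) +
      sin (y - be) * dot (egrad u (rot al be x y)) (rot_dph al be x y))).
  move=> _; have ds : is_derive y 1 (fun y => sin (y - be)) (cos (y - be)).
    by eapply is_derive_eq; [der|rewrite /=; ring].
  apply: (is_derive_eq (derM (der_cst y (cos x)) (derM ds (is_derive_rot_ph du al be x y)))).
  by rewrite /=; ring.
have p20 : 0 < 2 * pi :> R by rewrite mulr_gt0// pi_gt0.
rewrite (FTC_Ioo p20 dF).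
  have e : 2 * pi = pi *+ 2 :> R by rewrite mulr2n mulrDl mul1r.
  have es : sin (2 * pi - be) = sin (0 - be) by rewrite e sinB sin2pi cos2pi sub0r sinN; ring.
  have ec : cos (2 * pi - be) = cos (0 - be) by rewrite e cosB sin2pi cos2pi sub0r cosN; ring.
  have -> : rot al be x (2 * pi) = rot al be x 0 by rewrite /rot es ec.
  by rewrite es subrr.
move=> y _; move: y; apply: cmul; first exact: cstc.
apply: cadd; apply: cmul; [ctac|exact: cu_ph|ctac|exact: continuous_rot_dph].
Qed.

(** Rotations preserve the spherical mean of u: the derivative of u sin th in the
    tilt angle al is the divergence
    d/dth (cos (ph - be) sin th u) - d/dph (cos th sin (ph - be) u).
    The first term integrates to zero because sin vanishes at 0 and pi, the second by
    periodicity in ph. *)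
Lemma sphere_mean_cst al : sphere_mean al = sphere_mean 0.
Proof.
apply: is_derive_0_is_cst => a.
have [M M0 hM] := bound_div.
pose f (al : R) (z : R * R) := u (X al z) * sin z.1.
have df (a' : R) (z : R * R) : is_derive a' 1 (f ^~ z)
    (dot (egrad u (X a' z)) (rot_dal a' be z.1 z.2) * sin z.1).
  have h := is_derive_rot_al du be z.1 z.2 a'.
  by apply: (is_derive_eq (derM h (der_cst a' (sin z.1)))); rewrite /X /=; ring.
have intf a' : mu2.-integrable (Th `*` Ph) (EFin \o f a').
  apply: (integrable_box (M := M)); first exact: measurable_funM.
  move=> z _; rewrite /f normrM -[leRHS]mulr1 ler_pM//; last exact: sin_max.
  by case: (hM a' z).
have d1E a' z : partial1of2 f a' z =
    dot (egrad u (X a' z)) (rot_dal a' be z.1 z.2) * sin z.1.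
  by rewrite partial1of2E; case: (df a' z) => _ ->.
have inta : (`]a - 1, a + 1[%classic : set R) a by rewrite /= in_itv/=; lra.
have intM : mu2.-integrable (Th `*` Ph) (EFin \o (fun _ : R * R => M)).
  by apply: (integrable_box (M := M)) => // z _; rewrite ger0_norm.
have dM (x : R) (z : R * R) : `]a - 1, a + 1[%classic x -> (Th `*` Ph) z -> `|partial1of2 f x z| <= M.
  move=> _ _; rewrite d1E normrM -[leRHS]mulr1 ler_pM//; last exact: sin_max.
  by case: (hM x z).
have int0 : \int[mu2]_(z in Th `*` Ph) (partial1of2 f a z) = 0.
  have -> : \int[mu2]_(z in Th `*` Ph) (partial1of2 f a z) =
      \int[mu2]_(z in Th `*` Ph) (div_th a z - div_ph a z).
    apply: eq_Rintegral => z _; rewrite d1E rot_dal_comb /div_th /div_ph; ring.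
  rewrite RintegralB//.
  - by rewrite /Rintegral div_th0 div_ph0 subrr.
  - by apply: (integrable_box (M := M)) => // z _; case: (hM a z).
  - by apply: (integrable_box (M := M)) => // z _; case: (hM a z).
have derf x z : `]a - 1, a + 1[%classic x -> (Th `*` Ph) z -> derivable (f ^~ z) x 1.
  by move=> _ _; case: (df x z).
have smE : sphere_mean = (fun x' => \int[mu2]_(z in Th `*` Ph) f x' z) by [].
rewrite smE; apply: DeriveDef.
- apply: (derivable_under_integral _ inta (fun x _ => intf x) derf (fun _ => M0) intM dM).
  exact: measurableX.
- rewrite -derive1E -[RHS]int0.
  apply: (differentiation_under_integral _ inta (fun x _ => intf x) derf (fun _ => M0) intM dM).
  exact: measurableX.
Qed.

End RotationInvariance.

(** * Closure properties of smooth functions *)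

Section Smooth.
Context {R : realType}.
Implicit Types (F G : 'R3 R -> R) (n : nat).

Lemma CdiffS n F : Cdiff n.+1 F <->
  (forall x, differentiable F x) /\ (forall v, Cdiff n (fun x => 'D_v F x)).
Proof. by []. Qed.

Lemma Cdiff_continuous n F : Cdiff n F -> continuous F.
Proof. by case: n => // n [dF _] x; exact: differentiable_continuous. Qed.

Lemma CdiffW n F : Cdiff n.+1 F -> Cdiff n F.
Proof.
elim: n F => [|n ih] F [dF cF]; first by move=> x; exact: differentiable_continuous.
by split => // v; exact/ih/cF.
Qed.

Lemma Cdiff_cst n (c : R) : Cdiff n (fun=> c).
Proof.
elim: n c => [|n ih] c; first by move=> x; exact: cvg_cst.
split=> [x|v]; first exact: differentiable_cst.
have -> : 'D_v (fun=> c) = (fun _ : 'R3 R => 0 : R); last exact: ih.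
by apply/funext => x; exact: derive_cst.
Qed.

Lemma CdiffD n F G : Cdiff n F -> Cdiff n G -> Cdiff n (fun x => F x + G x).
Proof.
elim: n F G => [|n ih] F G; first by move=> cF cG x; apply: cvgD; [exact: cF|exact: cG].
move=> /CdiffS[dF cF] /CdiffS[dG cG]; apply/CdiffS; split=> [x|v]; first exact: differentiableD.
have -> : 'D_v (fun x => F x + G x) = (fun x => 'D_v F x + 'D_v G x).
  by apply/funext => x; rewrite deriveD//; exact: diff_derivable.
exact: ih (cF v) (cG v).
Qed.

Lemma CdiffM n F G : Cdiff n F -> Cdiff n G -> Cdiff n (fun x => F x * G x).
Proof.
elim: n F G => [|n ih] F G; first by move=> cF cG x; apply: cvgM; [exact: cF|exact: cG].
move=> CF CG; have /CdiffS[dF cF] := CF; have /CdiffS[dG cG] := CG.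
apply/CdiffS; split=> [x|v]; first exact: differentiableM.
have -> : 'D_v (fun x => F x * G x) = (fun x => F x * 'D_v G x + G x * 'D_v F x).
  by apply/funext => x; rewrite deriveM//; exact: diff_derivable.
exact: CdiffD (ih _ _ (CdiffW CF) (cG v)) (ih _ _ (CdiffW CG) (cF v)).
Qed.

Lemma CdiffN n F : Cdiff n F -> Cdiff n (fun x => - F x).
Proof.
move=> CF; rewrite (_ : (fun x => _) = fun x => -1 * F x).
  by apply: CdiffM => //; exact: Cdiff_cst.
by apply/funext => x; rewrite mulN1r.
Qed.

Lemma Cdiff_linear n (l : 'R3 R -> R) : linear l -> continuous l -> Cdiff n l.
Proof.
move=> ll cl; case: n => [|n]//.
pose L := GRing.isLinear.Build R _ _ _ l ll.
pose lL : {linear 'R3 R -> R} := HB.pack l L.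
have dl x : differentiable l x by exact: (@linear_differentiable _ _ _ lL).
apply/CdiffS; split => // v.
have -> : 'D_v l = (fun=> l v); last exact: Cdiff_cst.
by apply/funext => x; rewrite deriveE// (@diff_lin _ _ _ lL).
Qed.

Lemma Cdiff_fst n : Cdiff n (fun x : 'R3 R => x.1.1).
Proof.
apply: Cdiff_linear => // x.
by apply: (@continuous_comp _ _ _ fst fst); exact: cvg_fst.
Qed.

Lemma Cdiff_snd n : Cdiff n (fun x : 'R3 R => x.1.2).
Proof.
apply: Cdiff_linear => // x.
by apply: (@continuous_comp _ _ _ fst snd); [exact: cvg_fst|exact: cvg_snd].
Qed.

Lemma Cdiff_thd n : Cdiff n (fun x : 'R3 R => x.2).
Proof. by apply: Cdiff_linear => // x; exact: cvg_snd. Qed.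

Lemma derive_comp1 (h : R -> R) (d : R) F x v : differentiable F x ->
  is_derive (F x) 1 h d ->
  differentiable (fun y => h (F y)) x /\ 'D_v (fun y => h (F y)) x = d * 'D_v F x.
Proof.
move=> dF [dh hE]; have dh' : differentiable h (F x) by exact/derivable1_diffP.
have dhF : differentiable (fun y => h (F y)) x by exact: (differentiable_comp dF dh').
split=> //; rewrite !deriveE// (@diff_comp _ _ _ _ F h x dF dh') /=.
by rewrite diff1E// derive1E hE /GRing.scale/= mulrC.
Qed.

Lemma Cdiff_exp n F : Cdiff n F -> Cdiff n (fun x => expR (F x)).
Proof.
elim: n F => [|n ih] F CF.
  by move=> x; apply: (@continuous_comp _ _ _ F expR); [exact: CF|exact: continuous_expR].
have /CdiffS[dF cF] := CF; have D x v := @derive_comp1 expR _ F x v (dF x) (is_derive_expR _).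
apply/CdiffS; split=> [x|v]; first by have [] := D x 0.
have -> : 'D_v (fun x => expR (F x)) = (fun x => expR (F x) * 'D_v F x).
  by apply/funext => x; have [] := D x v.
exact: CdiffM (ih _ (CdiffW CF)) (cF v).
Qed.

Lemma Cdiff_ln n F : (forall x, 0 < F x) -> Cdiff n F -> Cdiff n (fun x => ln (F x)).
Proof.
move=> F0; elim: n => [|n ih] CF.
  by move=> x; apply: (@continuous_comp _ _ _ F (@ln R)); [exact: CF|exact: continuous_ln].
have /CdiffS[dF cF] := CF; have D x v := @derive_comp1 (@ln R) _ F x v (dF x) (is_derive1_ln (F0 x)).
apply/CdiffS; split=> [x|v]; first by have [] := D x 0.
have -> : 'D_v (fun x => ln (F x)) = (fun x => expR (- ln (F x)) * 'D_v F x).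
  by apply/funext => x; have [_ ->] := D x v; rewrite expRN lnK// posrE.
exact: CdiffM (Cdiff_exp (CdiffN (ih (CdiffW CF)))) (cF v).
Qed.

End Smooth.

Ltac cdiff := repeat first [exact: Cdiff_cst | exact: Cdiff_fst | exact: Cdiff_snd
  | exact: Cdiff_thd | apply: CdiffD | apply: CdiffM | apply: CdiffN | apply: Cdiff_exp].

(** * Rotation invariance of the surface measure *)

Section SphericalIntegral.
Context {R : realType}.
Local Notation mu := (@lebesgue_measure R).
Local Notation mu2 := (mu \x mu)%E.
Local Notation Th := (`]0, pi[%classic : set R).
Local Notation Ph := (`]0, (2 * pi)[%classic : set R).

(** Smooth functions with values in [0, 1] that converge pointwise to the indicator
    of the open octant x1 < a, x2 < b, x3 < c, at its boundary points too: the exponent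
    n^2 y + n tends to -oo for y < 0 and to +oo for y >= 0. *)
Definition smooth_box (a b c : R) (n : nat) (x : 'R3 R) : R :=
  expR (- (expR (n%:R * n%:R * (x.1.1 - a) + n%:R)
    + expR (n%:R * n%:R * (x.1.2 - b) + n%:R) + expR (n%:R * n%:R * (x.2 - c) + n%:R))).

Lemma C1_smooth_box a b c n : C1 (smooth_box a b c n).
Proof. by apply: smooth_C1 => k; rewrite /smooth_box; cdiff. Qed.

Lemma steep_exp_cvg0 (y : R) : y < 0 ->
  expR (n%:R * n%:R * y + n%:R) @[n --> \oo] --> 0.
Proof.
move=> y0.
apply: (@squeeze_cvgr _ _ _ _ (fun=> 0) (fun n : nat => expR (1 *- n))); first last.
- exact: cvgn_expR.
- exact: cvg_cst.
have d0 : 0 <= 2 / - y by rewrite divr_ge0// oppr_ge0 ltW.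
exists (Num.Def.archi_bound (2 / - y)) => //= n ndn.
rewrite expR_ge0/= ler_expR.
have h : 2 / - y <= n%:R.
  by rewrite (le_trans (ltW (archi_boundP d0)))// ler_nat.
move: h; rewrite ler_pdivrMr ?oppr_gt0// => h.
have n0 : 0 <= n%:R :> R by [].
rewrite -[leRHS]/(- n%:R); move: (n%:R) n0 h => m m0 h.
have : 0 <= m * (m * - y - 2) by rewrite mulr_ge0// subr_ge0.
lra.
Qed.

Lemma smooth_box_ge0 a b c n x : 0 <= smooth_box a b c n x.
Proof. exact: expR_ge0. Qed.

Lemma smooth_box_le1 a b c n x : smooth_box a b c n x <= 1.
Proof. by rewrite /smooth_box -expR0 ler_expR oppr_le0 !addr_ge0 ?expR_ge0. Qed.

Definition box (a b c : R) : set ('R3 R) := (`]-oo, a[ `*` `]-oo, b[) `*` `]-oo, c[.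

Lemma smooth_box_cvg (a b c : R) (x : 'R3 R) :
  smooth_box a b c n x @[n --> \oo] --> (\1_(box a b c) x : R).
Proof.
rewrite indicE; case: (boolP (x \in _)); rewrite /box.
  rewrite inE => -[[/=]]; rewrite !in_itv/= => xa xb xc.
  have -> : true%:R = expR (- (0 + 0 + 0)) :> R by rewrite !addr0 oppr0 expR0.
  have cE : continuous (fun y : R => expR (- y)).
    by move=> y; apply: continuous_comp; [exact: opp_continuous|exact: continuous_expR].
  have [ya yb yc] : [/\ x.1.1 - a < 0, x.1.2 - b < 0 & x.2 - c < 0].
    by rewrite !subr_lt0.
  have hs : expR (n%:R * n%:R * (x.1.1 - a) + n%:R) + expR (n%:R * n%:R * (x.1.2 - b) + n%:R)
      + expR (n%:R * n%:R * (x.2 - c) + n%:R) @[n --> \oo] --> 0 + 0 + 0.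
    by apply: cvgD; [apply: cvgD|]; exact: steep_exp_cvg0.
  have gen (s : nat -> R) l : s n @[n --> \oo] --> l -> expR (- s n) @[n --> \oo] --> expR (- l).
    by move=> sl; apply: (cvg_comp s (fun y : R => expR (- y)) sl (cE l)).
  exact: gen hs.
move=> xQ.
apply: (@squeeze_cvgr _ _ _ _ (fun=> 0) (fun n : nat => expR (1 *- n))); first last.
- exact: cvgn_expR.
- exact: cvg_cst.
apply: nearW => n; rewrite smooth_box_ge0/= ler_expR -[leRHS]/(- n%:R) lerN2.
have big (y : R) : 0 <= y -> n%:R <= expR (n%:R * n%:R * y + n%:R).
  move=> y0; apply: (@le_trans _ _ (expR n%:R)).
    by rewrite (le_trans _ (expR_ge1Dx _))// lerDr.
  by rewrite ler_expR lerDr mulr_ge0.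
have [xa|xa] := leP a x.1.1.
  by rewrite -addrA (le_trans (big (x.1.1 - a) _)) ?subr_ge0// lerDl addr_ge0 ?expR_ge0.
have [xb|xb] := leP b x.1.2.
  rewrite addrAC (le_trans (big (x.1.2 - b) _)) ?subr_ge0// lerDr addr_ge0 ?expR_ge0//.
have [xc|xc] := leP c x.2.
  by rewrite (le_trans (big (x.2 - c) _)) ?subr_ge0// lerDr addr_ge0 ?expR_ge0.
by exfalso; move: xQ; rewrite notin_setE; apply; split => /=; [split|]; rewrite /= in_itv.
Qed.

(** The surface density is supported on a half-open rectangle, which differs from
    the open one by a null set. *)
Lemma density_iterated (f : R * R -> \bar R) : measurable_fun setT f ->
  (forall z, 0 <= f z)%E ->
  (\int[mu2]_z (f z * (sph_density z)%:E) =
   \int[mu]_(y in Ph) \int[mu]_(x in Th) (f (x, y) * (sin x)%:E))%E.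
Proof.
move=> mf f0.
pose h z := (f z * (sph_density z)%:E)%E.
have mh : measurable_fun setT h.
  by apply: emeasurable_funM => //; apply/measurable_EFinP; exact: measurable_sph_density.
have h0 z : (0 <= h z)%E by rewrite mule_ge0// lee_fin sph_density_ge0.
transitivity (\int[mu]_y fubini_G mu h y)%E; first by apply: fubini_tonelli2.
pose G := fubini_G mu h.
have mG : measurable_fun setT G by exact: measurable_fun_fubini_tonelli_G.
transitivity (\int[mu]_(y in `[0%R, (2 * pi)%R[) G y)%E.
  rewrite [RHS]integral_mkcond; apply: eq_integral => y _; rewrite patchE.
  case: ifPn => // yn; rewrite /G/fubini_G integral0_eq// => x _.
  rewrite /h /sph_density indicE (_ : ((x, y) \in _) = false) ?mulr0 ?mule0//.
  apply/negbTE; move: yn; rewrite !notin_setE => yn [_ /= yI].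
  exact: yn.
rewrite (@integral_itv_bndoo R 0 (2 * pi) G true true); last exact: measurable_funTS.
apply: eq_integral => y /set_mem /= yP; rewrite /G /fubini_G.
transitivity (\int[mu]_(x in `[0%R, pi]) (f (x, y) * (sin x)%:E))%E.
  rewrite [RHS]integral_mkcond; apply: eq_integral => x _; rewrite patchE /h /sph_density indicE.
  have -> : ((x, y) \in `[0, pi] `*` `[0, 2 * pi[) = (x \in (`[0, pi]%classic : set R)).
    apply/idP/idP; rewrite !inE; first by case.
    by move=> xI; split => //=; move: yP; rewrite !in_itv/= => /andP[/ltW -> ->].
  by case: ifPn; rewrite ?mulr1// mulr0 mule0.
apply: integral_itv_bndoo; apply: measurable_funTS; apply: emeasurable_funM.
  by apply: (measurableT_comp mf); exact: measurable_fun_pair.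
by apply/measurable_EFinP; apply: continuous_measurable_fun; exact: continuous_sin.
Qed.

End SphericalIntegral.

Section RotatedMeasure.
Context {R : realType} (al be : R).
Local Notation mu := (@lebesgue_measure R).
Local Notation mu2 := (mu \x mu)%E.

(** The surface measure read in spherical coordinates about the pole
    sph (al, be). *)
Definition sigma_rot (A : set ('R3 R)) : \bar R :=
  (\int[mu2]_(z in (fun z => rot al be z.1 z.2) @^-1` A) (sph_density z)%:E)%E.

Let sigma_rot0 : sigma_rot set0 = 0%E.
Proof. by rewrite /sigma_rot preimage_set0 integral_set0. Qed.

Let sigma_rot_ge0 A : (0 <= sigma_rot A)%E.
Proof. by apply: integral_ge0 => z _; rewrite lee_fin sph_density_ge0. Qed.

Let sigma_rot_semi_sigma_additive : semi_sigma_additive sigma_rot.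
Proof.
move=> F mF tF mUF; rewrite /sigma_rot preimage_bigcup.
have mX n : measurable ((fun z => rot al be z.1 z.2) @^-1` F n).
  by rewrite -[X in measurable X]setTI; exact: measurable_rot.
apply: (@semi_sigma_additive_nng_induced _ _ _ mu2 (fun z => (sph_density z)%:E)) => //.
- by apply/measurable_EFinP; exact: measurable_sph_density.
- by move=> z; rewrite lee_fin sph_density_ge0.
- apply/trivIsetP => /= i j _ _ ij; rewrite -preimage_setI.
  by move/trivIsetP : tF => /(_ _ _ _ _ ij) ->//; rewrite preimage_set0.
- by rewrite -preimage_bigcup -[X in measurable X]setTI; exact: measurable_rot.
Qed.

HB.instance Definition _ := isMeasure.Build _ _ _ sigma_rot
  sigma_rot0 sigma_rot_ge0 sigma_rot_semi_sigma_additive.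

End RotatedMeasure.

Section RotationInvariantMeasure.
Context {R : realType}.
Implicit Types (al be : R).
Local Notation mu := (@lebesgue_measure R).
Local Notation mu2 := (mu \x mu)%E.
Local Notation Th := (`]0, pi[%classic : set R).
Local Notation Ph := (`]0, (2 * pi)[%classic : set R).

Let mbox a b c : measurable (box a b c : set ('R3 R)).
Proof. by apply: measurableX => //; exact: measurableX. Qed.

Let msin : measurable_fun setT (fun z : R * R => sin z.1).
Proof.
apply: (@measurableT_comp _ _ _ _ _ _ (@sin R) _ fst) => //.
by apply: continuous_measurable_fun; exact: continuous_sin.
Qed.

Lemma sigma_rot_iterated al be (A : set ('R3 R)) : measurable A ->
  (sigma_rot al be A =
   \int[mu]_(y in Ph) \int[mu]_(x in Th) (\1_A (rot al be x y) * sin x)%:E)%E.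
Proof.
move=> mA.
have mf : measurable_fun setT (fun z : R * R => (\1_A (rot al be z.1 z.2) : R)%:E).
  have mi : measurable_fun setT (\1_A : 'R3 R -> R) by exact: measurable_indic.
  by apply/measurable_EFinP; exact: (measurableT_comp mi (measurable_rot al be)).
rewrite /sigma_rot integral_mkcond.
transitivity (\int[mu2]_z ((\1_A (rot al be z.1 z.2))%:E * (sph_density z)%:E))%E.
  apply: eq_integral => z _; rewrite patchE indicE.
  have -> : (z \in (fun z => rot al be z.1 z.2) @^-1` A) = (rot al be z.1 z.2 \in A).
    by apply/idP/idP; rewrite !inE.
  by case: (_ \in A); rewrite ?mul1e ?mul0e.
by rewrite (density_iterated mf)// => z; rewrite lee_fin.
Qed.

Lemma smooth_box_mean_cvg al be a b c :
  (\int[mu2]_(z in Th `*` Ph) (smooth_box a b c n (rot al be z.1 z.2) * sin z.1)%:E)%E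
    @[n --> \oo] --> sigma_rot al be (box a b c).
Proof.
have mX := @measurable_rot R al be.
have bnd (s t : R) : 0 <= s <= 1 -> `|s * sin t| <= 1.
  move=> /andP[s0 s1]; rewrite normrM (ger0_norm s0) -[leRHS]mulr1 ler_pM//.
  exact: sin_max.
have m1 : measurable_fun setT (fun z : R * R => \1_(box a b c) (rot al be z.1 z.2) * sin z.1 : R).
  have mi : measurable_fun setT (\1_(box a b c) : 'R3 R -> R) by exact: measurable_indic.
  by apply: measurable_funM => //; exact: (measurableT_comp mi mX).
rewrite sigma_rot_iterated//.
rewrite -(@fubini_box R (fun z => \1_(box a b c) (rot al be z.1 z.2) * sin z.1) 1)//; last first.
  by move=> z; apply: bnd; rewrite indicE; case: (_ \in _); rewrite lexx ler01.
apply: (@dominated_cvg _ _ _ _ _ _ _ _ (fun=> 1%:E)) => //.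
- exact: measurableX.
- move=> n; apply: measurable_funTS; apply/measurable_EFinP.
  have mb : measurable_fun setT (smooth_box a b c n).
    by apply: continuous_measurable_R3; apply: C1_continuous; exact: C1_smooth_box.
  by apply: measurable_funM => //; exact: (measurableT_comp mb mX).
- move=> z _; apply: cvg_EFin; first exact: nearW.
  by apply: cvgMl; exact: smooth_box_cvg.
- by apply: (@integrable_box R (fun=> 1) 1) => // z _; rewrite normr1.
- move=> n z _; rewrite abse_EFin lee_fin; apply: bnd.
  by rewrite smooth_box_ge0 smooth_box_le1.
Qed.

(** Both measures of an octant are limits of means of the same C1 functions, which
    do not depend on al. *)
Lemma sigma_rot_box al be a b c : sigma_rot al be (box a b c) = sigma_rot 0 be (box a b c).
Proof.
have l1 := @smooth_box_mean_cvg al be a b c.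
have l0 := @smooth_box_mean_cvg 0 be a b c.
suff e : (fun n => \int[mu2]_(z in Th `*` Ph)
      (smooth_box a b c n (rot al be z.1 z.2) * sin z.1)%:E)%E =
    (fun n => \int[mu2]_(z in Th `*` Ph)
      (smooth_box a b c n (rot 0 be z.1 z.2) * sin z.1)%:E)%E.
  by move: l1; rewrite e => l1; exact: (cvg_unique _ l1 l0).
apply/funext => n; have := sphere_mean_cst (C1_smooth_box a b c n) be al.
have fin t : (\int[mu2]_(z in Th `*` Ph)
    (smooth_box a b c n (rot t be z.1 z.2) * sin z.1)%:E)%E \is a fin_num.
  apply: integrable_fin_num; first exact: measurableX.
  apply: (@integrable_box R (fun z => smooth_box a b c n (rot t be z.1 z.2) * sin z.1) 1).
    have mb : measurable_fun setT (smooth_box a b c n).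
      by apply: continuous_measurable_R3; apply: C1_continuous; exact: C1_smooth_box.
    by apply: measurable_funM => //; exact: (measurableT_comp mb (measurable_rot t be)).
  move=> z _; rewrite normrM ger0_norm ?smooth_box_ge0// -[leRHS]mulr1 ler_pM//.
  - exact: smooth_box_ge0.
  - exact: smooth_box_le1.
  - exact: sin_max.
pose I (t : R) := (\int[mu2]_(z in Th `*` Ph)
    (smooth_box a b c n (rot t be z.1 z.2) * sin z.1)%:E)%E.
have smE t : sphere_mean (smooth_box a b c n) be t = fine (I t) by [].
have {}fin t : I t \is a fin_num by exact: fin.
rewrite !smE => e.
have eI : I al = I 0.
  move: (I al) (I 0) (fin al) (fin 0) e => A B fA fB e.
  by rewrite -(fineK fA) -(fineK fB) e.
exact: eI.
Qed.

Lemma sigma_rot0E be (A : set ('R3 R)) : sigma_rot 0 be A = sigma A.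
Proof.
rewrite /sigma_rot /sigma; congr (\int[_]_(z in _) _)%E.
by apply/seteqP; split => -[x y] /=; rewrite rot0.
Qed.

Lemma sigma_rot_lty al be : (sigma_rot al be [set: 'R3 R] < +oo)%E.
Proof.
rewrite sigma_rot_iterated//.
rewrite -(@fubini_box R (fun z => \1_setT (rot al be z.1 z.2) * sin z.1) 1).
- apply: integrable_lty; first exact: measurableX.
  apply: (@integrable_box R (fun z => \1_setT (rot al be z.1 z.2) * sin z.1) 1).
    by under eq_fun do rewrite indicT mul1r.
  by move=> z _; rewrite indicT mul1r sin_max.
- by under eq_fun do rewrite indicT mul1r.
- by move=> z; rewrite indicT mul1r sin_max.
Qed.

Lemma generated_by_boxes (A : set ('R3 R)) : measurable A ->
  <<s [set box t.1.1 t.1.2 t.2 | t in [set: 'R3 R]] >> A.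
Proof.
move=> mA; pose G := [set box t.1.1 t.1.2 t.2 | t in [set: 'R3 R]].
pose T := g_sigma_algebraType G.
have boxG a b c : (measurable : set (set T)) (box a b c).
  by apply: sub_sigma_algebra; exists (a, b, c).
have ray (f : T -> R) (F : R -> nat -> set T) : (forall a n, measurable (F a n)) ->
    (forall a, f @^-1` `]-oo, a[ = \bigcup_n F a n) -> measurable_fun setT f.
  move=> mF fF; apply: (measurability _ (RGenInftyO.measurableE R)).
  move=> _ [_ [a ->] <-]; rewrite setTI fF.
  exact: bigcupT_measurable.
have big (y : R) : exists n : nat, y < n%:R.
  have [y0|/ltW y0] := leP 0 y; last by exists 1%N; rewrite (le_lt_trans y0).
  by exists (Num.Def.archi_bound y); exact: archi_boundP.
have max1 (m k : nat) (y : R) : y < m%:R -> y < (maxn m k)%:R.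
  by move=> h; rewrite (lt_le_trans h)// ler_nat leq_maxl.
have max2 (m k : nat) (y : R) : y < k%:R -> y < (maxn m k)%:R.
  by move=> h; rewrite (lt_le_trans h)// ler_nat leq_maxr.
have m1 : measurable_fun setT (fun x : T => (x : 'R3 R).1.1).
  apply: (ray _ (fun a n => box a n%:R n%:R)) => // a.
  apply/seteqP; split => [[[x1 x2] x3] /= x1a|[[x1 x2] x3] [n _ [[]]]]//.
  have [k xk] := big x2; have [l xl] := big x3.
  by exists (maxn k l) => //; split => /=; [split|]; rewrite /= in_itv /= ?(max1 _ _ _ xk) ?(max2 _ _ _ xl).
have m2 : measurable_fun setT (fun x : T => (x : 'R3 R).1.2).
  apply: (ray _ (fun a n => box n%:R a n%:R)) => // a.
  apply/seteqP; split => [[[x1 x2] x3] /= x1a|[[x1 x2] x3] [n _ [[]]]]//.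
  have [k xk] := big x1; have [l xl] := big x3.
  by exists (maxn k l) => //; split => /=; [split|]; rewrite /= in_itv /= ?(max1 _ _ _ xk) ?(max2 _ _ _ xl).
have m3 : measurable_fun setT (fun x : T => (x : 'R3 R).2).
  apply: (ray _ (fun a n => box n%:R n%:R a)) => // a.
  apply/seteqP; split => [[[x1 x2] x3] /= x1a|[[x1 x2] x3] [n _ [[]]]]//.
  have [k xk] := big x1; have [l xl] := big x2.
  by exists (maxn k l) => //; split => /=; [split|]; rewrite /= in_itv /= ?(max1 _ _ _ xk) ?(max2 _ _ _ xl).
have mid : measurable_fun setT (fun x : T => ((x : 'R3 R).1.1, (x : 'R3 R).1.2, (x : 'R3 R).2)).
  by apply: measurable_fun_pair => //; exact: measurable_fun_pair.
have := mid measurableT A mA; rewrite setTI.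
by rewrite (_ : _ @^-1` A = A)//; apply/seteqP; split => -[[x1 x2] x3].
Qed.

(** Octants are stable under intersection, exhaust the space and generate the Borel
    sets, so two finite measures that agree on them are equal. *)
Lemma sigma_rotE al be (A : set ('R3 R)) : measurable A -> sigma_rot al be A = sigma A.
Proof.
move=> mA; rewrite -(sigma_rot0E be).
apply: (g_sigma_algebra_measure_unique [set box t.1.1 t.1.2 t.2 | t in [set: 'R3 R]]
   _ (fun n => box n%:R n%:R n%:R)).
- by move=> _ [[[a b] c] _ <-]; exact: mbox.
- by move=> n; exists (n%:R, n%:R, n%:R).
- apply/seteqP; split => // -[[x1 x2] x3] _.
  have big (y : R) : exists n : nat, y < n%:R.
    have [y0|/ltW y0] := leP 0 y; last by exists 1%N; rewrite (le_lt_trans y0).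
    by exists (Num.Def.archi_bound y); exact: archi_boundP.
  have [k xk] := big x1; have [l xl] := big x2; have [m xm] := big x3.
  exists (maxn k (maxn l m)) => //; split => /=; [split|]; rewrite /= in_itv /=.
  + by rewrite (lt_le_trans xk)// ler_nat leq_maxl.
  + by rewrite (lt_le_trans xl)// ler_nat leq_max leq_maxl orbT.
  + by rewrite (lt_le_trans xm)// ler_nat leq_max leq_maxr orbT.
- move=> _ _ [[[a b] c] _ <-] [[[a' b'] c'] _ <-] /=.
  exists (Num.min a a', Num.min b b', Num.min c c') => //=.
  apply/seteqP; split => -[[x1 x2] x3]; rewrite /box /= !in_itv /= !lt_min.
    by move=> [[/andP[? ?] /andP[? ?]] /andP[? ?]]; do !split.
  by move=> [[[? ?] ?] [[? ?] ?]]; do !split; apply/andP.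
- by move=> _ [[[a b] c] _ <-]; exact: sigma_rot_box.
- move=> n; apply: (le_lt_trans _ (sigma_rot_lty al be)).
  by apply: le_measure; rewrite ?inE//; exact: mbox.
- exact: generated_by_boxes.
Qed.

End RotationInvariantMeasure.

(** * Distance to the pole and polar direction *)

Section MeasurableInverse.
Context {R : realType}.

Lemma measurable_invr : measurable_fun setT (fun x : R => x^-1).
Proof.
rewrite (_ : (fun x => _) = (fun x => if x == 0 then 0 else x^-1)); last first.
  by apply/funext => x; case: eqVneq => // ->; rewrite invr0.
apply: measurable_fun_if => //.
- by apply: measurable_fun_eqr.
- rewrite setTI (_ : _ @^-1` _ = [set x | x != 0]).
    apply: open_continuous_measurable_fun; first exact: open_neq.
    by move=> x /[!inE]/= x0; exact: inv_continuous.
  by apply/seteqP; split => x /=; case: (x == 0).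
Qed.

Lemma acos_nonincreasing (x y : R) : -1 <= x -> x <= y -> y <= 1 -> acos y <= acos x.
Proof.
move=> x1 xy y1.
have hx : -1 <= x <= 1 by rewrite x1 (le_trans xy).
have hy : -1 <= y <= 1 by rewrite y1 (le_trans x1).
rewrite leNgt -ltr_cos ?in_itv/= ?acos_ge0 ?acos_lepi//.
by rewrite !acosK ?in_itv// -leNgt.
Qed.

(** A monotone, hence measurable, extension of acos to the whole line. *)
Definition acos_clip (x : R) : R := acos (Num.max (-1) (Num.min x 1)).

Lemma acos_clipE x : -1 <= x <= 1 -> acos_clip x = acos x.
Proof. by move=> /andP[x1 x2]; rewrite /acos_clip (min_l x2) (max_r x1). Qed.

Lemma measurable_acos_clip : measurable_fun setT acos_clip.
Proof.
apply: nonincreasing_measurable => // x y xy; apply: acos_nonincreasing.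
- by rewrite le_max lexx.
- by rewrite ge_max le_max lexx/= le_max le_min !ge_min xy lexx !orbT.
- by rewrite ge_max ge_min lexx orbT andbT; lra.
Qed.

End MeasurableInverse.

Section SphereGeometry.
Context {R : realType}.
Implicit Types (p x : 'R3 R).
Local Notation mu := (@lebesgue_measure R).
Local Notation Th := (`]0, pi[%classic : set R).
Local Notation Ph := (`]0, (2 * pi)[%classic : set R).

Lemma dot_itv p x : S2 p -> S2 x -> -1 <= dot x p <= 1.
Proof.
case: p => [[p1 p2] p3]; case: x => [[x1 x2] x3]; rewrite /S2 /dot /= => hp hx.
have : 0 <= (x1 - p1) ^+ 2 + (x2 - p2) ^+ 2 + (x3 - p3) ^+ 2 by rewrite !addr_ge0 ?sqr_ge0.
have : 0 <= (x1 + p1) ^+ 2 + (x2 + p2) ^+ 2 + (x3 + p3) ^+ 2 by rewrite !addr_ge0 ?sqr_ge0.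
lra.
Qed.

Lemma dist_itv p x : S2 p -> S2 x -> 0 <= dist x p <= pi.
Proof.
by move=> hp hx; have h := dot_itv hp hx; rewrite /dist acos_ge0// acos_lepi.
Qed.

Lemma cos_dist p x : S2 p -> S2 x -> cos (dist x p) = dot x p.
Proof. by move=> hp hx; rewrite /dist acosK// in_itv/= dot_itv. Qed.

Lemma distN p x : S2 p -> S2 x -> dist x (- p) = pi - dist x p.
Proof.
move=> hp hx; rewrite /dist -acosN ?dot_itv//; congr acos.
by rewrite /dot /=; ring.
Qed.

Lemma S2N p : S2 p -> S2 (- p).
Proof. by rewrite /S2 /dot /= !mulrNN. Qed.

Lemma thetahatN p x : S2 p -> S2 x -> thetahat (- p) x = - thetahat p x.
Proof.
move=> hp hx; rewrite /thetahat distN//.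
have -> : sin (pi - dist x p) = sin (dist x p) by rewrite sinB sinpi cospi; ring.
have -> : cos (pi - dist x p) = - cos (dist x p) by rewrite cosB sinpi cospi; ring.
by rewrite -scalerN opprB scaleNr opprK addrC.
Qed.

(** The rotation-invariant description of sigma can be used about any pole, because
    every point of the sphere has spherical coordinates. *)
Lemma pole_coord p : S2 p -> exists al be, p = sph (al, be).
Proof.
case: p => [[p1 p2] p3]; rewrite /S2 /dot /sph /= => h.
have p31 : -1 <= p3 <= 1 by apply/andP; split; nra.
pose al := acos p3; have ca : cos al = p3 by rewrite acosK// in_itv.
have sa2 : sin al * sin al = p1 * p1 + p2 * p2.
  by have := cos_mul_cos al; rewrite ca; lra.
have [s0|s0] := eqVneq (sin al) 0.
  exists al, 0; rewrite s0 ca; congr (_, _, _); move: sa2; rewrite s0; nra.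
have q1 : (p1 / sin al) * (p1 / sin al) + (p2 / sin al) * (p2 / sin al) = 1.
  rewrite !mulf_div -mulrDl -sa2 divff// mulf_neq0//.
move: q1; set c := p1 / sin al; set s := p2 / sin al => q1.
have p1E : p1 = sin al * c by rewrite /c mulrC divfK.
have p2E : p2 = sin al * s by rewrite /s mulrC divfK.
have c1 : -1 <= c <= 1 by apply/andP; split; nra.
have cc : cos (acos c) = c by rewrite acosK// in_itv.
have ss : sin (acos c) * sin (acos c) = s * s by have := cos_mul_cos (acos c); rewrite cc; lra.
have : (s == sin (acos c)) || (s == - sin (acos c)).
  by rewrite -eqf_sqr !expr2 ss.
case/orP => /eqP sE.
- by exists al, (acos c); rewrite ca cc -sE -p1E -p2E.
- by exists al, (- acos c); rewrite ca cosN sinN cc -sE -p1E -p2E.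
Qed.

Lemma rot_S2 (al be th ph : R) : S2 (rot al be th ph).
Proof. exact: dot_rot. Qed.

Lemma sph_S2 (z : R * R) : S2 (sph z).
Proof. by case: z => th ph; rewrite -(rot0 0); exact: rot_S2. Qed.

Lemma dist_rot (al be th ph : R) : 0 <= th <= pi ->
  dist (rot al be th ph) (sph (al, be)) = th.
Proof. by move=> h; rewrite /dist dot_rot_pole cosK// in_itv. Qed.

Lemma thetahat_rot (al be th ph : R) : 0 < th < pi ->
  thetahat (sph (al, be)) (rot al be th ph) = rot_dth al be th ph.
Proof.
move=> h; have s0 := sin_gt0_pi h; move: h => /andP[/ltW t0 /ltW t1].
rewrite /thetahat dist_rot ?t0//.
have sc (a : R) (y : 'R3 R) : a *: y = (a * y.1.1, a * y.1.2, a * y.2) by [].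
have ad (y z : 'R3 R) : y - z = (y.1.1 - z.1.1, y.1.2 - z.1.2, y.2 - z.2) by [].
rewrite !sc !ad /rot /rot_dth /sph /=; have c2 := cos_mul_cos th.
have e (p_ t_ : R) : (sin th)^-1 * (cos th * (sin th * t_ + cos th * p_) - p_) =
    cos th * t_ - sin th * p_.
  apply: (mulfI (lt0r_neq0 s0)); rewrite mulrA divff ?gt_eqF// mul1r.
  transitivity (sin th * (cos th * t_) + (cos th * cos th) * p_ - p_); first by ring.
  by rewrite c2; ring.
congr (_, _, _).
- have := e (sin al * cos be) (cos (ph - be) * (cos al * cos be) - sin (ph - be) * sin be).
  by move=> h; transitivity ((sin th)^-1 * (cos th * (sin th * (cos (ph - be) * (cos al * cos be) - sin (ph - be) * sin be) + cos th * (sin al * cos be)) - sin al * cos be)); [congr (_ * _); ring|rewrite h; ring].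
- have := e (sin al * sin be) (cos (ph - be) * (cos al * sin be) + sin (ph - be) * cos be).
  by move=> h; transitivity ((sin th)^-1 * (cos th * (sin th * (cos (ph - be) * (cos al * sin be) + sin (ph - be) * cos be) + cos th * (sin al * sin be)) - sin al * sin be)); [congr (_ * _); ring|rewrite h; ring].
- have := e (cos al) (- (cos (ph - be) * sin al)).
  by move=> h; transitivity ((sin th)^-1 * (cos th * (sin th * (- (cos (ph - be) * sin al)) + cos th * cos al) - cos al)); [congr (_ * _); ring|rewrite h; ring].
Qed.

Lemma dot_thetahat_x p x : S2 p -> S2 x -> dot (thetahat p x) x = 0.
Proof.
move=> hp hx; have c := cos_dist hp hx; move: hx.
case: p c hp => [[p1 p2] p3]; case: x => [[x1 x2] x3] c hp.
rewrite /thetahat c /S2 /dot /= /GRing.scale/= => hx.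
move: (_^-1) => k.
rewrite (_ : _ + _ = k * ((x1 * p1 + x2 * p2 + x3 * p3) * (x1 * x1 + x2 * x2 + x3 * x3 - 1)));
  last by ring.
by rewrite hx subrr !mulr0.
Qed.

Lemma dot_thetahat_le p x : S2 p -> S2 x -> dot (thetahat p x) (thetahat p x) <= 1.
Proof.
move=> hp hx; have c := cos_dist hp hx.
have c2 := cos_mul_cos (dist x p); move: hx hp c; case: p c2 => [[p1 p2] p3]; case: x => [[x1 x2] x3].
set d := dist _ _ => c2 hx hp c; rewrite /thetahat -/d.
have -> : dot ((sin d)^-1 *: (cos d *: (x1, x2, x3) - (p1, p2, p3)))
     ((sin d)^-1 *: (cos d *: (x1, x2, x3) - (p1, p2, p3))) =
   (sin d)^-1 * (sin d)^-1 * (cos d * cos d * dot (x1, x2, x3) (x1, x2, x3)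
    - 2 * cos d * dot (x1, x2, x3) (p1, p2, p3) + dot (p1, p2, p3) (p1, p2, p3)).
  by rewrite /dot /= /GRing.scale/=; ring.
rewrite hx hp -c -mulrA c2.
have -> : (1 - sin d * sin d) * 1 - 2 * cos d * cos d + 1 = sin d * sin d.
  by rewrite -mulrA c2; ring.
have [->|s0] := eqVneq (sin d) 0; first by rewrite !mulr0.
by rewrite mulKf// mulVf.
Qed.

Lemma cauchy_schwarz3 (v w : 'R3 R) : dot v w ^+ 2 <= dot v v * dot w w.
Proof.
case: v => [[v1 v2] v3]; case: w => [[w1 w2] w3]; rewrite /dot /= -subr_ge0.
rewrite (_ : _ - _ = (v1 * w2 - v2 * w1) ^+ 2 + (v1 * w3 - v3 * w1) ^+ 2 + (v2 * w3 - v3 * w2) ^+ 2).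
  by rewrite !addr_ge0 ?sqr_ge0.
by ring.
Qed.

Lemma dotvv_ge0 (v : 'R3 R) : 0 <= dot v v.
Proof. by rewrite /dot !addr_ge0// -expr2 sqr_ge0. Qed.

Lemma thetahat_bound p x (v : 'R3 R) : S2 p -> S2 x ->
  dot (thetahat p x) v ^+ 2 <= dot v v.
Proof.
move=> hp hx; apply: le_trans (cauchy_schwarz3 _ _) _.
by rewrite ler_piMl ?dotvv_ge0// dot_thetahat_le.
Qed.

(** The polar direction is tangent to the sphere, so it does not see the normal part
    that distinguishes the Euclidean gradient from the spherical one. *)
Lemma thetahat_sgrad p x (u : 'R3 R -> R) : S2 p -> S2 x ->
  dot (thetahat p x) (sgrad u x) = dot (egrad u x) (thetahat p x).
Proof.
move=> hp hx; have := dot_thetahat_x hp hx.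
rewrite /sgrad; move: (egrad u x) (thetahat p x) => [[g1 g2] g3] [[t1 t2] t3].
case: x {hx} => [[x1 x2] x3]; rewrite /dot /= => h.
set k := g1 * x1 + g2 * x2 + g3 * x3.
rewrite (_ : _ + _ = g1 * t1 + g2 * t2 + g3 * t3 - k * (t1 * x1 + t2 * x2 + t3 * x3)).
  by rewrite h mulr0 subr0.
by rewrite /GRing.scale/= /k; ring.
Qed.

Lemma measurable_dot p : measurable_fun setT (fun x => dot x p).
Proof.
rewrite /dot; apply: measurable_funD; first apply: measurable_funD.
all: apply: measurable_funM => //.
- exact: (measurableT_comp (@measurable_fst _ _ _ _) (@measurable_fst _ _ _ _)).
- exact: (measurableT_comp (@measurable_snd _ _ _ _) (@measurable_fst _ _ _ _)).
Qed.

Lemma measurable_S2 : measurable (S2 : set ('R3 R)).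
Proof.
have md : measurable_fun setT (fun x : 'R3 R => dot x x).
  apply: continuous_measurable_R3; apply: (@Cdiff_continuous _ 0).
  by rewrite /dot; cdiff.
have -> : S2 = setT `&` (fun x : 'R3 R => dot x x) @^-1` [set 1].
  by rewrite setTI; apply/seteqP; split.
exact: md.
Qed.

Lemma measurable_dist p : S2 p -> measurable_fun S2 (fun x => dist x p).
Proof.
move=> hp; apply: (@eq_measurable_fun _ _ _ _ _ (fun x => acos_clip (dot x p))).
  by move=> x /[!inE] hx; rewrite acos_clipE// dot_itv.
apply: measurable_funTS; apply: measurableT_comp; first exact: measurable_acos_clip.
exact: measurable_dot.
Qed.

(** Fubini on the sphere in coordinates about the pole sph (al, be): the inner
    integral runs over a meridian. *)
Lemma integral_sphere al be (g : 'R3 R -> \bar R) : measurable_fun S2 g ->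
  (forall x, S2 x -> 0 <= g x)%E ->
  (\int[sigma]_(x in S2) g x =
   \int[mu]_(y in Ph) \int[mu]_(x in Th) (g (rot al be x y) * (sin x)%:E))%E.
Proof.
move=> mg g0; rewrite integral_mkcond.
have mG : measurable_fun setT (g \_ S2).
  by apply/(measurable_restrictT _ measurable_S2).
have G0 x : (0 <= (g \_ S2) x)%E.
  by rewrite patchE; case: ifPn => // /[!inE]; exact: g0.
have mX := measurable_rot al be.
have sE A : measurable A -> sigma A = (\int[mu \x mu]_(z in (fun z => rot al be z.1 z.2) @^-1` A)
    (sph_density z)%:E)%E.
  by move=> mA; rewrite -(sigma_rotE al be mA).
transitivity (\int[mu \x mu]_z ((g \_ S2) (rot al be z.1 z.2) * (sph_density z)%:E))%E.
  apply: (@ge0_integral_density _ _ _ _ R (mu \x mu)%E sigma (fun z => rot al be z.1 z.2)) => //.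
  - exact: measurable_sph_density.
  - exact: sph_density_ge0.
rewrite (@density_iterated _ (fun z => (g \_ S2) (rot al be z.1 z.2))).
- apply: eq_integral => y _; apply: eq_integral => x _; rewrite patchE mem_set//.
  exact: rot_S2.
- exact: measurableT_comp.
- by move=> z; exact: G0.
Qed.

End SphereGeometry.

(** * Hardy inequalities under L2 limits *)

Section Truncation.
Context d (T : measurableType d) {R : realType} (mu : {measure set T -> \bar R}).
Variables (D : set T) (mD : measurable D).
Local Open Scope ereal_scope.

Lemma wnorm2_ge0 (W f : T -> R) : (forall x, D x -> (0 <= W x)%R) -> 0 <= wnorm2 mu D W f.
Proof.
by move=> W0; apply: integral_ge0 => x Dx; rewrite lee_fin mulr_ge0 ?W0 ?sqr_ge0.
Qed.

Lemma measurable_weight (W f : T -> R) : measurable_fun D W -> measurable_fun D f ->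
  measurable_fun D (fun x => (W x * f x ^+ 2)%:E).
Proof.
move=> mW mf; apply/measurable_EFinP; apply: measurable_funM => //.
exact: measurable_funX.
Qed.

Lemma le_wnorm2 (W V f : T -> R) :
  measurable_fun D W -> measurable_fun D V -> measurable_fun D f ->
  (forall x, D x -> (0 <= W x <= V x)%R) -> wnorm2 mu D W f <= wnorm2 mu D V f.
Proof.
move=> mW mV mf WV; apply: ge0_le_integral => //.
- by move=> x Dx; have /andP[W0 _] := WV x Dx; rewrite lee_fin mulr_ge0 ?sqr_ge0.
- exact: measurable_weight.
- exact: measurable_weight.
- by move=> x Dx; have /andP[_ h] := WV x Dx; rewrite lee_fin ler_wpM2r ?sqr_ge0.
Qed.

Lemma wnorm2D (W V f : T -> R) :
  measurable_fun D W -> measurable_fun D V -> measurable_fun D f ->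
  (forall x, D x -> (0 <= W x)%R) -> (forall x, D x -> (0 <= V x)%R) ->
  wnorm2 mu D (fun x => W x + V x)%R f = wnorm2 mu D W f + wnorm2 mu D V f.
Proof.
move=> mW mV mf W0 V0; rewrite /wnorm2 -ge0_integralD//.
- by apply: eq_integral => x _; rewrite mulrDl EFinD.
- by move=> x Dx; rewrite lee_fin mulr_ge0 ?W0 ?sqr_ge0.
- exact: measurable_weight.
- by move=> x Dx; rewrite lee_fin mulr_ge0 ?V0 ?sqr_ge0.
- exact: measurable_weight.
Qed.

Lemma wnorm2_cst (k : R) (f : T -> R) : (0 <= k)%R -> measurable_fun D f ->
  wnorm2 mu D (cst k) f = k%:E * wnorm2 mu D (cst 1%R) f.
Proof.
move=> k0 mf; rewrite /wnorm2 -ge0_integralZl_EFin//.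
- by apply: eq_integral => x _ /=; rewrite mul1r EFinM.
- by move=> x _; rewrite lee_fin /= mul1r sqr_ge0.
- exact: measurable_weight.
Qed.

(** Weights that increase to W and stabilize at every point: monotone
    convergence. *)
Lemma wnorm2_limit (W : T -> R) (V : nat -> T -> R) (f : T -> R) (B : \bar R) :
  measurable_fun D f -> (forall k, measurable_fun D (V k)) ->
  (forall k x, D x -> (0 <= V k x <= W x)%R) ->
  (forall x, D x -> {homo V^~ x : i j / (i <= j)%N >-> (i <= j)%R}) ->
  (forall x, D x -> exists k, V k x = W x) ->
  (forall k, wnorm2 mu D (V k) f <= B) -> wnorm2 mu D W f <= B.
Proof.
move=> mf mV VW ndV stat VB.
have cv x : D x -> (V k x * f x ^+ 2)%:E @[k --> \oo] --> (W x * f x ^+ 2)%:E.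
  move=> Dx; have [k Vk] := stat x Dx; apply: cvg_near_cst.
  exists k => // j /= kj; congr ((_ * _)%:E); apply/eqP; rewrite eq_le.
  have /andP[_ ->] := VW j x Dx; rewrite -Vk.
  exact: ndV.
rewrite /wnorm2 (eq_integral (fun x => limn (fun k => (V k x * f x ^+ 2)%:E))); last first.
  by move=> x /[!inE] Dx; apply/esym/cvg_lim => //; exact: cv.
have nd x : D x -> nondecreasing_seq (fun k => (V k x * f x ^+ 2)%:E).
  by move=> Dx i j ij; rewrite lee_fin ler_wpM2r ?sqr_ge0// ndV.
rewrite monotone_convergence//.
- apply: lime_le.
    apply: ereal_nondecreasing_is_cvgn => i j ij; apply: ge0_le_integral => //.
    + by move=> x Dx; have /andP[h _] := VW i x Dx; rewrite lee_fin mulr_ge0 ?sqr_ge0.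
    + exact: measurable_weight.
    + exact: measurable_weight.
    + by move=> x Dx; exact: nd.
  by apply: nearW.
- by move=> k; exact: measurable_weight.
- by move=> k x Dx; have /andP[h _] := VW k x Dx; rewrite lee_fin mulr_ge0 ?sqr_ge0.
Qed.

(** Unlike in [hardy_closed], convergence is not assumed with respect to the weight W1
    itself: truncating W1 at height k makes it a bounded weight, for which L2
    convergence suffices, and k then tends to infinity. *)
Lemma hardy_closed_L2 (W1 W2 f F : T -> R) (u v : (T -> R)^nat) :
  measurable_fun D W1 -> measurable_fun D W2 ->
  measurable_fun D f -> measurable_fun D F ->
  (forall n, measurable_fun D (u n)) -> (forall n, measurable_fun D (v n)) ->
  (forall x, D x -> (0 <= W1 x)%R) -> (forall x, D x -> (0 <= W2 x)%R) ->
  (forall n, wnorm2 mu D W1 (u n) <= wnorm2 mu D (cst 1%R) (v n) + wnorm2 mu D W2 (u n)) ->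
  wnorm2 mu D (cst 1%R) (fun x => u n x - f x)%R @[n --> \oo] --> 0 ->
  wnorm2 mu D W2 (fun x => u n x - f x)%R @[n --> \oo] --> 0 ->
  wnorm2 mu D (cst 1%R) (fun x => v n x - F x)%R @[n --> \oo] --> 0 ->
  wnorm2 mu D W1 f <= wnorm2 mu D (cst 1%R) F + wnorm2 mu D W2 f.
Proof.
move=> mW1 mW2 mf mF mu_ mv W10 W20 H c1 c2 c3.
pose V (k : nat) x := Num.min (W1 x) k%:R.
have mV k : measurable_fun D (V k) by exact: measurable_minr.
have V0 k x : D x -> (0 <= V k x)%R by move=> Dx; rewrite le_min W10//=.
apply: (@wnorm2_limit W1 V) => //.
- by move=> k x Dx; rewrite V0//= ge_min lexx.
- move=> x Dx i j ij; rewrite le_min !ge_min lexx/=.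
  by rewrite ler_nat ij orbT.
- move=> x Dx; exists (Num.Def.archi_bound (W1 x)).
  by rewrite /V min_l// ltW// archi_boundP// W10.
move=> k; apply: (@hardy_closed _ _ _ _ _ mD (V k) W2 f F u v) => //.
- exact: V0.
- move=> n; apply: le_trans (H n); apply: le_wnorm2 => // x Dx.
  by rewrite V0//= ge_min lexx.
- apply: (@squeeze_cvge _ _ _ _ (cst 0) _ (fun n => k%:R%:E * wnorm2 mu D (cst 1%R) (fun x => u n x - f x)%R)).
  + apply: nearW => n; rewrite wnorm2_ge0 ?V0//=; last exact: V0.
    have muf : measurable_fun D (fun x => u n x - f x)%R by exact: measurable_funB.
    rewrite -wnorm2_cst//; apply: le_wnorm2 => // x Dx.
    by rewrite V0//= /V /= ge_min lexx orbT.
  + exact: cvg_cst.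
  + by rewrite -(mule0 k%:R%:E); exact: cvgeZl.
Qed.

End Truncation.

(** * Hardy inequalities for functions of class C1 *)

Section HardyC1.
Context {R : realType}.
Local Notation mu := (@lebesgue_measure R).
Local Notation Th := (`]0, pi[%classic : set R).
Local Notation Ph := (`]0, (2 * pi)[%classic : set R).
Local Notation N := (wnorm2 sigma S2).
Implicit Types (W : 'R3 R -> R) (w : R -> R) (u : 'R3 R -> R).

(** The derivative of a function with gradient G in the direction of increasing
    distance to p. *)
Definition radial_der (p : 'R3 R) (G : 'R3 R -> 'R3 R) (x : 'R3 R) : R :=
  dot (thetahat p x) (G x).

Lemma measurable_thetahat_dot p (G : 'R3 R -> 'R3 R) : S2 p ->
  measurable_fun S2 G -> measurable_fun S2 (radial_der p G).
Proof.
move=> hp mG; have md := measurable_dist hp.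
have ms : measurable_fun S2 (fun x => sin (dist x p)).
  by apply: measurableT_comp md; apply: continuous_measurable_fun; exact: continuous_sin.
have mc : measurable_fun S2 (fun x => cos (dist x p)).
  by apply: measurableT_comp md; apply: continuous_measurable_fun; exact: continuous_cos.
have mi : measurable_fun S2 (fun x => (sin (dist x p))^-1).
  exact: (measurableT_comp measurable_invr ms).
have f1 : measurable_fun setT (fun x : 'R3 R => x.1.1).
  exact: (measurableT_comp (@measurable_fst _ _ _ _) (@measurable_fst _ _ _ _)).
have f2 : measurable_fun setT (fun x : 'R3 R => x.1.2).
  exact: (measurableT_comp (@measurable_snd _ _ _ _) (@measurable_fst _ _ _ _)).
have f3 : measurable_fun setT (fun x : 'R3 R => x.2) by exact: measurable_snd.
have g1 := measurableT_comp f1 mG; have g2 := measurableT_comp f2 mG.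
have g3 := measurableT_comp f3 mG.
rewrite /radial_der /dot /thetahat /= /GRing.scale /= /GRing.scale /=.
by apply: measurable_funD; first apply: measurable_funD;
  apply: measurable_funM => //; apply: measurable_funM => //;
  apply: measurable_funB => //; apply: measurable_funM => //; exact: measurable_funTS.
Qed.

Lemma measurable_sgrad u : C1 u -> measurable_fun setT (sgrad u).
Proof.
move=> cu; have mD v : measurable_fun setT (fun x => 'D_v u x).
  by apply: continuous_measurable_R3; exact: cu.2.
have f1 : measurable_fun setT (fun x : 'R3 R => x.1.1).
  exact: (measurableT_comp (@measurable_fst _ _ _ _) (@measurable_fst _ _ _ _)).
have f2 : measurable_fun setT (fun x : 'R3 R => x.1.2).
  exact: (measurableT_comp (@measurable_snd _ _ _ _) (@measurable_fst _ _ _ _)).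
have f3 : measurable_fun setT (fun x : 'R3 R => x.2) by exact: measurable_snd.
have mdot : measurable_fun setT (fun x => dot (egrad u x) x).
  by rewrite /dot /egrad /=; apply: measurable_funD; first apply: measurable_funD; exact: measurable_funM.
rewrite (_ : sgrad u = fun x => ('D_(1, 0, 0) u x - dot (egrad u x) x * x.1.1,
  'D_(0, 1, 0) u x - dot (egrad u x) x * x.1.2, 'D_(0, 0, 1) u x - dot (egrad u x) x * x.2))//.
by apply: measurable_fun_pair; first apply: measurable_fun_pair;
  apply: measurable_funB => //; exact: measurable_funM.
Qed.

Lemma measurable_meridian_integral al be (g : 'R3 R -> \bar R) :
  measurable_fun S2 g -> (forall x, S2 x -> 0 <= g x)%E ->
  measurable_fun Ph (fun y => \int[mu]_(x in Th) (g (rot al be x y) * (sin x)%:E))%E.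
Proof.
move=> mg g0.
have mG : measurable_fun setT (g \_ S2) by apply/(measurable_restrictT _ measurable_S2).
have G0 x : (0 <= (g \_ S2) x)%E by rewrite patchE; case: ifPn => // /[!inE]; exact: g0.
pose F (z : R * R) := ((g \_ S2) (rot al be z.1 z.2) * (`|sin z.1| * \1_Th z.1)%:E)%E.
have mF : measurable_fun setT F.
  apply: emeasurable_funM; first exact: (measurableT_comp mG (measurable_rot al be)).
  apply/measurable_EFinP; apply: measurable_funM.
    apply: measurableT_comp => //; apply: measurableT_comp => //.
    by apply: continuous_measurable_fun; exact: continuous_sin.
  by apply: measurableT_comp => //; exact: measurable_indic.
have F0 z : (0 <= F z)%E by rewrite mule_ge0// lee_fin mulr_ge0.
apply: (@eq_measurable_fun _ _ _ _ _ (fubini_G mu F)); last first.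
  by apply: measurable_funTS; exact: measurable_fun_fubini_tonelli_G.
move=> y _; rewrite /fubini_G [RHS]integral_mkcond; apply: eq_integral => x _.
rewrite /F /= [RHS]patchE indicE; case: ifPn => xT; last by rewrite mulr0 mule0.
rewrite patchE mem_set ?mulr1; last exact: rot_S2.
by rewrite ger0_norm//; move: xT; rewrite inE /= in_itv/= => /sin_gt0_pi/ltW.
Qed.

Lemma le_integral_sphere al be (g h : 'R3 R -> \bar R) :
  measurable_fun S2 g -> measurable_fun S2 h ->
  (forall x, S2 x -> 0 <= g x)%E -> (forall x, S2 x -> 0 <= h x)%E ->
  (forall y, (\int[mu]_(x in Th) (g (rot al be x y) * (sin x)%:E) <=
              \int[mu]_(x in Th) (h (rot al be x y) * (sin x)%:E))%E) ->
  (\int[sigma]_(x in S2) g x <= \int[sigma]_(x in S2) h x)%E.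
Proof.
move=> mg mh g0 h0 gh; rewrite !(integral_sphere al be)//.
apply: ge0_le_integral => //.
- move=> y _; apply: integral_ge0 => x /= xT; rewrite mule_ge0 ?g0//; first exact: rot_S2.
  by rewrite lee_fin ltW// sin_gt0_pi//; move: xT; rewrite in_itv.
- exact: measurable_meridian_integral.
- exact: measurable_meridian_integral.
Qed.

Lemma measurable_radial p w : S2 p -> measurable_fun setT w ->
  measurable_fun S2 (fun x => w (dist x p)).
Proof. by move=> hp mw; exact: (measurableT_comp mw (measurable_dist hp)). Qed.

(** Along each meridian of the pole p this is [hardy_1D]. The number a is a cut-off:
    the multiplier may be singular at distance 0 when the weight w1 vanishes up to
    distance a. *)
Lemma sphere_hardy_C1 (p : 'R3 R) u w1 w2 (m dm : R -> R) (a : R) : S2 p -> C1 u ->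
  0 <= a -> a < pi -> measurable_fun setT w1 -> measurable_fun setT w2 ->
  (forall t, 0 <= t <= pi -> 0 <= w1 t) -> (forall t, 0 <= t <= pi -> 0 <= w2 t) ->
  (forall t, t <= a -> 0 < t -> w1 t = 0) ->
  (forall t, a <= t <= pi -> is_derive t 1 m (dm t)) ->
  (forall t, a <= t <= pi -> {for t, continuous dm}) ->
  (forall t, a < t < pi -> dm t + m t ^+ 2 / sin t <= (w2 t - w1 t) * sin t) ->
  m a <= 0 -> 0 <= m pi ->
  (N (fun x => w1 (dist x p)) u <=
   N (cst 1%R) (radial_der p (sgrad u)) + N (fun x => w2 (dist x p)) u)%E.
Proof.
move=> hp cu a0 api mw1 mw2 w10 w20 w1a dm_ cdm ric ma mpi.
have [al [be pE]] := pole_coord hp.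
have mW1 := measurable_radial hp mw1; have mW2 := measurable_radial hp mw2.
have mu_ : measurable_fun S2 u.
  by apply: measurable_funTS; apply: continuous_measurable_R3; exact: C1_continuous.
have mDu : measurable_fun S2 (radial_der p (sgrad u)).
  by apply: measurable_thetahat_dot => //; apply: measurable_funTS; exact: measurable_sgrad.
have W10 x : S2 x -> 0 <= w1 (dist x p) by move=> hx; rewrite w10// dist_itv.
have W20 x : S2 x -> 0 <= w2 (dist x p) by move=> hx; rewrite w20// dist_itv.
have dp := cu.1.
have m1 : measurable_fun S2 (fun x => (w1 (dist x p) * u x ^+ 2)%:E) by exact: measurable_weight.
have m2 : measurable_fun S2 (fun x => (w2 (dist x p) * u x ^+ 2)%:E) by exact: measurable_weight.
have m3 : measurable_fun S2 (fun x => (cst 1 x * radial_der p (sgrad u) x ^+ 2)%:E).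
  exact: measurable_weight.
rewrite /wnorm2 -ge0_integralD//; last 3 first.
- exact: measurable_S2.
- by move=> x _; rewrite lee_fin mul1r sqr_ge0.
- by move=> x Sx; rewrite lee_fin mulr_ge0 ?sqr_ge0 ?W20.
apply: (le_integral_sphere (al := al) (be := be)) => //.
- exact: emeasurable_funD.
- by move=> x Sx; rewrite lee_fin mulr_ge0 ?sqr_ge0 ?W10.
- by move=> x Sx; rewrite adde_ge0// lee_fin mulr_ge0 ?sqr_ge0 ?W20//= ler01.
move=> y; pose U t := u (rot al be t y).
pose dU t := dot (egrad u (rot al be t y)) (rot_dth al be t y).
have sub : `]a, pi[ `<=` Th.
  by move=> x /=; rewrite !in_itv/= => /andP[ax ->]; rewrite (le_lt_trans a0 ax).
have mU : measurable_fun setT U.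
  apply: continuous_measurable_fun => t.
  exact: is_derive_continuous (is_derive_rot_th dp al be y t).
have mdU : measurable_fun setT dU.
  by apply: continuous_measurable_fun; exact: continuous_rot_dth.
have ms : measurable_fun setT (@sin R).
  by apply: continuous_measurable_fun; exact: continuous_sin.
have inT x : Th x -> 0 <= x <= pi.
  by rewrite /= in_itv/= => /andP[/ltW -> /ltW ->].
have sT x : Th x -> 0 <= sin x by move=> /inT; exact: sin_ge0_pi.
have mA : measurable_fun setT (fun t => (dU t ^+ 2 * sin t)%:E).
  by apply/measurable_EFinP; apply: measurable_funM => //; exact: measurable_funX.
have mB : measurable_fun setT (fun t => (w2 t * U t ^+ 2 * sin t)%:E).
  apply/measurable_EFinP; apply: measurable_funM => //.
  by apply: measurable_funM => //; exact: measurable_funX.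
have mC : measurable_fun setT (fun t => (w1 t * U t ^+ 2 * sin t)%:E).
  apply/measurable_EFinP; apply: measurable_funM => //.
  by apply: measurable_funM => //; exact: measurable_funX.
rewrite (_ : (\int[_]_(x in _) _)%E = \int[mu]_(x in `]a, pi[) (w1 x * U x ^+ 2 * sin x)%:E)%E; last first.
  rewrite [LHS]integral_mkcond [RHS]integral_mkcond; apply: eq_integral => x _.
  rewrite !patchE; case: ifPn => xT; last first.
    case: ifPn => // /set_mem/sub xa; by rewrite mem_set in xT.
  have {}xT := set_mem xT; rewrite pE dist_rot ?inT//.
  case: ifPn => xa; first by rewrite -EFinM.
  rewrite w1a ?mul0r ?mul0e//; last by move: xT; rewrite /= in_itv/= => /andP[].
  rewrite leNgt; apply/negP => ax; move/negP: xa; apply; rewrite inE /= in_itv/= ax.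
  by move: xT; rewrite /= in_itv/= => /andP[].
have cdU : continuous dU by exact: continuous_rot_dth.
have H := @hardy_1D R m dm w1 w2 U dU a pi a0 api (lexx _) dm_ cdm
  (is_derive_rot_th dp al be y) cdU mw1 mw2.
apply: le_trans (H _ _ ric ma mpi) _.
- by move=> x /andP[ax xp]; rewrite w10// (le_trans a0 (ltW ax)) (ltW xp).
- by move=> x /andP[ax xp]; rewrite w20// (le_trans a0 (ltW ax)) (ltW xp).
apply: (@le_trans _ _ (\int[mu]_(x in Th) (dU x ^+ 2 * sin x)%:E +
                       \int[mu]_(x in Th) (w2 x * U x ^+ 2 * sin x)%:E)%E).
  apply: leeD; apply: ge0_subset_integral => //.
  - exact: measurable_funTS.
  - by move=> x /sT sx; rewrite lee_fin mulr_ge0 ?sqr_ge0.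
  - exact: measurable_funTS.
  - by move=> x xT; rewrite lee_fin mulr_ge0 ?sT// mulr_ge0 ?sqr_ge0 ?w20 ?inT.
rewrite -ge0_integralD//; last 4 first.
- by move=> x /sT sx; rewrite lee_fin mulr_ge0 ?sqr_ge0.
- exact: measurable_funTS.
- by move=> x xT; rewrite lee_fin mulr_ge0 ?sT// mulr_ge0 ?sqr_ge0 ?w20 ?inT.
- exact: measurable_funTS.
rewrite le_eqVlt; apply/orP; left; apply/eqP; apply: eq_integral => x /set_mem xT.
have hx := rot_S2 al be x y; rewrite /radial_der thetahat_sgrad// pE dist_rot ?inT//.
rewrite thetahat_rot; last by move: xT; rewrite /= in_itv.
by rewrite -!EFinD -EFinM; congr (_%:E); rewrite /= mul1r mulrDl.
Qed.

End HardyC1.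

(** * The logarithmic Hardy inequality in H1 *)

Section HardyH1.
Context {R : realType}.
Local Notation N := (wnorm2 (@sigma R) S2).
Implicit Types (p : 'R3 R) (u : 'R3 R -> R).

Definition hardy_weight (t : R) : R := 1 / 4 / rho_phi t ^+ 2.

Lemma hardy_weight_ge0 t : 0 <= hardy_weight t.
Proof. by rewrite /hardy_weight mulr_ge0 ?invr_ge0 ?sqr_ge0//; lra. Qed.

Lemma loss_ge0_cc (t : R) : 0 <= t <= pi -> 0 <= loss t.
Proof.
move=> /andP[]; rewrite le_eqVlt => /orP[/eqP <-|t0].
  by rewrite /loss /phi invr0 mulr0 ln0// mulr0 invr0 mulr0.
rewrite le_eqVlt => /orP[/eqP ->|tp]; last by rewrite loss_ge0// t0.
by rewrite /loss subrr mulr0 mul0r invr0 mulr0.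
Qed.

Lemma loss_lt_cc (t : R) : 0 <= t <= pi -> loss t < loss_bound t.
Proof.
move=> /andP[t0 tp]; have p0 := @pi_gt0 R.
have b0 : 0 < loss_bound t.
  rewrite /loss_bound ltr_pwDl// ?divr_gt0 ?mulr_gt0 ?exprn_gt0//.
  by rewrite divr_ge0 ?subr_ge0// divr_ge0// ltW// mulr_gt0.
move: t0; rewrite le_eqVlt => /orP[/eqP t0|t0].
  by apply: le_lt_trans b0; rewrite -t0 /loss /phi invr0 mulr0 ln0// mulr0 invr0 mulr0.
move: tp; rewrite le_eqVlt => /orP[/eqP t1|t1]; last by rewrite loss_lt// t0.
by apply: le_lt_trans b0; rewrite t1 /loss subrr mulr0 mul0r invr0 mulr0.
Qed.

Lemma loss_bound_le (t : R) : t <= pi -> loss_bound t <= 1 + (pi - t)^-1.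
Proof.
move=> tp; have p3 : 3 < (pi : R) by have := @pi_bounds R; lra.
have p0 : 0 < (pi : R) by lra.
have i0 : 0 <= (pi - t)^-1 by rewrite invr_ge0 subr_ge0.
rewrite /loss_bound lerD//.
  rewrite ler_pdivrMr ?mulr_gt0 ?exprn_gt0//; nra.
by rewrite ler_piMl// ler_pdivrMr ?mulr_gt0//; lra.
Qed.

Lemma measurable_phi : measurable_fun setT (@phi R).
Proof.
apply: (measurableT_comp (@measurable_ln R)).
by apply: measurable_funM => //; exact: measurable_invr.
Qed.

Lemma measurable_hardy_weight : measurable_fun setT hardy_weight.
Proof.
apply: measurable_funM => //; apply: (measurableT_comp measurable_invr).
by apply: measurable_funX; apply: measurable_funM => //; exact: measurable_phi.
Qed.

Lemma measurable_loss : measurable_fun setT (@loss R).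
Proof.
apply: measurable_funM.
  by apply: measurable_funX; exact: measurable_funB.
apply: (measurableT_comp measurable_invr); apply: measurable_funM; last exact: measurable_phi.
by apply: measurable_funM => //; exact: measurable_funB.
Qed.

Lemma measurable_pole : measurable_fun setT (fun t : R => (pi - t)^-1).
Proof. by apply: (measurableT_comp measurable_invr); exact: measurable_funB. Qed.

Lemma pole_hardy_C1 p u : S2 p -> C1 u ->
  (N (fun x => (pi - dist x p)^-1)%R u <=
   N (cst 1%R) (radial_der p (sgrad u)) + N (cst 7%R) u)%E.
Proof.
move=> hp cu.
apply: (@sphere_hardy_C1 R p u (fun t => (pi - t)^-1) (cst 7) pole_m pole_dm 0) => //.
- exact: pi_gt0.
- exact: measurable_pole.
- by move=> t /andP[_ tp]; rewrite invr_ge0 subr_ge0.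
- by move=> t t0 /(le_lt_trans t0); rewrite ltxx.
- by move=> t _; exact: is_derive_pole_m.
- by move=> t _; exact: continuous_pole_dm.
- by move=> t; exact: pole_riccati.
- by rewrite /pole_m sin0 mulr0.
- by rewrite /pole_m sinpi mulr0.
Qed.

(** The multiplier [hardy_m] is singular at 0, so the weight is first cut off at
    distance 1/(k+1). *)
Lemma log_hardy_C1 p u : S2 p -> C1 u ->
  (N (fun x => hardy_weight (dist x p)) u <=
   N (cst 1%R) (radial_der p (sgrad u)) + N (fun x => loss (dist x p)) u)%E.
Proof.
move=> hp cu; have p3 : 3 < (pi : R) by have := @pi_bounds R; lra.
pose w (k : nat) t := hardy_weight t * \1_`](k.+1%:R^-1), +oo[%classic t.
have mw k : measurable_fun setT (w k).
  apply: measurable_funM; first exact: measurable_hardy_weight.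
  exact: measurable_indic.
have w0 k t : 0 <= w k t by rewrite mulr_ge0 ?hardy_weight_ge0.
have wE k t : w k t = if k.+1%:R^-1 < t then hardy_weight t else 0.
  rewrite /w indicE; case: ifPn => kt.
    by rewrite mem_set ?mulr1//= in_itv/= kt.
  by rewrite memNset ?mulr0//= in_itv/= andbT; exact/negP.
(* At distance 0 the weight itself is 0, by the convention 1 / 0 = 0. *)
apply: (@wnorm2_limit _ _ _ _ _ (measurable_S2) _ (fun k x => w k (dist x p))).
- by apply: measurable_funTS; apply: continuous_measurable_R3; exact: C1_continuous.
- by move=> k; exact: measurable_radial.
- by move=> k x _; rewrite w0 wE; case: ifP => _; rewrite ?lexx ?hardy_weight_ge0.
- move=> x _ i j ij; rewrite !wE; case: ifPn => it; last by case: ifP => // _; exact: hardy_weight_ge0.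
  by rewrite (le_lt_trans _ it)// lef_pV2 ?posrE// ler_nat.
- move=> x hx; have /andP[] := dist_itv hp hx; rewrite le_eqVlt => /orP[/eqP d0 _|d0 _].
    exists 0%N; rewrite wE -d0; case: ifP => // _.
    by rewrite /hardy_weight /rho_phi mul0r expr0n/= invr0 mulr0.
  exists (Num.Def.archi_bound (dist x p)^-1); rewrite wE.
  rewrite invf_plt ?posrE// (lt_trans (archi_boundP _)) ?invr_ge0 ?(ltW d0)//.
  by rewrite ltr_nat.
move=> k; set e := k.+1%:R^-1 : R.
have e0 : 0 < e by rewrite invr_gt0.
have e1 : e < pi.
  have e1 : e <= 1 by rewrite invf_le1 ?ler1n.
  lra.
apply: (@sphere_hardy_C1 R p u (w k) (@loss R) hardy_m hardy_dm e hp cu (ltW e0) e1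
  (mw k) measurable_loss (fun t _ => w0 k t) loss_ge0_cc).
- by move=> t te t0; rewrite wE ltNge te.
- by move=> t /andP[et tp]; apply: is_derive_hardy_m; rewrite (lt_le_trans e0).
- by move=> t /andP[et tp]; apply: continuous_hardy_dm; rewrite (lt_le_trans e0).
- move=> t /andP[et tp]; rewrite wE et; apply: hardy_riccati.
  by rewrite (lt_trans e0).
- rewrite /hardy_m oppr_le0 divr_ge0 ?sin_ge0_pi ?(ltW e0) ?(ltW e1)// mulr_ge0//.
  by rewrite (le_trans (ltW e0))// rho_phi_ge// e0 ltW.
- by rewrite /hardy_m sinpi mul0r oppr0.
Qed.

Lemma egradB u v x : C1 u -> C1 v -> egrad (fun y => u y - v y) x = egrad u x - egrad v x.
Proof.
move=> [du _] [dv _]; rewrite /egrad !deriveB//; exact: diff_derivable.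
Qed.

Lemma radial_derB p u v x : C1 u -> C1 v -> S2 p -> S2 x ->
  radial_der p (sgrad (fun y => u y - v y)) x =
  radial_der p (sgrad u) x - radial_der p (sgrad v) x.
Proof.
move=> cu cv hp hx; rewrite /radial_der !thetahat_sgrad// egradB//.
move: (egrad u x) (egrad v x) (thetahat p x) => [[a1 a2] a3] [[b1 b2] b3] [[c1 c2] c3].
by rewrite /dot /=; ring.
Qed.

Lemma radial_der_sqr_le p (G H : 'R3 R -> 'R3 R) x : S2 p -> S2 x ->
  (radial_der p G x - radial_der p H x) ^+ 2 <= dot (G x - H x) (G x - H x).
Proof.
move=> hp hx; apply: le_trans (thetahat_bound _ hp hx).
rewrite le_eqVlt /radial_der; apply/orP; left; apply/eqP.
move: (G x) (H x) (thetahat p x) => [[a1 a2] a3] [[b1 b2] b3] [[c1 c2] c3].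
by rewrite /dot /=; ring.
Qed.

Lemma measurable_dot2 (G H : 'R3 R -> 'R3 R) : measurable_fun S2 G ->
  measurable_fun S2 H -> measurable_fun S2 (fun x => dot (G x) (H x)).
Proof.
move=> mG mH.
have f1 : measurable_fun setT (fun x : 'R3 R => x.1.1).
  exact: (measurableT_comp (@measurable_fst _ _ _ _) (@measurable_fst _ _ _ _)).
have f2 : measurable_fun setT (fun x : 'R3 R => x.1.2).
  exact: (measurableT_comp (@measurable_snd _ _ _ _) (@measurable_fst _ _ _ _)).
have f3 : measurable_fun setT (fun x : 'R3 R => x.2) by exact: measurable_snd.
have g1 := measurableT_comp f1 mG; have g2 := measurableT_comp f2 mG.
have g3 := measurableT_comp f3 mG.
have h1 := measurableT_comp f1 mH; have h2 := measurableT_comp f2 mH.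
have h3 := measurableT_comp f3 mH.
by rewrite /dot; apply: measurable_funD; first apply: measurable_funD; exact: measurable_funM.
Qed.

Lemma measurable_dotB (G H : 'R3 R -> 'R3 R) : measurable_fun S2 G ->
  measurable_fun S2 H -> measurable_fun S2 (fun x => dot (G x - H x) (G x - H x)).
Proof.
move=> mG mH; have mGG := measurable_dot2 mG mG; have mHH := measurable_dot2 mH mH.
have mGH := measurable_dot2 mG mH.
apply: (@eq_measurable_fun _ _ _ _ _
  (fun x => dot (G x) (G x) - 2 * dot (G x) (H x) + dot (H x) (H x))).
  by move=> x _; move: (G x) (H x) => [[a1 a2] a3] [[b1 b2] b3]; rewrite /dot /=; ring.
by apply: measurable_funD => //; apply: measurable_funB => //; exact: measurable_funM.
Qed.

Lemma measurable_H1 (f : H1 R) : measurable_fun S2 f.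
Proof. by case: f. Qed.

Lemma measurable_grad (f : H1 R) : measurable_fun S2 (grad f).
Proof. by case: f. Qed.

(** The radial derivative is a contraction from gradient fields to functions in
    L2, since the polar direction has length at most 1. *)
Lemma H1_approx p (f : H1 R) : S2 p -> exists u : nat -> 'R3 R -> R,
  [/\ forall n, C1 (u n),
      N (cst 1%R) (fun x => u n x - f x) @[n --> \oo] --> 0%E &
      N (cst 1%R) (fun x => radial_der p (sgrad (u n)) x - radial_der p (grad f) x)
        @[n --> \oo] --> 0%E].
Proof.
case: f => f G mf mG f2 G2 [u [su cu cG]] hp; exists u.
have cu1 n : C1 (u n) by exact: smooth_C1.
split=> //=.
  rewrite (_ : (fun n => _) = (fun n => \int[sigma]_(x in S2) ((u n x - f x) ^+ 2)%:E)%E)//.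
  by apply/funext => n; apply: eq_integral => x _; rewrite mul1r.
have mu_ n : measurable_fun S2 (sgrad (u n)).
  by apply: measurable_funTS; exact: measurable_sgrad.
apply: (@squeeze_cvge _ _ _ _ (cst 0%E) _ _ _ _ _ cG); last exact: cvg_cst.
apply: nearW => n; rewrite wnorm2_ge0//=.
apply: ge0_le_integral.
- exact: measurable_S2.
- by move=> x _; rewrite lee_fin mul1r sqr_ge0.
- by apply: measurable_weight => //; apply: measurable_funB; exact: measurable_thetahat_dot.
- by apply/measurable_EFinP; exact: measurable_dotB.
- by move=> x hx; rewrite lee_fin mul1r radial_der_sqr_le.
Qed.

(** Approximation in H1 norm also takes place for the singular weight 1/(pi - t):
    the inequality [pole_hardy_C1] is applied to u n - u k and k tends to infinity.
    This gives the convergence of the potential terms. *)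
Lemma pole_cvg0 p (f : H1 R) (u : nat -> 'R3 R -> R) : S2 p -> (forall n, C1 (u n)) ->
  N (cst 1%R) (fun x => u n x - f x) @[n --> \oo] --> 0%E ->
  N (cst 1%R) (fun x => radial_der p (sgrad (u n)) x - radial_der p (grad f) x)
    @[n --> \oo] --> 0%E ->
  N (fun x => (pi - dist x p)^-1) (fun x => u n x - f x) @[n --> \oo] --> 0%E.
Proof.
move=> hp cu c0 c1; have mf := measurable_H1 f.
have mG := measurable_thetahat_dot hp (measurable_grad f).
have mu_ n : measurable_fun S2 (u n).
  by apply: measurable_funTS; apply: continuous_measurable_R3; exact: C1_continuous.
have mD n : measurable_fun S2 (radial_der p (sgrad (u n))).
  by apply: measurable_thetahat_dot => //; apply: measurable_funTS; exact: measurable_sgrad.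
have muf n : measurable_fun S2 (fun x => u n x - f x) by exact: measurable_funB.
have mDf n : measurable_fun S2 (fun x => radial_der p (sgrad (u n)) x - radial_der p (grad f) x).
  exact: measurable_funB.
have mW := measurable_radial hp measurable_pole.
have W0 x : S2 x -> 0 <= (pi - dist x p)^-1.
  by move=> hx; rewrite invr_ge0 subr_ge0; have /andP[] := dist_itv hp hx.
have key n : (N (fun x => (pi - dist x p)^-1)%R (fun x => u n x - f x)%R <=
    N (cst 1%R) (fun x => radial_der p (sgrad (u n)) x - radial_der p (grad f) x)%R +
    N (cst 7%R) (fun x => u n x - f x)%R)%E.
  have eqN W (g h : 'R3 R -> R) : {in S2, forall x, g x ^+ 2 = h x ^+ 2} -> N W g = N W h.
    by move=> gh; apply: eq_integral => x xS; rewrite gh.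
  apply: (@hardy_closed_L2 _ _ _ _ _ measurable_S2 _ _ _ _
    (fun k x => u n x - u k x) (fun k => radial_der p (sgrad (fun x => u n x - u k x)))) => //.
  - by move=> k; exact: measurable_funB.
  - move=> k; apply: measurable_thetahat_dot => //; apply: measurable_funTS.
    by apply: measurable_sgrad; exact: C1B.
  - by move=> k; apply: pole_hardy_C1 => //; exact: C1B.
  - rewrite (_ : (fun k => _) = (fun k => N (cst 1%R) (fun x => u k x - f x)))//.
    by apply/funext => k; apply: eqN => x _; ring.
  - rewrite (_ : (fun k => _) = (fun k => 7%:E * N (cst 1%R) (fun x => u k x - f x)%R)%E).
      by rewrite -(mule0 7%:E); exact: cvgeZl.
    apply/funext => k; rewrite -(wnorm2_cst sigma measurable_S2)//.
    by apply: eqN => x _; ring.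
  - rewrite (_ : (fun k => _) = (fun k =>
      N (cst 1%R) (fun x => radial_der p (sgrad (u k)) x - radial_der p (grad f) x)))//.
    apply/funext => k; apply: eqN => x /[!inE] hx.
    rewrite radial_derB//.
    by move: (radial_der _ _ _) (radial_der _ _ _) (radial_der _ _ _) => a b c; ring.
apply: (@squeeze_cvge _ _ _ _ (cst 0%E) _ (fun n =>
    N (cst 1%R) (fun x => radial_der p (sgrad (u n)) x - radial_der p (grad f) x)%R +
    7%:E * N (cst 1%R) (fun x => u n x - f x)%R)%E).
- apply: nearW => n; rewrite wnorm2_ge0//=.
  by rewrite -(wnorm2_cst sigma measurable_S2)//.
- exact: cvg_cst.
- have z : 0%E = (0 + 7%:E * 0)%E :> \bar R by rewrite mule0 adde0.
  rewrite [X in _ --> X]z; apply: cvgeD => //.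
  exact: cvgeZl.
Qed.

(** The potential [loss] is at most 1 + 1/(pi - t), so by [pole_cvg0] its integrals
    converge along the approximating sequence, and the inequality for C1 functions
    passes to the limit. *)
Lemma log_hardy_H1 p (f : H1 R) : S2 p ->
  (N (fun x => hardy_weight (dist x p)) f <=
   N (cst 1%R) (radial_der p (grad f)) + N (fun x => loss (dist x p)) f)%E.
Proof.
move=> hp; have [u [cu c0 c1]] := H1_approx f hp.
have c2 := pole_cvg0 hp cu c0 c1; have mf := measurable_H1 f.
have mG := measurable_thetahat_dot hp (measurable_grad f).
have mu_ n : measurable_fun S2 (u n).
  by apply: measurable_funTS; apply: continuous_measurable_R3; exact: C1_continuous.
have muf n : measurable_fun S2 (fun x => u n x - f x) by exact: measurable_funB.
have mP := measurable_radial hp measurable_pole.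
have mL := measurable_radial hp measurable_loss.
have L0 x : S2 x -> 0 <= loss (dist x p) by move=> hx; rewrite loss_ge0_cc// dist_itv.
have P0 x : S2 x -> 0 <= (pi - dist x p)^-1.
  by move=> hx; rewrite invr_ge0 subr_ge0; have /andP[] := dist_itv hp hx.
apply: (@hardy_closed_L2 _ _ _ _ _ measurable_S2 _ _ _ _ u
  (fun n => radial_der p (sgrad (u n)))) => //.
- exact: measurable_radial measurable_hardy_weight.
- by move=> n; apply: measurable_thetahat_dot => //; apply: measurable_funTS; exact: measurable_sgrad.
- by move=> x _; exact: hardy_weight_ge0.
- by move=> n; exact: log_hardy_C1.
apply: (@squeeze_cvge _ _ _ _ (cst 0%E) _ (fun n => N (cst 1%R) (fun x => u n x - f x)%R +
   N (fun x => (pi - dist x p)^-1)%R (fun x => u n x - f x)%R)%E).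
- apply: nearW => n; rewrite wnorm2_ge0//=.
  rewrite -(wnorm2D sigma measurable_S2)//; apply: (le_wnorm2 sigma measurable_S2) => //.
    exact: measurable_funD.
  move=> x hx; rewrite L0//=; have dx := dist_itv hp hx.
  apply: le_trans (ltW (loss_lt_cc dx)) _; apply: loss_bound_le.
  by have /andP[] := dx.
- exact: cvg_cst.
- by rewrite -[X in _ --> X]adde0; exact: cvgeD.
Qed.

End HardyH1.

(** * Strictness and non-attainment *)

Section Inequality.
Context {R : realType}.
Local Notation N := (wnorm2 (@sigma R) S2).
Implicit Types (p : 'R3 R) (f : H1 R).

Lemma hardy_lhsE p f : S2 p ->
  hardy_lhs (fun x => dist x p) f = N (fun x => hardy_weight (dist x p)) f.
Proof.
move=> hp; have mf := measurable_H1 f.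
rewrite /hardy_lhs /wnorm2 -ge0_integralZl_EFin//.
- by apply: eq_integral => x _; rewrite -EFinM /hardy_weight; congr (_%:E); ring.
- exact: measurable_S2.
- by move=> x _; rewrite lee_fin divr_ge0 ?sqr_ge0.
- apply/measurable_EFinP; apply: measurable_funM; first exact: measurable_funX.
  apply: (measurableT_comp measurable_invr); apply: measurable_funX.
  apply: (@measurable_radial R p (@rho_phi R)) => //.
  by apply: measurable_funM => //; exact: measurable_phi.
Qed.

Lemma hardy_rhsE p f : S2 p ->
  hardy_rhs p (fun x => pi - dist x p) f =
  (N (cst 1%R) (radial_der p (grad f)) + N (fun x => loss_bound (dist x p)) f)%E.
Proof.
move=> hp; have mf := measurable_H1 f; have p0 := @pi_gt0 R.
have mP := measurable_radial hp measurable_pole.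
have P0 x : S2 x -> 0 <= (pi - dist x p)^-1.
  by move=> hx; rewrite invr_ge0 subr_ge0; have /andP[] := dist_itv hp hx.
have c1 : 0 <= 1 / (2 * pi ^+ 2) :> R by rewrite divr_ge0// mulr_ge0// sqr_ge0.
have c2 : 0 <= 1 / (2 * pi) :> R by rewrite divr_ge0// mulr_ge0// ltW.
rewrite /hardy_rhs /energy -addeA; congr (_ + _)%E.
  by apply: eq_integral => x _; rewrite mul1r.
rewrite (wnorm2D sigma measurable_S2 (W := cst (1 / (2 * pi ^+ 2)))
  (V := fun x => 1 / (2 * pi) / (pi - dist x p)))//; last 2 first.
- by apply: measurable_funM.
- by move=> x hx; rewrite mulr_ge0// P0.
congr (_ + _)%E.
  rewrite (wnorm2_cst sigma measurable_S2)//; congr (_ * _)%E.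
  by apply: eq_integral => x _; rewrite mul1r.
rewrite /wnorm2 -ge0_integralZl_EFin//.
- by apply: eq_integral => x _; rewrite -EFinM; congr (_%:E); ring.
- exact: measurable_S2.
- by move=> x hx; rewrite lee_fin mulr_ge0 ?sqr_ge0 ?P0.
- by apply/measurable_EFinP; apply: measurable_funM => //; exact: measurable_funX.
Qed.

Definition gap (t : R) : R := loss_bound t - loss t.

Lemma measurable_gap : measurable_fun setT gap.
Proof.
apply: measurable_funB; last exact: measurable_loss.
by apply: measurable_funD => //; apply: measurable_funM => //; exact: measurable_pole.
Qed.

(** At the two poles [loss] takes the value 0 by the convention 1 / 0 = 0, so the
    strict inequality extends to the closed interval. *)
Lemma gap_gt0 t : 0 <= t <= pi -> 0 < gap t.
Proof. by move=> ht; rewrite subr_gt0 loss_lt_cc. Qed.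

(** The inequality with a remainder, which forces strictness for every nonzero
    f. *)
Lemma hardy_gap p f : S2 p ->
  (hardy_lhs (fun x => dist x p) f + N (fun x => gap (dist x p)) f <=
   hardy_rhs p (fun x => (pi - dist x p)%R) f)%E.
Proof.
move=> hp; rewrite hardy_lhsE// hardy_rhsE//.
have -> : N (fun x => loss_bound (dist x p)) f =
    (N (fun x => loss (dist x p)) f + N (fun x => gap (dist x p)) f)%E.
  rewrite -(wnorm2D sigma measurable_S2)//.
  - by apply: eq_integral => x _; rewrite /gap subrKC.
  - exact: measurable_radial measurable_loss.
  - exact: measurable_radial measurable_gap.
  - exact: measurable_H1.
  - by move=> x hx; rewrite loss_ge0_cc// dist_itv.
  - by move=> x hx; rewrite ltW// gap_gt0// dist_itv.
by rewrite [leRHS]addeA; apply: leeD => //; exact: log_hardy_H1.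
Qed.

Lemma gap_norm_gt0 p f : S2 p -> nonzero f -> (0 < N (fun x => gap (dist x p)) f)%E.
Proof.
move=> hp fn0; have g0 x : S2 x -> 0 < gap (dist x p).
  by move=> hx; rewrite gap_gt0// dist_itv.
rewrite lt0e wnorm2_ge0 ?andbT; last by move=> x hx; rewrite ltW// g0.
apply/eqP => n0; apply: fn0.
have mg : measurable_fun S2 (fun x => (gap (dist x p) * f x ^+ 2)%:E).
  by apply: measurable_weight; [exact: measurable_radial measurable_gap|exact: measurable_H1].
have [+ _] := ae_eq_integral_abs sigma measurable_S2 mg.
have -> : (\int[sigma]_(x in S2) `|(gap (dist x p) * f x ^+ 2)%:E| =
    N (fun x => gap (dist x p)) f)%E.
  apply: eq_integral => x /[!inE] hx; rewrite gee0_abs// lee_fin.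
  by rewrite mulr_ge0 ?sqr_ge0 ?(ltW (g0 x hx)).
move=> /(_ n0); apply: filterS => x /[swap] hx /(_ hx) [] /eqP.
by rewrite mulf_eq0 gt_eqF ?g0//= sqrf_eq0 => /eqP.
Qed.

(** An infinite denominator gives the quotient 0; a finite one makes a and g
    finite. *)
Lemma ratio_lt1 (a b g : \bar R) :
  (0 <= a -> 0 < g -> a + g <= b -> a / b < 1)%E.
Proof.
move=> a0 g0; case: b => [b||] ab.
- have af : a \is a fin_num.
    rewrite ge0_fin_numE//; apply: le_lt_trans (ltry b); apply: le_trans ab.
    by rewrite leeDl// ltW.
  have gf : g \is a fin_num.
    rewrite ge0_fin_numE ?ltW//; apply: le_lt_trans (ltry b); apply: le_trans ab.
    by rewrite leeDr.
  move: ab a0 g0; rewrite -(fineK af) -(fineK gf) -EFinD !lee_fin lte_fin => ab a0 g0.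
  have b0 : 0 < b by lra.
  by rewrite inver gt_eqF// -EFinM lte_fin ltr_pdivrMr// mul1r; lra.
- by rewrite invey mule0 lte_fin.
- by have := le_trans (adde_ge0 a0 (ltW g0)) ab.
Qed.

Lemma hardy_lhs_ge0 p f : S2 p -> (0 <= hardy_lhs (fun x => dist x p) f)%E.
Proof. by move=> hp; rewrite hardy_lhsE// wnorm2_ge0// => x _; exact: hardy_weight_ge0. Qed.

Lemma hardy_le p f : S2 p ->
  (hardy_lhs (fun x => dist x p) f <= hardy_rhs p (fun x => (pi - dist x p)%R) f)%E.
Proof.
move=> hp; apply: le_trans (hardy_gap f hp); rewrite leeDl//.
by apply: wnorm2_ge0 => x hx; rewrite ltW// gap_gt0// dist_itv.
Qed.

Definition sharp_at p := forall c : R, c < 1 -> exists2 f : H1 R, nonzero f &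
  (c%:E <= hardy_lhs (fun x => dist x p) f / hardy_rhs p (fun x => (pi - dist x p)%R) f)%E.

Lemma hardy_optimal p : S2 p -> sharp_at p ->
  let Q f := (hardy_lhs (fun x => dist x p) f / hardy_rhs p (fun x => (pi - dist x p)%R) f)%E in
  ereal_sup [set Q f | f in @nonzero R] = 1%E /\
  ~ (exists2 f : H1 R, nonzero f & Q f = ereal_sup [set Q g | g in @nonzero R]).
Proof.
move=> hp sharp Q; have lt1 f : nonzero f -> (Q f < 1)%E.
  move=> f0; apply: (@ratio_lt1 _ _ (N (fun x => gap (dist x p)) f)).
  - exact: hardy_lhs_ge0.
  - exact: gap_norm_gt0.
  - exact: hardy_gap.
have sup1 : ereal_sup [set Q f | f in @nonzero R] = 1%E.
  apply/eqP; rewrite eq_le; apply/andP; split.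
    by apply: ge_ereal_sup => _ [f f0 <-]; exact/ltW/lt1.
  apply/lee_addgt0Pr => e e0; have [] := sharp (1 - e); first by rewrite ltrBlDr ltrDl.
  move=> f f0 ef; rewrite -leeBlDr// -EFinB; apply: le_trans ef _.
  by apply: ereal_sup_ubound; exists f.
by split=> // -[f f0]; rewrite sup1 => f1; have := lt1 f f0; rewrite f1 ltxx.
Qed.

(** The distance to the antipode - p is pi - dist x p. *)
Lemma hardy_lhsN p f : S2 p ->
  hardy_lhs (fun x => dist x (- p)) f = hardy_lhs (fun x => pi - dist x p) f.
Proof.
move=> hp; rewrite /hardy_lhs; congr (_ * _)%E; apply: eq_integral => x /[!inE] hx.
by rewrite distN.
Qed.

Lemma hardy_rhsN p f : S2 p ->
  hardy_rhs (- p) (fun x => pi - dist x (- p)) f = hardy_rhs p (fun x => dist x p) f.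
Proof.
move=> hp; rewrite /hardy_rhs /energy; congr (_ + _ + _ * _)%E.
  apply: eq_integral => x /[!inE] hx; rewrite thetahatN//; congr (_%:E).
  by rewrite -sqrrN; congr (_ ^+ 2); rewrite /dot /=; ring.
by apply: eq_integral => x /[!inE] hx; rewrite distN// subKr.
Qed.

End Inequality.

(** * The profile of the test functions *)

Section Profile.
Context {R : realType}.
Local Notation mu := (@lebesgue_measure R).
Implicit Types (e t y : R).

Definition logw y : R := ln (y + 1) - ln y.

(** The squared chord |x - p|^2 at distance t from p, shifted by e. *)
Definition chord e t : R := 2 - 2 * cos t + e.

(** The square root of ln (1 + 1/(|x - p|^2 + e)): a regularization of the virtual
    ground state sqrt phi that is a smooth function of x on all of three-space. *)
Definition profile e t : R := expR (1 / 2 * ln (logw (chord e t))).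

Definition dlogw e t : R := 2 * sin t * ((chord e t + 1)^-1 - (chord e t)^-1).

Definition dprofile e t : R := profile e t * (1 / 2 * ((logw (chord e t))^-1 * dlogw e t)).

Lemma chord_gt0 e t : 0 < e -> 0 < chord e t.
Proof. by move=> e0; have := cos_le1 t; rewrite /chord; lra. Qed.

Lemma logw_gt0 y : 0 < y -> 0 < logw y.
Proof. by move=> y0; rewrite subr_gt0 ltr_ln ?posrE ?ltrDl// addr_gt0. Qed.

Lemma logw_ge y : 0 < y -> - ln y <= logw y.
Proof. by move=> y0; rewrite lerDr ln_ge0// lerDr ltW. Qed.

Lemma profile_sqr e t : 0 < e -> profile e t ^+ 2 = logw (chord e t).
Proof.
move=> e0; rewrite /profile -expRM_natl mulrA (_ : _ * (1 / 2) = 1); last by field.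
by rewrite mul1r lnK// posrE logw_gt0// chord_gt0.
Qed.

(** With l = logw y one has exp l = 1 + 1/y, and exp l >= (1 + l/2)^2 gives
    l^2 <= 4 / y. *)
Lemma logw_sqr_le y : 0 < y -> logw y ^+ 2 * y <= 4.
Proof.
move=> y0; have y1 : 0 < y + 1 by rewrite addr_gt0.
have l0 := logw_gt0 y0.
have h : expR (logw y) * y = y + 1.
  by rewrite /logw expRD expRN !lnK ?posrE// mulfVK// gt_eqF.
have h1 := @expR_ge1Dx R (logw y / 2).
have h2 : expR (logw y) = expR (logw y / 2) * expR (logw y / 2).
  by rewrite -expRD; congr expR; field.
move: h h1 h2 l0; move: (logw y) (expR _) (expR (_ / 2)) => l E F h h1 h2 l0.
have : (1 + l / 2) * (1 + l / 2) <= E.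
  by rewrite h2; apply: ler_pM => //; lra.
move=> hE; have : (1 + l / 2) * (1 + l / 2) * y <= E * y by rewrite ler_pM2r.
have := mulr_gt0 l0 y0; rewrite h; move=> *; nra.
Qed.

Lemma sin_sqr_le_chord e t : 0 <= e -> sin t ^+ 2 <= chord e t.
Proof.
move=> e0; have := cos_mul_cos t; have := cos_le1 t; have := cos_geN1 t; rewrite /chord.
move: (cos t) (sin t) => c s *; nra.
Qed.

(** The logarithmic singularity of [logw] is compensated by the sine, since sin^2 is
    at most the squared chord. *)
Lemma logw_sin_le e t : 0 < e -> logw (chord e t) * sin t <= 2.
Proof.
move=> e0; have g0 := chord_gt0 t e0; have l0 := logw_gt0 g0.
have h := logw_sqr_le g0; have h1 := sin_sqr_le_chord t (ltW e0).
have : (logw (chord e t) * sin t) ^+ 2 <= 4.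
  by rewrite exprMn; apply: le_trans h; rewrite ler_wpM2l// sqr_ge0.
move: (_ * _) => z *; nra.
Qed.

Lemma is_derive_logw_chord e t : 0 < e ->
  is_derive t 1 (fun t => logw (chord e t)) (dlogw e t).
Proof.
move=> e0; have g0 := chord_gt0 t e0.
have g1 : 0 < chord e t + 1 by rewrite addr_gt0.
have dg : is_derive t 1 (chord e) (2 * sin t).
  by rewrite /chord; eapply is_derive_eq; [der|rewrite /=; ring].
have dg1 : is_derive t 1 (fun t => chord e t + 1) (2 * sin t).
  by eapply is_derive_eq; [exact: (derD dg (der_cst t 1))|rewrite /=; ring].
refine (@is_derive_eq _ _ _ _ _ _ _ _ (derD (der_ln (f := fun t => chord e t + 1) g1 dg1)
  (derN (der_ln (f := chord e) g0 dg))) _).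
by rewrite /dlogw /=; field; nz.
Qed.

Lemma is_derive_profile e t : 0 < e -> is_derive t 1 (profile e) (dprofile e t).
Proof.
move=> e0; have g0 := chord_gt0 t e0; have l0 := logw_gt0 g0.
have dl := is_derive_logw_chord t e0.
refine (@is_derive_eq _ _ _ (profile e) _ _ _ _ (der_exp (derM (der_cst t (1 / 2))
  (der_ln (f := fun t => logw (chord e t)) l0 dl))) _).
rewrite /dprofile /profile /=; field; nz.
Qed.

Definition dlnlogw e t : R := sin t / (logw (chord e t) * chord e t * (chord e t + 1)).

Lemma is_derive_lnlogw e t : 0 < e ->
  is_derive t 1 (fun t => - (1 / 2 * ln (logw (chord e t)))) (dlnlogw e t).
Proof.
move=> e0; have g0 := chord_gt0 t e0; have l0 := logw_gt0 g0.
have g1 : 0 < chord e t + 1 by rewrite addr_gt0.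
have dl := is_derive_logw_chord t e0.
refine (@is_derive_eq _ _ _ _ _ _ _ _ (derN (derM (der_cst t (1 / 2))
  (der_ln (f := fun t => logw (chord e t)) l0 dl))) _).
rewrite /dlnlogw /dlogw /=; field; nz.
Qed.

Lemma continuous_dlnlogw e t : 0 < e -> {for t, continuous (dlnlogw e)}.
Proof.
move=> e0; have g0 := chord_gt0 t e0; have l0 := logw_gt0 g0.
have g1 : 0 < chord e t + 1 by rewrite addr_gt0.
have dg : is_derive t 1 (chord e) (2 * sin t).
  by rewrite /chord; eapply is_derive_eq; [der|rewrite /=; ring].
have nz0 : logw (chord e t) * chord e t * (chord e t + 1) != 0 by rewrite !mulf_neq0 ?gt_eqF.
apply: is_derive_continuous (derM (is_derive_sin t) (derV
  (f := fun t => logw (chord e t) * chord e t * (chord e t + 1)) nz0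
  (derM (derM (is_derive_logw_chord t e0) dg) (derD dg (der_cst t 1))))).
Qed.

(** The energy density is at most the derivative of - ln (logw) / 2, because sin^2 is at
    most the squared chord. *)
Lemma dprofile_sqr_le e t : 0 < e -> 0 <= sin t -> dprofile e t ^+ 2 * sin t <= dlnlogw e t.
Proof.
move=> e0 s0; have g0 := chord_gt0 t e0; have l0 := logw_gt0 g0.
have h := sin_sqr_le_chord t (ltW e0).
have -> : dprofile e t ^+ 2 = sin t ^+ 2 / (logw (chord e t) * chord e t ^+ 2 * (chord e t + 1) ^+ 2).
  have := profile_sqr t e0; rewrite /dprofile exprMn => ->.
  rewrite /dlogw; move: (chord e t) (logw _) g0 l0 => g l g0 l0.
  have g1 : 0 < g + 1 by lra.
  by field; nz.
rewrite /dlnlogw mulrC -subr_ge0.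
move: (sin t) (chord e t) (logw _) g0 l0 h s0 => s g l g0 l0 h s0.
have g1 : 0 < g + 1 by lra.
rewrite (_ : _ - _ = s * (g * (g + 1) - s ^+ 2) / (l * g ^+ 2 * (g + 1) ^+ 2)).
  rewrite divr_ge0// ?mulr_ge0 ?sqr_ge0 ?(ltW l0)//; nra.
by field; nz.
Qed.

End Profile.

(** * Weighted integrals of the profile *)

Section ProfileIntegrals.
Context {R : realType}.
Local Notation mu := (@lebesgue_measure R).
Local Notation Th := (`]0, pi[%classic : set R).
Implicit Types (e t y : R).

Lemma measurable_of_derive (f df : R -> R) : (forall t, is_derive t 1 f (df t)) ->
  measurable_fun setT f.
Proof.
by move=> d; apply: continuous_measurable_fun => t; exact: is_derive_continuous (d t).
Qed.

Lemma measurable_sin_R : measurable_fun setT (@sin R).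
Proof. by apply: continuous_measurable_fun; exact: continuous_sin. Qed.

Lemma measurable_profile e : 0 < e -> measurable_fun setT (profile e).
Proof. by move=> e0; apply: measurable_of_derive => t; exact: is_derive_profile. Qed.

Lemma continuous_dprofile e : 0 < e -> continuous (dprofile e).
Proof.
move=> e0 t; have g0 := chord_gt0 t e0; have l0 := logw_gt0 g0.
have g1 : 0 < chord e t + 1 by rewrite addr_gt0.
have dg : is_derive t 1 (chord e) (2 * sin t).
  by rewrite /chord; eapply is_derive_eq; [der|rewrite /=; ring].
have n1 : chord e t + 1 != 0 by nz.
have n2 : chord e t != 0 by nz.
have n3 : logw (chord e t) != 0 by nz.
apply: is_derive_continuous (derM (is_derive_profile t e0) (derM (der_cst t _) (derM
  (derV (f := fun t => logw (chord e t)) n3 (is_derive_logw_chord t e0))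
  (derM (derM (der_cst t _) (is_derive_sin t))
   (derD (derV (f := fun t => chord e t + 1) n1 (derD dg (der_cst t 1)))
     (derN (derV (f := chord e) n2 dg))))))).
Qed.

Lemma sin_Th t : Th t -> 0 <= sin t.
Proof. by rewrite /= in_itv/= => /sin_gt0_pi/ltW. Qed.

(** The value of [chord e] is e at 0 and at most 5 at pi. *)
Lemma energy_profile_le e : 0 < e -> e <= 1 ->
  (\int[mu]_(t in Th) (dprofile e t ^+ 2 * sin t)%:E <=
   (1 / 2 * ln (logw e) - 1 / 2 * ln (logw 5))%:E)%E.
Proof.
move=> e0 e1; have p0 := @pi_gt0 R.
apply: (@le_trans _ _ (\int[mu]_(t in Th) (dlnlogw e t)%:E)%E).
  apply: ge0_le_integral => //.
  - by move=> t /sin_Th s0; rewrite lee_fin mulr_ge0 ?sqr_ge0.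
  - apply: measurable_funTS; apply/measurable_EFinP; apply: measurable_funM; last exact: measurable_sin_R.
    by apply: measurable_funX; apply: continuous_measurable_fun; exact: continuous_dprofile.
  - apply: measurable_funTS; apply/measurable_EFinP.
    by apply: continuous_measurable_fun => t; exact: continuous_dlnlogw.
  - by move=> t /sin_Th s0; rewrite lee_fin dprofile_sqr_le.
have D1 t : 0 <= t <= pi -> _ := fun _ => is_derive_lnlogw t e0.
have D2 t : 0 <= t <= pi -> _ := fun _ => @continuous_dlnlogw R e t e0.
rewrite (FTC_Ioo p0 D1 D2).
have -> : chord e 0 = e by rewrite /chord cos0; ring.
have -> : chord e pi = 4 + e by rewrite /chord cospi; ring.
have g4 : 0 < 4 + e by lra.
rewrite lee_fin opprK addrC lerD2l lerN2 ler_pM2l//.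
rewrite ler_ln ?posrE ?logw_gt0// /logw.
rewrite -!ln_div ?posrE ?addr_gt0//.
rewrite ler_ln ?posrE ?divr_gt0 ?addr_gt0//.
rewrite ler_pdivlMr// mulrAC ler_pdivrMr//; lra.
Qed.

(** On the near half of the meridian the potential is bounded, and logw sin as well;
    on the far half logw is bounded and sin t compensates the pole of the
    potential. *)
Lemma loss_profile_pointwise e t : 0 < e -> 0 < t < pi ->
  loss_bound t * profile e t ^+ 2 * sin t <= 4.
Proof.
move=> e0 tp; have s0 := sin_gt0_pi tp; have /andP[t0 t1] := tp.
have q0 : 0 < pi - t by rewrite subr_gt0.
have g0 := chord_gt0 t e0; have l0 := logw_gt0 g0.
rewrite profile_sqr//; have b := loss_bound_le (ltW t1); have b0 := loss_lt_cc (t := t).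
have {}b0 : 0 <= loss_bound t.
  by apply: (le_trans (loss_ge0 tp)); apply: ltW; rewrite b0// !ltW.
have p3 : 3 < (pi : R) by have := @pi_bounds R; lra.
have [tpi|tpi] := leP t (pi / 2).
  have h := logw_sin_le t e0.
  have i2 : (pi - t)^-1 <= 1.
    by rewrite invf_le1//; lra.
  have : loss_bound t * (logw (chord e t) * sin t) <= 2 * 2.
    apply: ler_pM => //; last lra.
    by rewrite mulr_ge0// ltW.
  by rewrite mulrA; lra.
have l1 : logw (chord e t) <= 3 / 2.
  have c2 : cos t <= 0.
    have -> : cos t = - cos (pi - t) by rewrite cosB cospi sinpi; ring.
    by rewrite oppr_le0 cos_ge0_pihalf//; apply/andP; split; lra.
  have g2 : 2 <= chord e t by rewrite /chord; lra.
  have := logw_sqr_le g0; move: (chord e t) (logw _) l0 g2 => g l *; nra.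
have s1 := sin_le1 t; have s2 := sin_le_dist_pi (ltW t1).
have i1 : (pi - t)^-1 * sin t <= 1 by rewrite mulrC ler_pdivrMr// mul1r.
have h : loss_bound t * sin t <= 2.
  apply: (@le_trans _ _ ((1 + (pi - t)^-1) * sin t)); first by rewrite ler_pM2r.
  by rewrite mulrDl mul1r; lra.
have : loss_bound t * sin t * logw (chord e t) <= 2 * (3 / 2).
  by apply: ler_pM => //; [rewrite mulr_ge0// ltW|exact: ltW].
by rewrite mulrAC; lra.
Qed.

Lemma loss_profile_le e : 0 < e ->
  (\int[mu]_(t in Th) (loss_bound t * profile e t ^+ 2 * sin t)%:E <= (4 * pi)%:E)%E.
Proof.
move=> e0; have p0 := @pi_gt0 R.
have mB : measurable_fun setT (@loss_bound R).
  by apply: measurable_funD => //; apply: measurable_funM => //; exact: measurable_pole.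
apply: (@le_trans _ _ (\int[mu]_(t in Th) (cst 4%:E) t)%E).
  apply: ge0_le_integral => //.
  - move=> t tT; rewrite lee_fin mulr_ge0 ?sin_Th// mulr_ge0 ?sqr_ge0//.
    have tp : 0 <= t <= pi by move: tT; rewrite /= in_itv/= => /andP[/ltW -> /ltW ->].
    by rewrite (le_trans (loss_ge0_cc tp))// ltW// loss_lt_cc.
  - apply: measurable_funTS; apply/measurable_EFinP; apply: measurable_funM; last exact: measurable_sin_R.
    by apply: measurable_funM => //; apply: measurable_funX; exact: measurable_profile.
  - by move=> t; rewrite /= in_itv/= => tp; rewrite lee_fin loss_profile_pointwise.
rewrite integral_cst//= lebesgue_measure_itv/= lte_fin p0 -EFinD subr0 -EFinM.
by rewrite lee_fin.
Qed.

(** The additive error in the comparison of 2 phi t with logw (chord (e ^+ 2) t) for t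
    between e and 1. *)
Definition hardy_const : R := 3 + 2 * ln pi + ln 2.

Lemma phi_ln t : 0 < t -> phi t = 1 + ln pi - ln t.
Proof. by move=> t0; rewrite phiE// ln_div ?posrE ?pi_gt0//; ring. Qed.

(** For t >= e the shifted chord is at most 2 t^2, so logw is at least 2 phi up to an
    additive constant; sin t is t up to a relative error t^2/6. *)
Lemma hardy_profile_pointwise e t : 0 < e -> e < t -> t < 1 ->
  1 / 2 * (t * phi t)^-1 <=
  hardy_weight t * profile (e ^+ 2) t ^+ 2 * sin t + hardy_const / 4 * (t * phi t ^+ 2)^-1.
Proof.
move=> e0 et t1; have t0 : 0 < t by rewrite (lt_trans e0).
have p3 : 3 < (pi : R) by have := @pi_bounds R; lra.
have tp : 0 < t <= pi by rewrite t0; lra.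
have E0 : 0 < e ^+ 2 by rewrite exprn_gt0.
have g0 := chord_gt0 t E0; have l0 := logw_gt0 g0.
have f1 := phi_ge1 tp.
have g2 : chord (e ^+ 2) t <= 2 * t ^+ 2.
  have := cos_ge_deg2 (ltW t0).
  have : e ^+ 2 <= t ^+ 2 by rewrite ler_sqr ?nnegrE ltW.
  rewrite /chord; lra.
have lb : 2 * phi t - 2 - 2 * ln pi - ln 2 <= logw (chord (e ^+ 2) t).
  apply: le_trans (logw_ge g0).
  have : ln (chord (e ^+ 2) t) <= ln (2 * t ^+ 2) by rewrite ler_ln ?posrE ?mulr_gt0 ?exprn_gt0.
  rewrite lnM ?posrE ?exprn_gt0// lnXn// phi_ln//.
  by rewrite -mulr_natl; lra.
have s3 := sin_ge_deg3 (ltW t0).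
have lt1 : logw (chord (e ^+ 2) t) * t <= 3.
  have h := logw_sin_le t E0.
  have st : 5 / 6 * t <= sin t by move: s3 t0 t1; clear; move: (sin t) => s *; nra.
  have : logw (chord (e ^+ 2) t) * (5 / 6 * t) <= logw (chord (e ^+ 2) t) * sin t by rewrite ler_pM2l.
  lra.
have key : 2 * phi t * t <= logw (chord (e ^+ 2) t) * sin t + hardy_const * t.
  have : logw (chord (e ^+ 2) t) * (t - t ^+ 3 / 6) <= logw (chord (e ^+ 2) t) * sin t by rewrite ler_pM2l.
  have : logw (chord (e ^+ 2) t) * t * t ^+ 2 <= 3 * t.
    apply: ler_pM => //; rewrite ?mulr_ge0 ?sqr_ge0 ?ltW// expr2.
    by rewrite gtr_pMl.
  have : (2 * phi t - 2 - 2 * ln pi - ln 2) * t <= logw (chord (e ^+ 2) t) * t by rewrite ler_pM2r.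
  rewrite /hardy_const; move: (logw _) (phi t) (ln pi) (ln 2) (sin t) => l f a b s *; nra.
rewrite profile_sqr// /hardy_weight /rho_phi -subr_ge0.
have f0 : 0 < phi t by lra.
rewrite (_ : _ - _ = (logw (chord (e ^+ 2) t) * sin t + hardy_const * t - 2 * phi t * t) /
   (4 * t ^+ 2 * phi t ^+ 2)).
  by rewrite divr_ge0 ?subr_ge0// mulr_ge0 ?sqr_ge0// mulr_ge0 ?sqr_ge0.
by move: (logw _) (phi t) f0 (sin t) hardy_const => l f f0 s k; field; nz.
Qed.

Lemma FTC_phi_inv (a : R) : 0 < a -> a < 1 ->
  (\int[mu]_(t in `]a, 1%R[) ((t * phi t)^-1)%:E = (ln (phi a) - ln (phi 1))%:E)%E.
Proof.
move=> a0 a1.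
have p3 : 3 < (pi : R) by have := @pi_bounds R; lra.
have F t : a <= t <= 1 -> 0 < t /\ 0 < phi t.
  move=> /andP[at_ t1]; have t0 : 0 < t by rewrite (lt_le_trans a0).
  by split=> //; rewrite (lt_le_trans ltr01)// phi_ge1// t0; lra.
have D1 t : a <= t <= 1 -> is_derive t 1 (fun t => - ln (phi t)) ((t * phi t)^-1).
  move=> /F[t0 f0]; refine (@is_derive_eq _ _ _ _ _ _ _ _ (derN (der_ln f0 (is_derive_phi t0))) _).
  by field; nz.
have D2 t : a <= t <= 1 -> {for t, continuous (fun t => (t * phi t)^-1)}.
  move=> /F[t0 f0]; have n0 : t * phi t != 0 by rewrite mulf_neq0 ?gt_eqF.
  exact: is_derive_continuous (derV (f := fun t => t * phi t) n0 (derM (der_id t) (is_derive_phi t0))).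
by rewrite (FTC_Ioo a1 D1 D2); congr (_%:E); ring.
Qed.

Lemma FTC_phi_inv2 (a : R) : 0 < a -> a < 1 ->
  (\int[mu]_(t in `]a, 1%R[) ((t * phi t ^+ 2)^-1)%:E = ((phi 1)^-1 - (phi a)^-1)%:E)%E.
Proof.
move=> a0 a1.
have p3 : 3 < (pi : R) by have := @pi_bounds R; lra.
have F t : a <= t <= 1 -> 0 < t /\ 0 < phi t.
  move=> /andP[at_ t1]; have t0 : 0 < t by rewrite (lt_le_trans a0).
  by split=> //; rewrite (lt_le_trans ltr01)// phi_ge1// t0; lra.
have D1 t : a <= t <= 1 -> is_derive t 1 (fun t => (phi t)^-1) ((t * phi t ^+ 2)^-1).
  move=> /F[t0 f0]; have n0 : phi t != 0 by nz.
  refine (@is_derive_eq _ _ _ _ _ _ _ _ (derV n0 (is_derive_phi t0)) _).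
  by field; nz.
have D2 t : a <= t <= 1 -> {for t, continuous (fun t => (t * phi t ^+ 2)^-1)}.
  move=> /F[t0 f0]; have n0 : t * phi t ^+ 2 != 0 by rewrite mulf_neq0 ?expf_neq0 ?gt_eqF.
  exact: is_derive_continuous (derV (f := fun t => t * phi t ^+ 2) n0
    (derM (der_id t) (derX 1 (is_derive_phi t0)))).
by rewrite (FTC_Ioo a1 D1 D2).
Qed.

(** The leading term integrates to half of ln phi, the remainder term to a bounded
    quantity, since (ln phi)' = -1/(t phi) and (1/phi)' = 1/(t phi^2). *)
Lemma hardy_profile_ge e : 0 < e -> e < 1 ->
  ((1 / 2 * ln (phi e) - 1 / 2 * ln (phi 1) - hardy_const / 4)%:E <=
   \int[mu]_(t in Th) (hardy_weight t * profile (e ^+ 2) t ^+ 2 * sin t)%:E)%E.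
Proof.
move=> e0 e1; have p3 : 3 < (pi : R) by have := @pi_bounds R; lra.
have E0 : 0 < e ^+ 2 by rewrite exprn_gt0.
have sub : `]e, 1[ `<=` Th.
  by move=> t /=; rewrite !in_itv/= => /andP[et t1]; apply/andP; split; lra.
have k0 : 0 <= hardy_const.
  by rewrite /hardy_const !addr_ge0// ?mulr_ge0// ln_ge0//; lra.
have mA : measurable_fun setT (fun t => (hardy_weight t * profile (e ^+ 2) t ^+ 2 * sin t)%:E).
  apply/measurable_EFinP; apply: measurable_funM; last exact: measurable_sin_R.
  apply: measurable_funM; first exact: measurable_hardy_weight.
  by apply: measurable_funX; exact: measurable_profile.
have mP n : measurable_fun setT (fun t : R => (t * phi t ^+ n)^-1).
  apply: (measurableT_comp measurable_invr); apply: measurable_funM => //.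
  by apply: measurable_funX; exact: measurable_phi.
have A0 t : Th t -> (0 <= (hardy_weight t * profile (e ^+ 2) t ^+ 2 * sin t)%:E)%E.
  by move=> /sin_Th s0; rewrite lee_fin mulr_ge0// mulr_ge0 ?hardy_weight_ge0 ?sqr_ge0.
have P0 n t : `]e, 1[%classic t -> 0 <= (t * phi t ^+ n)^-1.
  rewrite /= in_itv/= => /andP[et t1]; have t0 := lt_trans e0 et.
  rewrite invr_ge0 mulr_ge0 ?exprn_ge0 ?(ltW t0)// (le_trans ler01)// phi_ge1// t0; lra.
apply: (@le_trans _ _ (\int[mu]_(t in `]e, 1%R[) (hardy_weight t * profile (e ^+ 2) t ^+ 2 * sin t)%:E)%E); last first.
  by apply: ge0_subset_integral => //; exact: measurable_funTS.
have f1 : 1 <= phi 1 :> R by rewrite phi_ge1// ltr01; lra.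
have fe : 1 <= phi e by rewrite phi_ge1// e0; lra.
have : (\int[mu]_(t in `]e, 1%R[) (1 / 2 * (t * phi t)^-1)%:E <=
   \int[mu]_(t in `]e, 1%R[) (hardy_weight t * profile (e ^+ 2) t ^+ 2 * sin t)%:E +
   \int[mu]_(t in `]e, 1%R[) (hardy_const / 4 * (t * phi t ^+ 2)^-1)%:E)%E.
  rewrite -ge0_integralD//; last 4 first.
  - by move=> t /sub; exact: A0.
  - exact: measurable_funTS.
  - by move=> t et; rewrite lee_fin mulr_ge0 ?P0// divr_ge0.
  - by apply: measurable_funTS; apply/measurable_EFinP; apply: measurable_funM => //; exact: mP 2%N.
  apply: ge0_le_integral => //.
  - by move=> t et; rewrite lee_fin mulr_ge0//; have := P0 1%N t et; rewrite expr1.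
  - apply: measurable_funTS; apply/measurable_EFinP; apply: measurable_funM => //.
    exact: mP 1%N.
  - apply: measurable_funTS; apply: emeasurable_funD => //.
    by apply/measurable_EFinP; apply: measurable_funM => //; exact: mP 2%N.
  - by move=> t; rewrite /= in_itv/= => /andP[et t1]; rewrite -EFinD lee_fin hardy_profile_pointwise.
under eq_integral do rewrite EFinM.
under [X in (_ <= _ + X)%E -> _]eq_integral do rewrite EFinM.
rewrite !ge0_integralZl_EFin//; last 5 first.
- by move=> t et; rewrite lee_fin P0.
- by apply: measurable_funTS; apply/measurable_EFinP; exact: mP 2%N.
- by rewrite divr_ge0.
- by move=> t et; rewrite lee_fin; have := P0 1%N t et; rewrite expr1.
- by apply: measurable_funTS; apply/measurable_EFinP; exact: mP 1%N.
rewrite FTC_phi_inv// FTC_phi_inv2// -!EFinM => H.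
rewrite -leeBlDr// in H; apply: le_trans H; rewrite -EFinB lee_fin.
have : hardy_const / 4 * ((phi 1)^-1 - (phi e)^-1) <= hardy_const / 4 * 1.
  apply: ler_wpM2l; first by rewrite divr_ge0.
  have : (phi 1)^-1 <= 1 :> R by rewrite invf_le1// (lt_le_trans ltr01).
  have : 0 <= (phi e)^-1 by rewrite invr_ge0 (le_trans ler01).
  lra.
lra.
Qed.

Lemma logw_le_phi e : 0 < e -> e < 1 -> ln (logw (e ^+ 2)) <= ln 2 + ln (phi e).
Proof.
move=> e0 e1; have E0 : 0 < e ^+ 2 by rewrite exprn_gt0.
have p3 : 3 < (pi : R) by have := @pi_bounds R; lra.
have f1 : 1 <= phi e by rewrite phi_ge1// e0; lra.
rewrite -lnM ?posrE ?ltr0n//; last exact: lt_le_trans f1.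
rewrite ler_ln ?posrE ?logw_gt0//; last by rewrite mulr_gt0// (lt_le_trans ltr01).
have : ln (e ^+ 2 + 1) <= 1.
  apply: le_trans (_ : e ^+ 2 <= 1); last by rewrite expr_le1// ltW.
  by rewrite addrC; apply: le_ln1Dx; rewrite (lt_trans _ E0)// ltrN10.
have : 0 <= ln (pi : R) by rewrite ln_ge0//; lra.
by rewrite /logw lnXn// phi_ln// -mulr_natl; lra.
Qed.

End ProfileIntegrals.

(** * Smooth elements of H1 *)

Section SmoothElements.
Context {R : realType}.
Local Notation mu := (@lebesgue_measure R).
Local Notation Th := (`]0, pi[%classic : set R).
Local Notation Ph := (`]0, (2 * pi)[%classic : set R).
Local Notation N := (wnorm2 (@sigma R) S2).
Implicit Types (p x : 'R3 R) (u : 'R3 R -> R).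

Lemma sigma_S2_lty : (@sigma R S2 < +oo)%E.
Proof.
have h := @sigma_rotE R 0 0 setT measurableT.
apply: (@le_lt_trans _ _ (sigma [set: 'R3 R])).
  by apply: le_measure; rewrite ?inE//; exact: measurable_S2.
by rewrite -h; exact: sigma_rot_lty.
Qed.

Lemma integral_S2_bounded (f : 'R3 R -> R) (M : R) : 0 <= M -> measurable_fun S2 f ->
  (forall x, S2 x -> 0 <= f x <= M) -> (\int[sigma]_(x in S2) (f x)%:E < +oo)%E.
Proof.
move=> M0 mf fM; apply: (@le_lt_trans _ _ (\int[sigma]_(x in S2) (cst M%:E) x)%E).
  apply: ge0_le_integral => //; first exact: measurable_S2.
  - by move=> x /fM/andP[f0 _]; rewrite lee_fin.
  - exact/measurable_EFinP.
  - by move=> x /fM/andP[_ h]; rewrite lee_fin.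
rewrite integral_cst//; last exact: measurable_S2.
by apply: lte_mul_pinfty; rewrite ?lee_fin//; exact: sigma_S2_lty.
Qed.

Lemma dot_sgrad_le u x : S2 x -> dot (sgrad u x) (sgrad u x) <= dot (egrad u x) (egrad u x).
Proof.
rewrite /S2 /sgrad /=; move: (egrad u x) => [[a1 a2] a3]; case: x => [[x1 x2] x3].
rewrite /dot /= => h; set k := a1 * x1 + a2 * x2 + a3 * x3.
rewrite -subr_ge0 (_ : _ - _ = k ^+ 2 * (2 - (x1 * x1 + x2 * x2 + x3 * x3))).
  by rewrite h mulr_ge0 ?sqr_ge0//; lra.
rewrite /k /GRing.scale/=; ring.
Qed.

(** The constant sequence approximates a smooth function in the H1 norm. *)
Lemma smooth_H1 u : smooth u -> exists f : H1 R, h1fun f = u /\ grad f = sgrad u.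
Proof.
move=> su; have cu := smooth_C1 su.
have mu_ : measurable_fun S2 u.
  by apply: measurable_funTS; apply: continuous_measurable_R3; exact: C1_continuous.
have mG : measurable_fun S2 (sgrad u) by apply: measurable_funTS; exact: measurable_sgrad.
have u2 : (\int[sigma]_(x in S2) (u x ^+ 2)%:E < +oo)%E.
  have [M M0 uM] := continuous_bounded_cube (C1_continuous cu).
  apply: (@integral_S2_bounded (fun x => u x ^+ 2) (M ^+ 2)); [exact: sqr_ge0|exact: measurable_funX|].
  move=> x /in_cube_sphere/uM h; rewrite sqr_ge0/= -real_normK ?num_real//.
  by rewrite ler_sqr ?nnegrE.
have G2 : (\int[sigma]_(x in S2) (dot (sgrad u x) (sgrad u x))%:E < +oo)%E.
  have [M1 M10 uM1] := continuous_bounded_cube (cu.2 (1, 0, 0)).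
  have [M2 M20 uM2] := continuous_bounded_cube (cu.2 (0, 1, 0)).
  have [M3 M30 uM3] := continuous_bounded_cube (cu.2 (0, 0, 1)).
  apply: (@integral_S2_bounded (fun x => dot (sgrad u x) (sgrad u x))
    (M1 ^+ 2 + M2 ^+ 2 + M3 ^+ 2)); [by rewrite !addr_ge0 ?sqr_ge0|exact: measurable_dot2|].
  move=> x hx; rewrite dotvv_ge0/=; apply: le_trans (dot_sgrad_le u hx) _.
  have hc := in_cube_sphere hx.
  have sq (y M : R) : `|y| <= M -> y * y <= M ^+ 2.
    move=> yM; rewrite -expr2 -(real_normK (num_real y)) ler_sqr ?nnegrE//.
    exact: le_trans yM.
  by rewrite /dot; apply: lerD; [apply: lerD|]; apply: sq; [exact: uM1|exact: uM2|exact: uM3].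
have ap : exists v : nat -> 'R3 R -> R,
      [/\ forall n, smooth (v n),
          (\int[sigma]_(x in S2) ((v n x - u x) ^+ 2)%:E)%E
            @[n --> \oo] --> 0%E
        & (\int[sigma]_(x in S2)
            (dot (sgrad (v n) x - sgrad u x) (sgrad (v n) x - sgrad u x))%:E)%E
            @[n --> \oo] --> 0%E ].
  exists (fun=> u); split=> //.
    rewrite integral0_eq; first exact: cvg_cst.
    by move=> x _; rewrite subrr expr0n.
  rewrite integral0_eq; first exact: cvg_cst.
  by move=> x _; rewrite subrr /dot /= !mul0r !addr0.
by exists (MkH1 mu_ mG u2 G2 ap).
Qed.

Lemma integral_sphere_radial al be (g : 'R3 R -> \bar R) (h : R -> R) :
  measurable_fun S2 g -> (forall x, S2 x -> 0 <= g x)%E ->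
  measurable_fun Th h -> (forall t, Th t -> 0 <= h t) ->
  (forall t y, Th t -> g (rot al be t y) = (h t)%:E) ->
  (\int[sigma]_(x in S2) g x = (2 * pi)%:E * \int[mu]_(t in Th) (h t * sin t)%:E)%E.
Proof.
move=> mg g0 mh h0 gh; rewrite (integral_sphere al be)//.
rewrite (eq_integral (cst (\int[mu]_(t in Th) (h t * sin t)%:E)%E)); last first.
  by move=> y _; apply: eq_integral => t /set_mem tT; rewrite gh// EFinM.
have p0 : 0 < 2 * pi :> R by rewrite mulr_gt0// pi_gt0.
rewrite integral_cst//= lebesgue_measure_itv/= lte_fin p0 -EFinD subr0.
by rewrite muleC.
Qed.

End SmoothElements.

(** * Sharpness of the constant *)

Section Sharpness.
Context {R : realType}.
Local Notation mu := (@lebesgue_measure R).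
Local Notation Th := (`]0, pi[%classic : set R).
Local Notation N := (wnorm2 (@sigma R) S2).
Implicit Types (p x : 'R3 R) (u : 'R3 R -> R).

Definition sqdist p x : R :=
  (x.1.1 - p.1.1) * (x.1.1 - p.1.1) + (x.1.2 - p.1.2) * (x.1.2 - p.1.2)
  + (x.2 - p.2) * (x.2 - p.2).

Definition peak p (e : R) x : R := expR (1 / 2 * ln (logw (sqdist p x + e))).

Lemma sqdist_ge0 p x : 0 <= sqdist p x.
Proof. by rewrite /sqdist -!expr2 !addr_ge0 ?sqr_ge0. Qed.

Lemma smooth_peak p e : 0 < e -> smooth (peak p e).
Proof.
move=> e0 n; have g0 x : 0 < sqdist p x + e by rewrite ltr_wpDl// sqdist_ge0.
have cg : Cdiff n (fun x => sqdist p x + e) by rewrite /sqdist; cdiff.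
apply: Cdiff_exp; apply: CdiffM; first exact: Cdiff_cst.
apply: Cdiff_ln; first by move=> x; exact: logw_gt0.
apply: CdiffD; last by apply: CdiffN; exact: Cdiff_ln.
apply: Cdiff_ln; first by move=> x; rewrite addr_gt0.
by apply: CdiffD => //; exact: Cdiff_cst.
Qed.

Lemma sqdist_rot al be t y : sqdist (sph (al, be)) (rot al be t y) = 2 - 2 * cos t.
Proof.
have h1 := dot_rot al be t y; have h2 := dot_rot_pole al be t y.
have h3 : dot (sph (al, be)) (sph (al, be)) = 1 by exact: sph_S2.
move: h1 h2 h3; rewrite /dot /sqdist; move: (rot _ _ _ _) (sph _) => x p h1 h2 h3.
lra.
Qed.

Lemma peak_rot al be e t y : peak (sph (al, be)) e (rot al be t y) = profile e t.
Proof. by rewrite /peak sqdist_rot. Qed.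

Lemma radial_der_peak al be e t y : 0 < e -> Th t ->
  radial_der (sph (al, be)) (sgrad (peak (sph (al, be)) e)) (rot al be t y) = dprofile e t.
Proof.
move=> e0; rewrite /= in_itv/= => tT.
have [dp _] := smooth_C1 (smooth_peak (sph (al, be)) e0).
rewrite /radial_der thetahat_sgrad; [|exact: sph_S2|exact: rot_S2].
rewrite thetahat_rot//.
(* Both sides are the derivative in t of u along a meridian. *)
have pE : (fun s => peak (sph (al, be)) e (rot al be s y)) = profile e.
  by apply/funext => s; exact: peak_rot.
have d1 : is_derive t 1 (profile e) (dot (egrad (peak (sph (al, be)) e) (rot al be t y))
    (rot_dth al be t y)) by rewrite -pE; exact: is_derive_rot_th.
by have [_ <-] := d1; have [_ <-] := is_derive_profile t e0.
Qed.

(** Numerator and denominator of the quotient are both 2 pi times half of ln phi e, up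
    to constants that do not depend on e. *)
Lemma peak_bounds p (e : R) (f : H1 R) : S2 p -> 0 < e -> e < 1 ->
  h1fun f = peak p (e ^+ 2) -> grad f = sgrad (peak p (e ^+ 2)) ->
  ((2 * pi * (1 / 2 * ln (phi e) - 1 / 2 * ln (phi 1) - hardy_const / 4))%:E <=
    hardy_lhs (fun x => dist x p) f)%E /\
  (hardy_rhs p (fun x => (pi - dist x p)%R) f <=
    (2 * pi * (1 / 2 * ln (phi e) + 1 / 2 * ln 2 - 1 / 2 * ln (logw 5) + 4 * pi))%:E)%E.
Proof.
move=> hp e0 e1 fE gE; have E0 : 0 < e ^+ 2 by rewrite exprn_gt0.
have E1 : e ^+ 2 <= 1 by rewrite expr_le1// ltW.
have p0 : 0 <= 2 * pi :> R by rewrite mulr_ge0// pi_ge0.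
have mf := measurable_H1 f; have mG := measurable_thetahat_dot hp (measurable_grad f).
have mB : measurable_fun setT (@loss_bound R).
  by apply: measurable_funD => //; apply: measurable_funM => //; exact: measurable_pole.
have [al [be pE]] := pole_coord hp.
have inT t : Th t -> 0 <= t <= pi by rewrite /= in_itv/= => /andP[/ltW -> /ltW ->].
have B0 t : 0 <= t <= pi -> 0 <= loss_bound t.
  by move=> tp; rewrite (le_trans (loss_ge0_cc tp))// ltW// loss_lt_cc.
have mp := measurable_profile E0.
split.
  rewrite hardy_lhsE// /wnorm2 (@integral_sphere_radial R al be _
      (fun t => hardy_weight t * profile (e ^+ 2) t ^+ 2)).
  - by rewrite EFinM lee_wpmul2l ?lee_fin// hardy_profile_ge.
  - apply: measurable_weight => //; exact: measurable_radial measurable_hardy_weight.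
  - by move=> x _; rewrite lee_fin mulr_ge0 ?sqr_ge0 ?hardy_weight_ge0.
  - apply: measurable_funTS; apply: measurable_funM; first exact: measurable_hardy_weight.
    exact: measurable_funX.
  - by move=> t _; rewrite mulr_ge0 ?sqr_ge0 ?hardy_weight_ge0.
  - by move=> t y tT; rewrite fE pE peak_rot dist_rot ?inT.
rewrite hardy_rhsE// /wnorm2.
rewrite (@integral_sphere_radial R al be _ (fun t => dprofile (e ^+ 2) t ^+ 2)); last 5 first.
- exact: measurable_weight.
- by move=> x _; rewrite lee_fin mul1r sqr_ge0.
- apply: measurable_funTS; apply: measurable_funX.
  by apply: continuous_measurable_fun; exact: continuous_dprofile.
- by move=> t _; rewrite sqr_ge0.
- by move=> t y tT; rewrite mul1r gE pE radial_der_peak.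
rewrite (@integral_sphere_radial R al be _ (fun t => loss_bound t * profile (e ^+ 2) t ^+ 2)); last 5 first.
- by apply: measurable_weight => //; exact: measurable_radial.
- by move=> x hx; rewrite lee_fin mulr_ge0 ?sqr_ge0// B0// dist_itv.
- by apply: measurable_funTS; apply: measurable_funM => //; exact: measurable_funX.
- by move=> t tT; rewrite mulr_ge0 ?sqr_ge0// B0// inT.
- by move=> t y tT; rewrite fE pE peak_rot dist_rot ?inT.
apply: le_trans (leeD (lee_wpmul2l _ (energy_profile_le E0 E1)) (lee_wpmul2l _ (loss_profile_le E0))) _.
- by rewrite lee_fin.
- by rewrite lee_fin.
rewrite -!EFinM -EFinD lee_fin -mulrDr ler_wpM2l//.
have := logw_le_phi e0 e1; lra.
Qed.

(** The function ln phi is unbounded near 0. *)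
Lemma phi_surj (X : R) : 2 <= X -> exists2 e : R, 0 < e < 1 & 1 / 2 * ln (phi e) = X.
Proof.
move=> X2; have p0 := @pi_gt0 R; have p4 : (pi : R) < 4 by have := @pi_bounds R; lra.
exists (expR (1 + ln pi - expR (2 * X))).
  rewrite expR_gt0 -[X in _ < X]expR0 ltr_expR subr_lt0/=.
  have h := @expR_ge1Dx R (2 * X).
  have h1 : ln (pi : R) <= pi - 1.
    rewrite -[X in ln X](subrKC 1); apply: le_ln1Dx; lra.
  lra.
rewrite phi_ln ?expR_gt0// expRK subKr expRK; lra.
Qed.

(** For X = ln (phi e) / 2 the quotient is at least (X - C1) / (X + C2), which tends
    to 1 as e tends to 0. *)
Lemma hardy_sharp p : S2 p -> sharp_at p.
Proof.
move=> hp c c1; have p0 : 0 < 2 * pi :> R by rewrite mulr_gt0// pi_gt0.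
pose C1 : R := 1 / 2 * ln (phi 1) + hardy_const / 4.
pose C2 : R := 1 / 2 * ln 2 - 1 / 2 * ln (logw 5) + 4 * pi.
(* X is large enough for X - C1 > 0, X + C2 > 0 and c (X + C2) <= X - C1. *)
pose X : R := 2 + `|C1| + `|C2| + `|(C1 + c * C2) / (1 - c)|.
have n1 : 0 <= `|C1| by []. have n2 : 0 <= `|C2| by [].
have n3 : 0 <= `|(C1 + c * C2) / (1 - c)| by [].
have n1' := ler_norm C1; have n2' := lerNnormlW (lexx `|C2|).
have [e /andP[e0 e1] eX] : exists2 e : R, 0 < e < 1 & 1 / 2 * ln (phi e) = X.
  by apply: phi_surj; rewrite /X; lra.
have [f [fE gE]] := smooth_H1 (smooth_peak p (exprn_gt0 2 e0)).
have [lb ub] := peak_bounds hp e0 e1 fE gE.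
rewrite eX in lb ub; set l := hardy_lhs _ _ in lb *; set r := hardy_rhs _ _ _ in ub *.
have A0 : 0 < X - C1 by rewrite /X; lra.
have XC2 : 0 < X + C2 by rewrite /X; lra.
have cX : c * (X + C2) <= X - C1.
  have : (C1 + c * C2) / (1 - c) <= X.
    by apply: le_trans (ler_norm _) _; rewrite /X; lra.
  rewrite ler_pdivrMr ?subr_gt0//; lra.
have {}lb : ((2 * pi * (X - C1))%:E <= l)%E.
  by apply: le_trans lb; rewrite lee_fin ler_pM2l// /C1; lra.
have {}ub : (r <= (2 * pi * (X + C2))%:E)%E.
  by apply: (le_trans ub); rewrite lee_fin ler_pM2l// /C2; lra.
have l0 : (0 < l)%E by apply: lt_le_trans lb; rewrite lte_fin mulr_gt0.
exists f.
  move=> f0; move: l0; rewrite /l hardy_lhsE// /wnorm2.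
  rewrite (ae_eq_integral (cst 0%E)) ?integral0 ?ltxx//.
  - exact: measurable_S2.
  - apply: measurable_weight; last exact: measurable_H1.
    exact: measurable_radial measurable_hardy_weight.
  - by apply: filterS f0 => x h /h ->; rewrite expr0n mulr0.
have lr : (l <= r)%E by exact: hardy_le.
have r0 : (0 < r)%E := lt_le_trans l0 lr.
have rf : r \is a fin_num by rewrite ge0_fin_numE ?(ltW r0)// (le_lt_trans ub)// ltry.
have lf : l \is a fin_num by rewrite ge0_fin_numE ?(ltW l0)// (le_lt_trans lr)// -ge0_fin_numE// ltW.
rewrite -/l -/r; move: lb ub r0; rewrite -(fineK rf) -(fineK lf) !lee_fin lte_fin => lb ub r0.
rewrite inver gt_eqF// -EFinM lee_fin ler_pdivlMr//; apply: le_trans lb.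
have [c0|c0] := leP 0 c.
  by apply: le_trans (ler_wpM2l c0 ub) _; rewrite mulrCA ler_pM2l.
apply: (@le_trans _ _ 0); first by rewrite mulr_le0_ge0// ltW.
by rewrite mulr_ge0// ltW.
Qed.

End Sharpness.

(** * Exchanging the two poles *)

Local Open Scope ereal_scope.

Theorem theorem4 (R : realType) (p : 'R3 R) (hp : S2 p) :
  let d (x : 'R3 R) : R := dist x p in
  let d' (x : 'R3 R) : R := (pi - dist x p)%R in
  [/\ forall f : H1 R, hardy_lhs d f <= hardy_rhs p d' f,
      forall f : H1 R, hardy_lhs d' f <= hardy_rhs p d f,
      ereal_sup [set hardy_lhs d f / hardy_rhs p d' f | f in @nonzero R] = 1
      /\ ereal_sup [set hardy_lhs d' f / hardy_rhs p d f | f in @nonzero R] = 1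
    & ~ (exists2 f : H1 R, nonzero f &
           hardy_lhs d f / hardy_rhs p d' f =
           ereal_sup [set hardy_lhs d g / hardy_rhs p d' g | g in @nonzero R])
      /\ ~ (exists2 f : H1 R, nonzero f &
           hardy_lhs d' f / hardy_rhs p d f =
           ereal_sup [set hardy_lhs d' g / hardy_rhs p d g | g in @nonzero R])].
Proof.
move=> d d'; have hn := S2N hp.
have [s1 n1] := hardy_optimal hp (hardy_sharp hp).
have [s2 n2] := hardy_optimal hn (hardy_sharp hn).
have E (f : H1 R) : hardy_lhs (fun x => dist x (- p)%R) f /
    hardy_rhs (- p)%R (fun x => (pi - dist x (- p))%R) f =
    hardy_lhs d' f / hardy_rhs p d f by rewrite hardy_lhsN// hardy_rhsN.
move: s2 n2; rewrite (eq_imagel (fun f _ => E f)) => s2 n2.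
split; last by split=> [//|[f f0]]; rewrite -E => h; apply: n2; exists f.
- by move=> f; exact: hardy_le.
- by move=> f; rewrite -(hardy_lhsN f hp) -(hardy_rhsN f hp); exact: hardy_le.
- by split.
Qed.
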